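(* Let $X$ be a transient one-dimensional regular diffusion on natural scale on $\mathbf E=(l,r)$, $-\infty\le l<r\le\infty$, with speed measure $m$, killing measure $k$ and symmetric transition density $p(t,x,y)$ with respect to $m$. Let $G_x:=\sup\{t\ge0:X_t=x\}$ be the last hitting time of $x$, and let $u(x,y)=\int_0^\infty p(t,x,y)\,dt$ be the potential kernel of $X$. Then, for $f\in L^2(m)$, $\alpha>0$ and $t>0$, $$\mathcal J^\alpha_tf(x)=u(x,x)\,E^{\mu}\!\left(J_0(2\sqrt{tG_x})\,e^{-\alpha G_x}\mathbf 1_{[G_x>0]}\right),$$ where $\mu$ is the measure on $\mathbf E$ given by $\mu(dy)=f(y)\,m(dy)$ and $J_0$ is the Bessel function of the first kind of order $0$.
   Context: The diffusion is defined by the generator $Af=\dfrac{\frac12\,d\frac{df}{dx}-f\,dk}{dm}$, where the killing measure $k$ and the speed measure $m$ are Radon measures on $(l,r)$; in the absolutely continuous case $Af=\frac{\sigma^2}{2}f''-cf$ with measurable $\sigma>0$, $c\ge0$. The transition semigroup is $P_tf(x)=\int_{\mathbf E}f(y)p(t,x,y)\,m(dy)$ with $p(t,x,y)=p(t,y,x)$; it is symmetric and strongly continuous on $L^2(m)$. $E^y$ is expectation for $X$ started at $y$ and $E^\mu(\cdot)=\int_{\mathbf E}E^y(\cdot)\,\mu(dy)$. The convention $\sup\emptyset=0$ is used. For $\alpha>0$ and $t\ge 0$, $\mathcal J^\alpha_t$ is the bounded operator on $L^2(m)$ given by the Bochner integral $$\mathcal J^{\alpha}_t f=\int_0^\infty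 J_0(2\sqrt{ts})\,e^{-\alpha s}P_sf\,ds .$$ The identity for $\mathcal J^\alpha_t f(x)$ is understood for $m$-a.e. $x$ (as elements of $L^2(m)$). *)

(* Defs.v *)
From HB Require Import structures.
From mathcomp Require Import all_boot all_order all_algebra.
From mathcomp Require Import all_classical all_reals all_analysis.
From mathcomp Require Import measurable_realfun.

Set Implicit Arguments.
Unset Strict Implicit.
Unset Printing Implicit Defensive.
Import Order.TTheory GRing.Theory Num.Theory.
Import numFieldNormedType.Exports.

Local Open Scope classical_set_scope.
Local Open Scope ring_scope.

Definition besselJ0 {R : realType} (z : R) : R :=
  limn (series (fun n : nat =>
    (-1) ^+ n * (z / 2) ^+ (2 * n) / (n`!%:R) ^+ 2)).

Definition state_space {R : realType} (l r : \bar R) : set R :=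
  [set x | (l < x%:E < r)%E].

(* A Radon measure on the open interval E is encoded as its extension by zero
   to the Borel sets of R. It need not be locally finite at the end points. *)
Definition radon_on {R : realType} (E : set R)
    (mu : {measure set R -> \bar R}) : Prop :=
  mu (~` E) = 0%E /\
  forall a b : R, E a -> E b -> (mu `[a, b]%classic < +oo)%E.

(* A killed process is given by its lifetime zeta and its positions X;
   X t w is meaningful only when 0 <= t < zeta w, and the process is in the
   cemetery from time zeta w on. P x is the law of the process started at x;
   it is meaningful only for x in the state space. *)
Section Process.
Context {R : realType} {d : measure_display} {Omega : measurableType d}.
Variables (E : set R) (zeta : Omega -> \bar R) (X : R -> Omega -> R)
  (P : R -> probability Omega R).

Definition in_at (t : R) (B : set R) : set Omega :=
  [set w | (t%:E < zeta w)%E /\ B (X t w)].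

Definition transition (t x : R) (B : set R) : \bar R := P x (in_at t B).

Definition history (t : R) : set (set Omega) :=
  <<s [set A | exists (s : R) (B : set R),
        [/\ 0 <= s, s <= t, measurable B & A = in_at s B]] >>.

Definition optional_time (tau : Omega -> \bar R) : Prop :=
  (forall w, (0 <= tau w)%E) /\
  (forall t : R, 0 < t -> history t [set w | (tau w < t%:E)%E]).

Definition history_at (tau : Omega -> \bar R) : set (set Omega) :=
  [set A | forall t : R, 0 < t -> history t (A `&` [set w | (tau w < t%:E)%E])].

Definition strong_markov : Prop :=
  forall (tau : Omega -> \bar R) (A : set Omega),
  optional_time tau -> history_at tau A ->
  forall (x s : R) (B : set R), E x -> 0 <= s -> measurable B ->
  P x (A `&` [set w | (tau w + s%:E < zeta w)%E /\
                      B (X (fine (tau w) + s) w)])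
  = (\int[P x]_(w in A `&` [set w | tau w < zeta w])
       transition s (X (fine (tau w)) w) B)%E.

Definition hits (y : R) : set Omega :=
  [set w | exists t : R, 0 <= t /\ in_at t [set y] w].

Definition bounded_continuous_on (f : R -> R) : Prop :=
  {within E, continuous f} /\ exists M, forall x, E x -> `|f x| <= M.

(* (f, g) is in the graph of the infinitesimal generator on bounded continuous
   functions, g being the bounded pointwise limit of (P_t f - f) / t. *)
Definition generator (f g : R -> R) : Prop :=
  let quotient t x :=
    ((\int[P x]_(w in in_at t setT) f (X t w)) - f x) / t in
  [/\ bounded_continuous_on f, bounded_continuous_on g,
      exists M, forall t x : R, 0 < t -> E x -> `|quotient t x| <= M &
      forall x, E x -> quotient t x @[t --> 0^'+] --> g x].

(* g = (1/2 d(df/dx) - f dk) / dm, that is, 1/2 d(df/dx) = f dk + g dm as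
   measures on E, where df/dx is the right derivative. *)
Definition krein_feller (m k : {measure set R -> \bar R}) (f g : R -> R) :
    Prop :=
  exists Df : R -> R,
    (forall x, E x -> (f (x + h) - f x) / h @[h --> 0^'+] --> Df x) /\
    (forall a b, E a -> E b -> a < b ->
       (Df b - Df a) / 2 =
       \int[k]_(x in `]a, b]) f x + \int[m]_(x in `]a, b]) g x).

(* The condition on the generator determines the process, because the domain
   of the generator contains the resolvent images of all functions that are
   continuous with compact support; the process dies on exit from E. *)
Record regular_diffusion (m k : {measure set R -> \bar R}) : Prop := {
  speed_radon : radon_on E m ;
  killing_radon : radon_on E k ;
  state_in : forall w (t : R), 0 <= t -> (t%:E < zeta w)%E -> E (X t w) ;
  path_continuous : forall w,
    {within [set t | 0 <= t /\ (t%:E < zeta w)%E], continuous (X ^~ w)} ;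
  event_measurable : forall (t : R) (B : set R), 0 <= t -> measurable B ->
    measurable (in_at t B) ;
  transition_measurable : forall (t : R) (B : set R), 0 <= t -> measurable B ->
    measurable_fun E (transition t ^~ B) ;
  started_at : forall x, E x -> P x (in_at 0 [set x]) = 1%E ;
  diffusion_strong_markov : strong_markov ;
  regular : forall x y, E x -> E y -> (0 < P x (hits y))%E ;
  diffusion_generator : forall f g, generator f g -> krein_feller m k f g
}.

Definition recurrent : Prop :=
  forall x y, E x -> E y -> P x (hits y) = 1%E.

Definition transient : Prop := ~ recurrent.

(* Joint continuity selects the version of the density for which the values
   p t x x, hence u x x, are determined. *)
Record transition_density (m : {measure set R -> \bar R})
    (p : R -> R -> R -> R) : Prop := {
  density_ge0 : forall (t x y : R), 0 < t -> E x -> E y -> 0 <= p t x y ;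
  density_sym : forall (t x y : R), 0 < t -> E x -> E y -> p t x y = p t y x ;
  density_continuous :
    {within [set z : R * R * R | [/\ 0 < z.1.1, E z.1.2 & E z.2]],
      continuous (fun z => p z.1.1 z.1.2 z.2)} ;
  density_transition : forall (t x : R) (B : set R), 0 < t -> E x -> measurable B ->
    transition t x B = (\int[m]_(y in E `&` B) (p t x y)%:E)%E
}.

(* Adding 0 to the set implements the convention that sup of the empty set
   is 0. *)
Definition last_hitting_time (x : R) (w : Omega) : \bar R :=
  ereal_sup (0%E |` [set t%:E | t in [set t | 0 <= t /\ in_at t [set x] w]]).

(* The expectation under the measure f(y) m(dy), which need be neither positive
   nor finite. *)
Definition expectation_density (m : {measure set R -> \bar R}) (f : R -> R)
    (Y : Omega -> R) : \bar R :=
  (\int[m]_(y in E) ('E_(P y)[Y] * (f y)%:E))%E.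

(* The value at G_x = +oo is the limit value 0. *)
Definition bessel_last_hitting (alpha t x : R) (w : Omega) : R :=
  if last_hitting_time x w is g%:E then
    besselJ0 (2 * Num.sqrt (t * g)) * expR (- (alpha * g)) * (0 < g)%R%:R
  else 0.

End Process.

Definition potential_kernel {R : realType} (p : R -> R -> R -> R) (x y : R) :
    \bar R :=
  (\int[lebesgue_measure]_(t in `]0%R, +oo[) (p t x y)%:E)%E.

(* Bochner integration with values in L^2(m); elements of L^2(m) are handled
   through representatives. *)
Section Bochner.
Context {R : realType}.
Variable m : {measure set R -> \bar R}.

Record simple_L2 := SimpleL2 {
  simple_size : nat ;
  simple_set : 'I_simple_size -> set R ;
  simple_coef : 'I_simple_size -> R -> R ;
  simple_measurable : forall i, measurable (simple_set i) ;
  simple_finite : forall i, (lebesgue_measure (simple_set i) < +oo)%E ;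
  simple_in_L2 : forall i, simple_coef i \in Lfun m 2%:E
}.

Definition simple_eval (S : simple_L2) (s : R) : R -> R :=
  fun x => \sum_(i < simple_size S)
    \1_(@simple_set S i) s * @simple_coef S i x.

Definition simple_integral (D : set R) (S : simple_L2) : R -> R :=
  fun x => \sum_(i < simple_size S)
    fine (lebesgue_measure (@simple_set S i `&` D)) * @simple_coef S i x.

Definition dist_L2 (f g : R -> R) : \bar R :=
  'N[m]_2%:E[EFin \o (f \- g)%R]%E.

Definition is_bochner_integral (D : set R) (F : R -> R -> R) (g : R -> R) :
    Prop :=
  [/\ g \in Lfun m 2%:E,
      {ae lebesgue_measure, forall s, D s -> F s \in Lfun m 2%:E} &
      exists S : nat -> simple_L2,
      [/\ {ae lebesgue_measure, forall s, D s ->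
             dist_L2 (F s) (simple_eval (S n) s) @[n --> \oo] --> 0%E},
          (\int[lebesgue_measure]_(s in D)
             dist_L2 (F s) (simple_eval (S n) s))%E @[n --> \oo] --> 0%E &
          dist_L2 g (simple_integral D (S n)) @[n --> \oo] --> 0%E]].

(* A representative of the Bochner integral; 0 if there is no integral. *)
Definition bochner_integral (D : set R) (F : R -> R -> R) : R -> R :=
  xget (cst 0) [set g | is_bochner_integral D F g].

End Bochner.

(* Cut off outside E, where p is meaningless. *)
Definition semigroup {R : realType} (E : set R)
    (m : {measure set R -> \bar R}) (p : R -> R -> R -> R) (t : R)
    (f : R -> R) : R -> R :=
  (fun x => \int[m]_(y in E) (f y * p t x y)) \_ E.

Definition bessel_operator {R : realType} (E : set R)
    (m : {measure set R -> \bar R}) (p : R -> R -> R -> R) (alpha t : R)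
    (f : R -> R) : R -> R :=
  bochner_integral m `]0, +oo[ (fun s x =>
    besselJ0 (2 * Num.sqrt (t * s)) * expR (- (alpha * s))
    * semigroup E m p s f x).

(* Main.v *)
(** The last hitting time of x has the density p(t, y, x) / u(x, x) under P^y.
    Indeed, the strong Markov property at the first hit of x after time s gives
    P^y(G_x > s) u(x, x) = int_s^oo p(v, y, x) dv, and transience makes
    u(x, x) finite. Hence u(x, x) E^y(J_0(2 sqrt(t G_x)) e^(- alpha G_x); G_x > 0)
    is the integral of J_0(2 sqrt(t s)) e^(- alpha s) p(s, y, x) ds, and Fubini's
    theorem turns its integral against f(y) m(dy) into that of
    J_0(2 sqrt(t s)) e^(- alpha s) P_s f(x) ds.

    This pointwise integral represents the Bochner integral, because s |-> P_s f
    is continuous in L^2 on ]0, +oo[: for f >= 0 the function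
    psi(s) = <f, P_s f> is nonincreasing, bounded and midpoint convex, and
    ||P_s f - P_t f||^2 = psi(2 s) + psi(2 t) - 2 psi(s + t). Minkowski's
    integral inequality compares the pointwise integral with those of the
    approximating simple functions. The damping survives the growth of J_0,
    because |J_0(2 sqrt(t s))| <= e^(2 t / alpha) e^(alpha s / 2). *)

Require Import Defs.
From HB Require Import structures.
From mathcomp Require Import all_boot all_order all_algebra.
From mathcomp Require Import all_classical all_reals all_analysis.
From mathcomp Require Import measurable_realfun.
From mathcomp Require Import ring lra.

Set Implicit Arguments.
Unset Strict Implicit.
Unset Printing Implicit Defensive.
Import Order.TTheory GRing.Theory Num.Theory.
Import numFieldNormedType.Exports.

Local Open Scope classical_set_scope.
Local Open Scope ring_scope.

(** * Integration *)

(** The strong Markov property is available only for the position at a fixed delay after an optional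
    time, not for a whole shifted path. Hits of [x] are therefore read off from occupation times:
    the expected time spent in an interval beyond [x] factors through the first visit to [x], and
    the factor that belongs to the interval is cancelled at the end. Identities of this kind compare
    averages over small intervals. They become identities at points because the speed measure
    charges every interval and both sides are continuous. Continuity is the obstacle: the density is
    controlled only for positive times, so the Green function of a finite horizon needs a separate
    bound near time 0. On the diagonal it comes from a path that starts elsewhere and visits the
    point after a delay; the weighted inequality between a product and two squares then carries it
    off the diagonal and makes the contribution of short times uniformly small. Finiteness of
    [u(x,x)] is obtained by contraposition: an infinite potential pushes ratios of finite-horizon
    Green functions up to 1, and these ratios bound hitting probabilities from below. *)

Local Definition sigma_finite_measure_of d (T : measurableType d)
    (R : realType) (mu : {measure set T -> \bar R})
    (s : sigma_finite setT mu) : {sigma_finite_measure set T -> \bar R} :=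
  @SigmaFiniteMeasure.Pack d T R mu
    (@SigmaFiniteMeasure.Class d T R mu
      (Measure.measure_function_isContent_mixin (Measure.class mu))
      (Measure.measure_function_Content_isMeasure_mixin (Measure.class mu))
      (isSFinite.Build d T R mu (sfinite_measure_sigma_finite s))
      (isSigmaFinite.Build d T R mu s)).

Section tonelli.
Context d1 d2 (T1 : measurableType d1) (T2 : measurableType d2) (R : realType).
Variables (m1 : {measure set T1 -> \bar R}) (m2 : {measure set T2 -> \bar R}).
Hypotheses (s1 : sigma_finite setT m1) (s2 : sigma_finite setT m2).
Variable f : T1 -> T2 -> \bar R.
Hypotheses (f0 : forall x y, (0 <= f x y)%E)
  (mf : measurable_fun setT (fun z : T1 * T2 => f z.1 z.2)).

Lemma measurable_fun_integral1 D : measurable D ->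
  measurable_fun setT (fun x => \int[m2]_(y in D) f x y)%E.
Proof.
move=> mD; pose M2 := sigma_finite_measure_of s2.
pose g z := (f z.1 z.2 * (\1_D z.2)%:E)%E.
have mg : measurable_fun setT g.
  apply: emeasurable_funM => //; apply/measurable_EFinP.
  exact: measurableT_comp.
have g0 z : (0 <= g z)%E by rewrite mule_ge0// lee_fin.
have := @measurable_fun_fubini_tonelli_F _ _ T1 T2 R M2 g mg g0.
apply: eq_measurable_fun => x _; rewrite /fubini_F.
rewrite [RHS]integral_mkcond; under [RHS]eq_integral do rewrite patchE.
transitivity (\int[m2]_y g (x, y))%E.
  exact: eq_measure_integral.
apply: eq_integral => y _; rewrite /g/= indicE.
by case: ifPn => _; rewrite ?mule1 ?mule0.
Qed.

Lemma tonelli : (\int[m1]_x \int[m2]_y f x y = \int[m2]_y \int[m1]_x f x y)%E.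
Proof.
pose M1 := sigma_finite_measure_of s1; pose M2 := sigma_finite_measure_of s2.
have f0' (z : T1 * T2) : (0 <= f z.1 z.2)%E by exact: f0.
exact: (@fubini_tonelli _ _ T1 T2 R M1 M2 (fun z => f z.1 z.2) mf f0').
Qed.

End tonelli.

Lemma tonelli_in d1 d2 (T1 : measurableType d1) (T2 : measurableType d2)
    (R : realType) (m1 : {measure set T1 -> \bar R})
    (m2 : {measure set T2 -> \bar R}) (f : T1 -> T2 -> \bar R)
    (D1 : set T1) (D2 : set T2) :
  sigma_finite setT m1 -> sigma_finite setT m2 ->
  (forall x y, (0 <= f x y)%E) ->
  measurable_fun setT (fun z : T1 * T2 => f z.1 z.2) ->
  measurable D1 -> measurable D2 ->
  (\int[m1]_(x in D1) \int[m2]_(y in D2) f x y =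
   \int[m2]_(y in D2) \int[m1]_(x in D1) f x y)%E.
Proof.
move=> s1 s2 f0 mf mD1 mD2.
pose g x y := (f x y * (\1_D1 x)%:E * (\1_D2 y)%:E)%E.
have := @tonelli _ _ _ _ _ m1 m2 s1 s2 g.
have -> : (\int[m1]_(x in D1) \int[m2]_(y in D2) f x y =
    \int[m1]_x \int[m2]_y g x y)%E.
  rewrite integral_mkcond; apply: eq_integral => x _.
  rewrite patchE /g indicE; case: ifPn => _; last first.
    by under eq_integral do rewrite mule0 mul0e; rewrite integral0.
  rewrite integral_mkcond; apply: eq_integral => y _.
  by rewrite patchE indicE mule1; case: ifPn => _; rewrite ?mule1 ?mule0.
have -> : (\int[m2]_(y in D2) \int[m1]_(x in D1) f x y =
    \int[m2]_y \int[m1]_x g x y)%E.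
  rewrite integral_mkcond; apply: eq_integral => y _.
  rewrite patchE /g [\1_D2 y]indicE; case: ifPn => _; last first.
    by under eq_integral do rewrite mule0; rewrite integral0.
  rewrite integral_mkcond; apply: eq_integral => x _.
  by rewrite patchE indicE mule1; case: ifPn => _; rewrite ?mule1 ?mule0.
apply.
  by move=> x y; rewrite !mule_ge0// lee_fin.
apply: emeasurable_funM; first (apply: emeasurable_funM => //);
  by apply/measurable_EFinP; exact: measurableT_comp.
Qed.

Lemma lebesgue_integral_shift (R : realType) (f : R -> \bar R) (a : R) :
  measurable_fun setT f -> (forall x, 0 <= f x)%E ->
  (\int[@lebesgue_measure R]_x f (x + a)%R = \int[@lebesgue_measure R]_x f x)%E.
Proof.
move=> mf f0; pose h := (fun x => x + a : measurableTypeR R) : measurableTypeR R -> _.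
have mh : measurable_fun [set: measurableTypeR R] h by exact: measurable_funD.
transitivity (\int[pushforward (@lebesgue_measure R) h]_x f x)%E.
  by rewrite ge0_integral_pushforward.
apply: eq_measure_integral => A mA _.
apply/esym/lebesgue_measure_unique => // _ [[u v] _ <-].
rewrite /pushforward/= [X in _ = lebesgue_measure X](_ : _ = `]u - a, v - a]%classic); last first.
  by apply/seteqP; split => x; rewrite /= !in_itv/= ltrBlDr lerBrDr.
rewrite !lebesgue_measure_itv/= !lte_fin ltrD2r.
by case: ifP => // _; rewrite -!EFinB; congr (_%:E); lra.
Qed.

(** * Integration against the law of a partially defined random variable with a density *)

Section integral_density.
Context d1 d2 (T1 : measurableType d1) (T2 : measurableType d2) (R : realType).
Variables (P : {measure set T1 -> \bar R}) (mu : {measure set T2 -> \bar R}).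
Variables (D : set T1) (Z : T1 -> T2) (g : T2 -> R).
Hypotheses (mD : measurable D) (mZ : measurable_fun D Z)
  (g0 : forall y, 0 <= g y) (mg : measurable_fun setT g)
  (lawZ : forall B, measurable B ->
     P (D `&` Z @^-1` B) = (\int[mu]_(y in B) (g y)%:E)%E).

Import HBNNSimple.

(** The event [D] is where [Z] is meaningful, such as survival up to a time or a positive finite
    last hit, so the law may have mass less than 1. Simple functions reduce the formula to [lawZ],
    and monotone convergence does the rest. *)
Lemma ge0_integral_density (C : set T2) (phi : T2 -> \bar R) :
  measurable C -> (forall y, (0 <= phi y)%E) -> measurable_fun setT phi ->
  (\int[P]_(w in D `&` Z @^-1` C) phi (Z w) =
   \int[mu]_(y in C) (phi y * (g y)%:E))%E.
Proof.
move=> mC phi0 mphi.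
have mDZ B : measurable B -> measurable (D `&` Z @^-1` B) by exact: mZ.
have mZC : measurable_fun (D `&` Z @^-1` C) Z.
  by apply: measurable_funS mZ => //; exact: mDZ.
pose h := nnsfun_approx measurableT mphi.
have hcvg y : (h n y)%:E @[n --> \oo] --> phi y.
  by apply: cvg_nnsfun_approx => //= *; exact: phi0.
have simpleE n : (\int[P]_(w in D `&` Z @^-1` C) (h n (Z w))%:E =
    \int[mu]_(y in C) ((h n y)%:E * (g y)%:E))%E.
  under eq_integral do rewrite fimfunE -fsumEFin//.
  rewrite ge0_integral_fsum//; last 3 first.
  - exact: mDZ.
  - move=> r; apply/measurable_EFinP; apply: measurable_funM => //.
    exact: (measurableT_comp (measurable_indic _)).
  - by move=> r w _; rewrite nnfun_muleindic_ge0.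
  transitivity (\sum_(k \in range (h n))
     \int[mu]_(y in C) ((k * \1_(h n @^-1` [set k]) y)%:E * (g y)%:E))%E.
    apply: eq_fsbigr => r _.
    (* Negative values are not attained, so their fibres are empty; a constant can be pulled out of
       the integral only if it is nonnegative. *)
    have [r0|r0] := ltP r 0%R.
      rewrite preimage_nnfun0//.
      by under eq_integral do rewrite indic0 mulr0; rewrite integral0;
         under eq_integral do rewrite indic0 mulr0 mul0e; rewrite integral0.
    under eq_integral do rewrite EFinM.
    rewrite ge0_integralZl//; [|exact: mDZ|]; last first.
      apply/measurable_EFinP.
      exact: (measurableT_comp (measurable_indic _)).
    rewrite (_ : (\int[P]_(w in _) _)%E =
        (\int[P]_(w in D `&` Z @^-1` C)
           (\1_(D `&` Z @^-1` (h n @^-1` [set r])) w)%:E)%E); last first.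
      apply: eq_integral => w /[!inE] -[Dw _].
      rewrite !indicE; congr (_%:R%:E); apply: congr1.
      by apply/idP/idP; rewrite !inE//= => -[].
    rewrite integral_indic; [|exact: mDZ|exact: mDZ].
    rewrite setIACA setIid -preimage_setI.
    rewrite lawZ; last exact: measurableI.
    rewrite integral_mkcondl/=.
    under [RHS]eq_integral do rewrite EFinM -muleA.
    rewrite ge0_integralZl//; last 2 first.
    - apply: emeasurable_funM.
        by apply/measurable_EFinP; exact: measurable_funTS.
      by apply/measurable_EFinP; exact: measurable_funTS.
    - by move=> y _; rewrite mule_ge0// lee_fin.
    congr (_ * _)%E; apply: eq_integral => y _.
    by rewrite patchE indicE; case: ifPn => _; rewrite ?mul1e ?mul0e.
  rewrite -ge0_integral_fsum//; last 2 first.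
  - move=> r; apply: emeasurable_funM.
      apply/measurable_EFinP; apply: measurable_funTS.
      exact: measurable_funM.
    by apply/measurable_EFinP; exact: measurable_funTS.
  - by move=> r y _; rewrite mule_ge0 ?EFinM ?nnfun_muleindic_ge0 ?lee_fin.
  apply: eq_integral => y _.
  rewrite -ge0_mule_fsuml; last by move=> r; rewrite EFinM nnfun_muleindic_ge0.
  by rewrite fsumEFin// -fimfunE.
have lim1 : (\int[P]_(w in D `&` Z @^-1` C) (h n (Z w))%:E)%E @[n --> \oo] -->
    (\int[P]_(w in D `&` Z @^-1` C) phi (Z w))%E.
  rewrite (_ : (\int[P]_(w in _) phi _)%E = (\int[P]_(w in D `&` Z @^-1` C)
     (fun w => limn (fun n => (h n (Z w))%:E)) w)%E); last first.
    by apply: eq_integral => w _; apply/esym/cvg_lim => //; exact: hcvg.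
  apply: cvg_monotone_convergence => //.
  - exact: mDZ.
  - move=> n; apply/measurable_EFinP.
    exact: measurableT_comp.
  - by move=> n w _; rewrite lee_fin.
  - by move=> w _ a b ab; rewrite lee_fin; exact/lefP/nd_nnsfun_approx.
have lim2 : (\int[mu]_(y in C) ((h n y)%:E * (g y)%:E))%E @[n --> \oo] -->
    (\int[mu]_(y in C) (phi y * (g y)%:E))%E.
  rewrite (_ : (\int[mu]_(w in _) (phi _ * _))%E = (\int[mu]_(y in C)
     (fun y => limn (fun n => (h n y)%:E * (g y)%:E)) y)%E); last first.
    apply: eq_integral => w _; apply/esym/cvg_lim => //.
    by apply: cvgeZr.
  apply: cvg_monotone_convergence => //.
  - move=> n; apply: measurable_funTS; apply: emeasurable_funM.
      exact/measurable_EFinP.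
    exact/measurable_EFinP.
  - by move=> n w _; rewrite mule_ge0 ?lee_fin.
  - move=> w _ a b ab; apply: lee_wpmul2r; first by rewrite lee_fin.
    by rewrite lee_fin; exact/lefP/nd_nnsfun_approx.
move: lim1; rewrite (funext simpleE) => lim1.
exact: (cvg_unique _ lim1 lim2).
Qed.

End integral_density.

(** * From continuity to measurability, boundedness and pointwise inequalities *)

Section continuity_tools.
Context {R : realType}.

(** Second countability: the boxes with rational centres and radii [1/(k+1)] that lie in [U] cover
    it. This makes the joint continuity of the density usable for the product sigma-algebra. *)
Lemma open_measurable3 (U : set (R * R * R)) : open U -> measurable U.
Proof.
move=> oU.
have [rho rhoE] : exists rho : nat -> R, rho = fun k => k.+1%:R^-1 by exists (fun k => k.+1%:R^-1).
pose J k (a : R) := [set x : R | `|a - x| < rho k].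
have mJ k a : measurable (J k a).
  by apply: open_measurable; exact: (@ball_open _ R a).
pose box k (a b c : rat) := J k (ratr a) `*` J k (ratr b) `*` J k (ratr c).
have -> : U = \bigcup_a \bigcup_b \bigcup_c \bigcup_k
    (if `[< box k a b c `<=` U >] then box k a b c else set0).
  apply/seteqP; split => [[[x y] z] Uxyz|z]; last first.
    move=> [a _] [b _] [c _] [k _].
    by case: asboolP => // BU Bz; exact: BU.
  have /nbhs_ballP[e /= e0 eU] := open_nbhs_nbhs (conj oU Uxyz).
  (* Two points of one box are each within [rho k] of its centre, hence the bound [e / 2]. *)
  have [k _ /(_ k) ke] : \forall k \near \oo, (k.+1%:R^-1 : R) < e / 2.
    by apply: near_infty_natSinv_lt (PosNum _); lra.
  have {}ke : rho k < e / 2 by rewrite rhoE; exact: ke (leqnn _).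
  have k0 : 0 < rho k by rewrite rhoE.
  have approx (v : R) : exists a : rat, J k (ratr a) v.
    have [q] := @rat_in_itvoo R (v - rho k) (v + rho k) ltac:(lra).
    rewrite in_itv/= => /andP[q1 q2]; exists q; rewrite /J/= ltr_norml; lra.
  have [a Ja] := approx x; have [b Jb] := approx y; have [c Jc] := approx z.
  exists a => //; exists b => //; exists c => //; exists k => //.
  case: asboolP => [_|]; first by [].
  case=> -[[x' y'] z'] [[/= Jx Jy] Jz]; apply: eU.
  have dist (u v w : R) : J k w u -> J k w v -> `|u - v| < e.
    move=> Ju Jv; have -> : u - v = (w - v) - (w - u) by ring.
    by apply: (le_lt_trans (ler_normB _ _)); move: Ju Jv; rewrite /J/=; lra.
  by split; [split|]; rewrite /ball/= /ball_/=; apply: dist; eassumption.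
apply: bigcupT_measurable_rat => a; apply: bigcupT_measurable_rat => b.
apply: bigcupT_measurable_rat => c; apply: bigcup_measurable => k _.
by case: ifP => // _; do 2 apply: measurableX => //.
Qed.

Lemma open_continuous_measurable_fun3 (U : set (R * R * R))
    (f : R * R * R -> R) :
  open U -> {within U, continuous f} -> measurable_fun U f.
Proof.
move=> oU cf; apply: (measurability _ (RGenOpens.measurableE R)).
move=> _ [_ [a [b ->] <-]]; apply: open_measurable3.
move: cf; rewrite continuous_open_subspace// => cf.
rewrite openE => z [Uz faz]; rewrite /interior.
apply: filterI; first exact: open_nbhs_nbhs.
have := cf z; rewrite inE => /(_ Uz); apply.
by apply: open_nbhs_nbhs; split => //; exact: interval_open.
Qed.

Lemma compact_box_bounded (U : set (R * R * R)) (f : R * R * R -> R)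
    (a1 b1 a2 b2 a3 b3 : R) :
  {within U, continuous f} ->
  `[a1, b1]%classic `*` `[a2, b2]%classic `*` `[a3, b3]%classic `<=` U ->
  exists2 M, 0 <= M & forall x y z, a1 <= x <= b1 -> a2 <= y <= b2 ->
    a3 <= z <= b3 -> `|f (x, y, z)| <= M.
Proof.
move=> cf KU.
set K := (X in X `<=` _) in KU.
have cK : compact K.
  exact: (compact_setX (compact_setX (@segment_compact R a1 b1) (@segment_compact R a2 b2)) (@segment_compact R a3 b3)).
have := continuous_compact (continuous_subspaceW KU cf) cK.
move=> /compact_bounded[M [Mreal bM]].
exists (`|M| + 1); first by rewrite addr_ge0.
move=> x y z hx hy hz; apply: bM; first by rewrite (le_lt_trans (ler_norm _))// ltrDl.
exists (x, y, z) => //; rewrite /K/= !in_itv/=; split => //; split => //.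
Qed.

Lemma continuous_Rintegral d (T : measurableType d)
    (mu : {measure set T -> \bar R}) (D : set T) (f : R -> T -> R)
    (y0 e M : R) :
  measurable D -> (mu D < +oo)%E -> 0 < e ->
  (forall y, `|y - y0| < e -> measurable_fun D (f y)) ->
  (forall y x, `|y - y0| < e -> D x -> `|f y x| <= M) ->
  (forall y x, `|y - y0| < e -> D x -> {for y, continuous (f ^~ x)}) ->
  {for y0, continuous (fun y => \int[mu]_(x in D) f y x)}.
Proof.
move=> mD Doo e0 mf fM cf.
have inI y : `]y0 - e, y0 + e[%classic y -> `|y - y0| < e.
  by rewrite /= in_itv/= ltr_norml; lra.
have cstI (c : R) : mu.-integrable D (EFin \o cst c).
  apply/integrableP; split; first exact/measurable_EFinP.
  by have /= -> := integral_cst mu mD `|c|%:E; rewrite lte_mul_pinfty.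
have := @continuity_under_integral R d T mu f D mD (y0 - e) (y0 + e).
move=> /(_ _ _ (cst M)); apply.
- move=> y /inI ye; apply: (le_integrable mD _ _ (cstI M)).
    by apply/measurable_EFinP; exact: mf.
  move=> x Dx /=; rewrite lee_fin (le_trans (fM _ _ _ _))//.
  exact: ler_norm.
- by apply: aeW => x Dx y /set_mem /inI ye; exact: cf.
- exact: cstI.
- by move=> y /inI ye; apply: aeW => x Dx; exact: fM.
- by rewrite inE /= in_itv/=; lra.
Qed.

(** If [G x < F x], the levels [c2 < c1] separate the two functions on a whole neighbourhood, and
    every set of positive finite measure inside it reverses the inequality of the averages. The sets
    [B] need not contain [x], so intervals on one side of it are admissible. *)
Lemma le_of_integral_le_near (mu : {measure set R -> \bar R}) (F G : R -> R)
    (x : R) :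
  {for x, continuous F} -> {for x, continuous G} -> 
  measurable_fun setT F -> measurable_fun setT G -> (forall y, 0 <= G y) ->
  (forall e, 0 < e -> exists B, [/\ measurable B, B `<=` ball x e,
     (0 < mu B < +oo)%E &
     (\int[mu]_(y in B) (F y)%:E <= \int[mu]_(y in B) (G y)%:E)%E]) ->
  F x <= G x.
Proof.
move=> cF cG mF mG G0 H; rewrite leNgt; apply/negP => GF.
pose c1 := (2 * F x + G x) / 3; pose c2 := (F x + 2 * G x) / 3.
have Gx0 := G0 x.
have nF : \forall y \near x, c1 < F y.
  by apply: (cvgr_gt (F x) cF); rewrite /c1; lra.
have nG : \forall y \near x, G y < c2.
  by apply: (cvgr_lt (G x) cG); rewrite /c2; lra.
have /nbhs_ballP[e /= e0 He] : \forall y \near x, c1 < F y /\ G y < c2.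
  by near=> y; split; near: y.
have [B [mB Be /andP[B0 Boo] BFG]] := H e e0.
move: BFG; apply/negP; rewrite -ltNge.
apply: (@le_lt_trans _ _ (c2%:E * mu B)%E).
  rewrite -integral_cst//; apply: ge0_le_integral => //.
  - by move=> y _; rewrite lee_fin.
  - by apply/measurable_EFinP; exact: measurable_funTS.
  - by move=> y By; rewrite lee_fin ltW//; have [] := He y (Be y By).
apply: (@lt_le_trans _ _ (c1%:E * mu B)%E).
  rewrite -(@fineK _ (mu B)) ?ge0_fin_numE// -!EFinM lte_fin.
  rewrite ltr_pM2r; first by rewrite /c1 /c2; lra.
  by rewrite fine_gt0// B0.
rewrite -integral_cst//; apply: ge0_le_integral => //.
- by move=> y _; rewrite lee_fin /c1; lra.
- by apply/measurable_EFinP; exact: measurable_funTS.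
- by move=> y By; rewrite lee_fin ltW//; have [] := He y (Be y By).
Unshelve. all: by end_near. Qed.

End continuity_tools.

(** * Paths and hitting times *)

Section process.
Context {R : realType} {d : measure_display} {Omega : measurableType d}.
Variables (zeta : Omega -> \bar R) (X : R -> Omega -> R).
Hypothesis Xcont : forall w,
  {within [set t | 0 <= t /\ (t%:E < zeta w)%E], continuous (X ^~ w)}.
Hypothesis Xmeas : forall (t : R) (B : set R), 0 <= t -> measurable B ->
  measurable (in_at zeta X t B).

Notation in_at := (in_at zeta X).
Notation history := (history zeta X).

Lemma path_near w t e : 0 <= t -> (t%:E < zeta w)%E -> 0 < e ->
  exists2 h, 0 < h & forall s, 0 <= s -> `|s - t| < h ->
    (s%:E < zeta w)%E /\ `|X s w - X t w| < e.
Proof.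
move=> t0 tz e0.
have [h1 h10 Hh1] : exists2 h, 0 < h & forall s, `|s - t| < h ->
    (s%:E < zeta w)%E.
  case: (zeta w) tz => [z| |] //.
    rewrite lte_fin => tz; exists (z - t); first by rewrite subr_gt0.
    by move=> s; rewrite lte_fin ltr_norml; lra.
  by exists 1 => // s _; rewrite ltry.
pose D := [set t | 0 <= t /\ (t%:E < zeta w)%E].
have Dt : D t by [].
have /subspace_continuousP/(_ t Dt)/cvgrPdist_lt/(_ e e0) := @Xcont w.
rewrite near_withinE => /nbhs_ballP[h2 /= h20 Hh2].
exists (Num.min h1 h2); first by rewrite lt_min h10.
move=> s s0; rewrite lt_min => /andP[sh1 sh2].
have sz := Hh1 _ sh1; split => //.
by rewrite distrC; apply: Hh2 => //=; rewrite /ball/= distrC.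
Qed.

Lemma path_within w s u : 0 <= s -> (u%:E < zeta w)%E ->
  {within `[s, u], continuous (X ^~ w)}.
Proof.
move=> s0 uz; apply: continuous_subspaceW (@Xcont w) => v /=.
rewrite in_itv/= => /andP[sv vu]; split; first exact: le_trans sv.
by rewrite (le_lt_trans _ uz)// lee_fin.
Qed.

Lemma path_IVT w s u x : 0 <= s -> s <= u -> (u%:E < zeta w)%E ->
  Num.min (X s w) (X u w) <= x <= Num.max (X s w) (X u w) ->
  exists2 v, s <= v <= u & in_at v [set x] w.
Proof.
move=> s0 su uz hx.
have [v] := IVT su (path_within s0 uz) hx.
rewrite in_itv/= => sv Xv; exists v => //; split => //.
by rewrite (le_lt_trans _ uz)// lee_fin; case/andP: sv.
Qed.

Definition hit_time s x w : \bar R :=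
  ereal_inf [set t%:E | t in [set t | s <= t /\ in_at t [set x] w]].

Lemma hit_time_ge s x w : (s%:E <= hit_time s x w)%E.
Proof. by apply: le_ereal_inf_tmp => _ [t [st _] <-]; rewrite lee_fin. Qed.

Lemma hit_time_ltP s x w c : (hit_time s x w < c)%E <->
  exists u, [/\ s <= u, (u%:E < c)%E & in_at u [set x] w].
Proof.
split.
  by move=> /ereal_inf_ltP[_ [u [su ux] <-] uc]; exists u.
by move=> [u [su uc ux]]; apply/ereal_inf_ltP; exists u%:E => //; exists u.
Qed.

(** The infimum is attained: if the path were off [x] at that time, continuity would keep it off [x]
    a little longer. Some actual hit [u] bounds the infimum, which places it before the lifetime. *)
Lemma hit_time_at s x w : 0 <= s -> (hit_time s x w < +oo)%E ->
  [/\ hit_time s x w = (fine (hit_time s x w))%:E,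
      s <= fine (hit_time s x w) &
      in_at (fine (hit_time s x w)) [set x] w].
Proof.
move=> s0 /[dup] hoo /hit_time_ltP[u [su _ [uz Xu]]].
have hge := hit_time_ge s x w.
have hE : hit_time s x w = (fine (hit_time s x w))%:E.
  by rewrite fineK// fin_numE gt_eqF ?lt_eqF// (lt_le_trans _ hge)// ltNyr.
have hu : (hit_time s x w <= u%:E)%E by apply: ereal_inf_lbound; exists u.
move: hge hu hE; move: (fine _) => c.
move=> hge hu hE; move: hge hu; rewrite {1 2}hE !lee_fin => sc cu.
have cz : (c%:E < zeta w)%E by rewrite (le_lt_trans _ uz)// lee_fin.
split => //; split => //=.
apply/eqP; apply/negPn/negP => Xc.
have e0 : 0 < `|X c w - x| by rewrite normr_gt0 subr_eq0.
have c0 := le_trans s0 sc.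
have [h h0 Hh] := path_near c0 cz e0.
have : (hit_time s x w < (c + h)%:E)%E by rewrite hE lte_fin ltrDl.
move=> /hit_time_ltP[v [sv vc [vz Xv]]].
have cv : c <= v.
  by rewrite -lee_fin -hE; apply: ereal_inf_lbound; exists v.
have [||_] := Hh v; [exact: le_trans sv|rewrite lte_fin in vc; rewrite ger0_norm; lra|].
by rewrite Xv distrC ltxx.
Qed.

Lemma in_at_history s t B : 0 <= s -> s <= t -> measurable B ->
  history t (in_at s B).
Proof. by move=> s0 st mB; apply: sub_gen_smallest; exists s, B. Qed.

Lemma history_le s t A : s <= t -> history s A -> history t A.
Proof.
move=> st; apply: smallest_sub; first exact: smallest_sigma_algebra.
move=> _ [v [B [v0 vs mB ->]]]; apply: sub_gen_smallest; exists v, B.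
by split => //; exact: le_trans st.
Qed.

Lemma history_measurable s A : history s A -> measurable A.
Proof.
apply: smallest_sub; first exact: sigma_algebra_measurable.
by move=> _ [v [B [v0 vs mB ->]]]; exact: Xmeas.
Qed.

Lemma historyI s A B : history s A -> history s B -> history s (A `&` B).
Proof.
move=> hA hB.
exact: (@measurableI _ (g_sigma_algebraType [set A | exists (s' : R) (B : set R),
  [/\ 0 <= s', s' <= s, measurable B & A = in_at s' B]]) A B hA hB).
Qed.

Lemma history0 s : history s set0.
Proof.
exact: (@measurable0 _ (g_sigma_algebraType [set A | exists (s' : R) (B : set R),
  [/\ 0 <= s', s' <= s, measurable B & A = in_at s' B]])).
Qed.

Lemma historyT s : history s setT.
Proof.
exact: (@measurableT _ (g_sigma_algebraType [set A | exists (s' : R) (B : set R),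
  [/\ 0 <= s', s' <= s, measurable B & A = in_at s' B]])).
Qed.

Lemma history_bigcup_rat t (F : rat -> set Omega) :
  (forall q, history t (F q)) -> history t (\bigcup_q F q).
Proof.
move=> hF.
exact: (@bigcupT_measurable_rat _ (g_sigma_algebraType [set A | exists (s' : R) (B : set R),
  [/\ 0 <= s', s' <= t, measurable B & A = in_at s' B]]) F hF).
Qed.

Lemma history_bigcap t (F : nat -> set Omega) :
  (forall q, history t (F q)) -> history t (\bigcap_q F q).
Proof.
move=> hF.
exact: (@bigcapT_measurable _ (g_sigma_algebraType [set A | exists (s' : R) (B : set R),
  [/\ 0 <= s', s' <= t, measurable B & A = in_at s' B]]) F hF).
Qed.

(* A path avoiding x on a compact time interval stays away from x there, so a
   hit can be detected along rational times. *)
Lemma hit_before_history s t x : 0 <= s ->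
  history t [set w | (hit_time s x w < t%:E)%E].
Proof.
move=> s0.
(* Survival at the rational time [q] makes the path continuous on the compact interval from [s] to
   [q]. The times [p] are strictly after [s], since a hit at [s] itself is seen from the rational
   times just after it. *)
pose F (q : rat) := if (s < ratr q) && (ratr q < t) then
  in_at (ratr q) setT `&` \bigcap_k \bigcup_(p : rat)
    (if (s < ratr p) && (ratr p <= ratr q :> R) then
       in_at (ratr p) [set y | `|y - x| < k.+1%:R^-1] else set0)
  else set0.
have -> : [set w | (hit_time s x w < t%:E)%E] = \bigcup_q F q.
  apply/seteqP; split => [w /= /hit_time_ltP[u [su ut [uz Xu]]]|w [q _]].
    have [e e0 He] := path_near (le_trans s0 su) uz ltr01.
    rewrite lte_fin in ut.
    have [q] := @rat_in_itvoo R u (Num.min t (u + e)) ltac:(by rewrite lt_min ut/= ltrDl).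
    rewrite in_itv/= lt_min => /and3P[uq qt qe].
    have q0 : 0 <= ratr q :> R by lra.
    exists q => //; rewrite /F (le_lt_trans su uq) qt /=; split.
      by split => //; apply: (He _ q0 _).1; rewrite gtr0_norm; lra.
    move=> k _.
    have k0 : 0 < k.+1%:R^-1 :> R by [].
    have [h h0 Hh] := path_near (le_trans s0 su) uz k0.
    have [p] := @rat_in_itvoo R u (Num.min (ratr q) (u + h)) ltac:(by rewrite lt_min uq/= ltrDl).
    rewrite in_itv/= lt_min => /and3P[up pq ph].
    exists p => //; rewrite (le_lt_trans su up) (ltW pq)/=.
    have [||pz pX] := Hh (ratr p); [lra|rewrite gtr0_norm; lra|].
    by split => //=; rewrite -Xu.
  rewrite /F; case: ifP => // /andP[sq qt] [[qz _] H].
  pose g v := `|X v w - x|.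
  have cg : {within `[s, ratr q], continuous g}.
    move=> v; apply: (@continuous_comp (subspace `[s, ratr q]) R R (X ^~ w) (fun y => `|y - x|) v).
      exact: (path_within s0 qz).
    by apply: cvg_norm; apply: cvgB; [exact: cvg_id|exact: cvg_cst].
  have [c] := EVT_min (ltW sq) cg.
  rewrite in_itv/= => /andP[sc cq] cmin.
  have cz : (c%:E < zeta w)%E by rewrite (le_lt_trans _ qz)// lee_fin.
  have [gc|gc] := eqVneq (g c) 0.
    apply/hit_time_ltP; exists c; split => //.
      by rewrite lte_fin (le_lt_trans cq).
    by split => //=; apply/eqP; rewrite -subr_eq0 -normr_eq0; exact/eqP.
  have {}gc : 0 < g c by rewrite lt_neqAle eq_sym gc /g normr_ge0.
  have [k _ /(_ k) kc] := near_infty_natSinv_lt (PosNum gc).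
  have {}kc := kc (leqnn k).
  have [p _] := H k I.
  case: ifP => // /andP[sp pq] [_ /= /lt_trans/(_ kc)].
  by rewrite ltNge cmin// in_itv/= pq ltW.
apply: history_bigcup_rat => q; rewrite /F.
case: ifP => [/andP[sq qt]|_]; last exact: history0.
apply: historyI; first by apply: in_at_history => //; lra.
apply: history_bigcap => k; apply: history_bigcup_rat => p.
case: ifP => [/andP[sp pq]|_]; last exact: history0.
apply: in_at_history; [lra|lra|].
apply: open_measurable.
rewrite (_ : [set _ | _] = ball x k.+1%:R^-1); first exact: ball_open.
by apply/seteqP; split => y; rewrite /ball/= distrC.
Qed.

Lemma hit_before_measurable s x c : 0 <= s ->
  measurable [set w | (hit_time s x w < c)%E].
Proof.
move=> s0; case: c => [c| |].
- exact: (history_measurable (@hit_before_history s c x s0)).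
- rewrite (_ : [set _ | _] =
      \bigcup_n [set w | (hit_time s x w < n%:R%:E)%E]).
    apply: bigcup_measurable => n _.
    exact: (history_measurable (@hit_before_history s n%:R x s0)).
  apply/seteqP; split => w /=.
    move=> /(hit_time_at s0)[hE hs _].
    exists (Num.bound (fine (hit_time s x w))) => //=.
    by rewrite [ltLHS]hE lte_fin archi_boundP// (le_trans s0).
  by move=> [n _] /= /lt_le_trans; apply; exact: leey.
- rewrite (_ : [set _ | _] = set0)//.
  by apply/seteqP; split => w //=; rewrite ltNge leNye.
Qed.

Lemma hit_time_measurable s x : 0 <= s -> measurable_fun setT (hit_time s x).
Proof.
move=> s0; apply: (measurability _ (ErealGenInftyO.measurableE R)).
move=> _ [_ [c ->]] <-; rewrite setTI.
rewrite (_ : _ @^-1` _ = [set w | (hit_time s x w < c%:E)%E]).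
  exact: hit_before_measurable.
by apply/seteqP; split => w; rewrite /= in_itv.
Qed.

(** Events are measurable at each fixed time; Tonelli's theorem over time and paths needs joint
    measurability. By continuity, a position strictly inside the interval at [t] means that at all
    rational times near [t] the path keeps a margin [1/(k+1)] from the end points, and the margin
    survives the passage to the limit. *)
Lemma alive_joint_measurable a b :
  measurable [set z : R * Omega | 0 <= z.1 /\ in_at z.1 `]a, b[%classic z.2].
Proof.
pose J k := [set y : R | a + k.+1%:R^-1 <= y <= b - k.+1%:R^-1].
have mJ k : measurable (J k).
  exact: (@measurable_itv R `[a + k.+1%:R^-1, b - k.+1%:R^-1]).
pose F (q1 q2 : rat) k := ([set t : R | ratr q1 < t < ratr q2 /\ 0 <= t] `*`
  \bigcap_(q in [set q : rat | ratr q1 < (ratr q : R) < ratr q2 /\ 0 <= (ratr q : R)])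
     in_at (ratr q) (J k)).
rewrite (_ : [set _ | _] = \bigcup_q1 \bigcup_q2 \bigcup_k F q1 q2 k).
  apply: bigcupT_measurable_rat => q1; apply: bigcupT_measurable_rat => q2.
  apply: bigcup_measurable => k _; apply: measurableX.
    rewrite (_ : [set _ | _] = `]ratr q1, ratr q2[%classic `&` `[0, +oo[%classic).
      exact: measurableI.
    by apply/seteqP; split => t /=; rewrite !in_itv/= andbT.
  rewrite bigcap_mkcond -[X in measurable X]setCK setC_bigcap.
  apply: measurableC; apply: bigcupT_measurable_rat => q; apply: measurableC.
  by case: ifPn => // /set_mem[_ q0]; exact: Xmeas.
apply/seteqP; split => [[t w] /= [t0 [tz]]|[t w] [q1 _ [q2 _ [k _ [[/= /andP[q1t tq2] t0] H]]]]].
  rewrite /= in_itv/= => /andP[aX Xb].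
  pose e := Num.min (X t w - a) (b - X t w) / 2.
  have e0 : 0 < e by rewrite divr_gt0// lt_min !subr_gt0 aX.
  have [h h0 Hh] := path_near t0 tz e0.
  have [q1] := @rat_in_itvoo R (t - h) t ltac:(lra).
  rewrite in_itv/= => /andP[hq1 q1t].
  have [q2] := @rat_in_itvoo R t (t + h) ltac:(lra).
  rewrite in_itv/= => /andP[tq2 q2h].
  have [k _ /(_ k) ke] := near_infty_natSinv_lt (PosNum e0).
  have {}ke : k.+1%:R^-1 < e := ke (leqnn k).
  exists q1 => //; exists q2 => //; exists k => //; split => /=; first by rewrite q1t.
  move=> q /= [/andP[q1q qq2] q0].
  have [||qz qX] := Hh (ratr q); [by []|rewrite ltr_norml; lra|].
  split => //; rewrite /J/=.
  have ea : e <= (X t w - a) / 2 by rewrite ler_pM2r// ge_min lexx.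
  have eb : e <= (b - X t w) / 2 by rewrite ler_pM2r// ge_min lexx orbT.
  move: ke qX; move: (k.+1%:R^-1) => r; rewrite ltr_norml; lra.
(* Survival at [t] follows from survival at a later rational time. *)
have [q] := rat_in_itvoo tq2; rewrite in_itv/= => /andP[tq qq2].
have [qz _] := H q ltac:(by split; [rewrite qq2 (lt_trans q1t)|lra]).
have tz : (t%:E < zeta w)%E by rewrite (lt_trans _ qz)// lte_fin.
split => //; split => //=; rewrite in_itv/=.
have k0 : 0 < k.+1%:R^-1 :> R by [].
have [h h0 Hh] := path_near t0 tz k0.
have [p] := @rat_in_itvoo R t (Num.min (ratr q2) (t + h)) ltac:(by rewrite lt_min tq2/= ltrDl).
rewrite in_itv/= lt_min => /and3P[tp pq2 ph].
have [pz] := H p ltac:(by split; [rewrite pq2 (lt_trans q1t)|lra]).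
have [||_] := Hh (ratr p); [lra|rewrite gtr0_norm; lra|].
rewrite /J/=; move: (k.+1%:R^-1) => r; rewrite ltr_norml; lra.
Qed.

End process.

(** * The strong Markov property at a hitting time *)

Section strong_markov_at_hit.
Context {R : realType} {d : measure_display} {Omega : measurableType d}.
Variables (E : set R) (zeta : Omega -> \bar R) (X : R -> Omega -> R)
  (P : R -> probability Omega R).
Hypothesis Xcont : forall w,
  {within [set t | 0 <= t /\ (t%:E < zeta w)%E], continuous (X ^~ w)}.
Hypothesis Xmeas : forall (t : R) (B : set R), 0 <= t -> measurable B ->
  measurable (in_at zeta X t B).
Hypothesis Xmarkov : strong_markov E zeta X P.

Notation in_at := (in_at zeta X).
Notation history := (history zeta X).
Notation hit_time := (hit_time zeta X).
Notation transition := (transition zeta X P).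

Lemma hit_before_inf_history s t x c : 0 <= s ->
  history t ([set w | (hit_time s x w < c)%E] `&`
             [set w | (hit_time s x w < t%:E)%E]).
Proof.
move=> s0; case: c => [c| |].
- have [ct|tc] := leP c t.
    rewrite setIidl; last by move=> w /= /lt_le_trans; apply; rewrite lee_fin.
    by apply: (history_le ct); exact: hit_before_history.
  rewrite setIidr; last by move=> w /= /lt_trans; apply; rewrite lte_fin.
  exact: hit_before_history.
- rewrite setIidr; first exact: hit_before_history.
  by move=> w /= /lt_le_trans; apply; exact: leey.
- rewrite (_ : [set w | _] = set0); first by rewrite set0I; exact: history0.
  by apply/seteqP; split => w //=; rewrite ltNge leNye.
Qed.

Lemma hit_time_optional s x : 0 <= s -> optional_time zeta X (hit_time s x).
Proof.
move=> s0; split=> [w|t t0].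
  by rewrite (le_trans _ (hit_time_ge _ _ _ _ _))// lee_fin.
exact: hit_before_history.
Qed.

(** At the hitting time the path sits at [x], so the integrand of the strong Markov property is
    constant. The event [hit_time s x w < c] belongs to the past of the hitting time and is kept in
    order to control finite horizons. *)
Lemma strong_markov_hit s x c A y v B : 0 <= s -> history s A -> E y ->
  0 <= v -> measurable B ->
  P y (A `&` [set w | (hit_time s x w < c)%E] `&`
       [set w | (hit_time s x w < +oo)%E /\ in_at (fine (hit_time s x w) + v) B w])
  = (P y (A `&` [set w | (hit_time s x w < c)%E] `&`
          [set w | (hit_time s x w < +oo)%E]) * transition v x B)%E.
Proof.
move=> s0 hA Ey v0 mB.
set A' := A `&` _.
have hA' : history_at zeta X (hit_time s x) A'.
  (* The event [A] is known only from time [s] on; for [t <= s] no hit after [s] can precede [t], so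
     the intersection is empty. *)
  move=> t t0; have [ts|st] := leP t s.
    rewrite (_ : _ `&` _ = set0); first exact: history0.
    apply/seteqP; split => w //= -[_ /lt_le_trans].
    move=> /(_ s%:E); rewrite lee_fin => /(_ ts).
    by rewrite ltNge hit_time_ge.
  rewrite /A' -setIA; apply: historyI; first exact: history_le (ltW st) hA.
  exact: hit_before_inf_history.
have := Xmarkov (hit_time_optional x s0) hA' Ey v0 mB.
have lt_pinfty w : (hit_time s x w < zeta w)%E -> (hit_time s x w < +oo)%E.
  by move=> /lt_le_trans; apply; exact: leey.
rewrite (_ : A' `&` [set w | (_ + _ < _)%E /\ _] = A' `&`
  [set w | (hit_time s x w < +oo)%E /\ in_at (fine (hit_time s x w) + v) B w]).
  move=> ->.
  rewrite (_ : A' `&` [set w | (_ < zeta w)%E] = A' `&` [set w | (hit_time s x w < +oo)%E]).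
    rewrite muleC -integral_cst; last first.
      apply: measurableI; [apply: measurableI|]; last 2 first.
      - exact: hit_before_measurable.
      - exact: hit_before_measurable.
      exact: history_measurable hA.
    apply: eq_integral => w /[!inE] -[_ /=] /(hit_time_at Xcont s0)[_ _ [_ /= ->]].
    by [].
  congr (_ `&` _); apply/seteqP; split => w /=; first exact: lt_pinfty.
  by move=> /(hit_time_at Xcont s0)[hE _ [+ _]]; rewrite -hE.
congr (_ `&` _); apply/seteqP; split => w /= -[h1 h2].
  have h1' : (hit_time s x w < +oo)%E.
    rewrite ltey; apply: contraTneq h1 => ->.
    by rewrite addye// ltNge leey.
  split => //; split => //.
  by have [hE _ _] := hit_time_at Xcont s0 h1'; rewrite EFinD -hE.
case: h2 => h2 h3; split => //.
by have [hE _ _] := hit_time_at Xcont s0 h1; rewrite hE -EFinD.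
Qed.

End strong_markov_at_hit.

(** * Occupation times of intervals before and after a hit *)

Section occupation.
Context {R : realType} {d : measure_display} {Omega : measurableType d}.
Variables (E : set R) (zeta : Omega -> \bar R) (X : R -> Omega -> R)
  (P : R -> probability Omega R).
Hypothesis Xcont : forall w,
  {within [set t | 0 <= t /\ (t%:E < zeta w)%E], continuous (X ^~ w)}.
Hypothesis Xmeas : forall (t : R) (B : set R), 0 <= t -> measurable B ->
  measurable (in_at zeta X t B).
Hypothesis Xmarkov : strong_markov E zeta X P.

Notation in_at := (in_at zeta X).
Notation history := (history zeta X).
Notation hit_time := (hit_time zeta X).
Notation transition := (transition zeta X P).
Notation mu := (@lebesgue_measure R).

(** With [h] constant this describes occupation after a fixed time, with [h] the hitting time
    occupation after the hit. Both become sets of pairs of a delay and a path, which are compared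
    path by path after exchanging the integrals. *)
Local Definition delayed (a b : R) (I : set R) (A : set Omega) (h : Omega -> R) :
  set (R * Omega) := [set z | [/\ I z.1, A z.2, 0 <= h z.2 + z.1 &
    in_at (h z.2 + z.1) `]a, b[%classic z.2]].

Let mcst (r : R) : measurable_fun [set: Omega] (cst r : Omega -> R).
Proof. exact: measurable_cst. Qed.

Lemma delayed_measurable a b I A h : measurable I -> measurable A ->
  measurable_fun setT h -> measurable (delayed a b I A h).
Proof.
move=> mI mA mh.
pose k (z : R * Omega) := (h z.2 + z.1, z.2).
have mk : measurable_fun setT k.
  apply: measurable_fun_pair => //; apply: measurable_funD => //.
  exact: (measurableT_comp mh).
rewrite (_ : delayed _ _ _ _ _ = (I `*` A) `&`
  k @^-1` [set z | 0 <= z.1 /\ in_at z.1 `]a, b[%classic z.2]).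
  apply: measurableI; first exact: measurableX.
  rewrite -[X in measurable X]setTI; apply: mk => //.
  exact: alive_joint_measurable.
apply/seteqP; split => [z [? ? ? ?]//|z /= [[? ?] [? ?]]].
by split.
Qed.

Lemma measurable_section (v : R) (D : set (R * Omega)) : measurable D ->
  measurable [set w | D (v, w)].
Proof.
move=> mD; rewrite (_ : [set w | _] = xsection D v).
  exact: measurable_xsection.
by apply/seteqP; split => w; rewrite /xsection/= inE.
Qed.

Lemma probability_section y (D : set (R * Omega)) v : measurable D ->
  (P y [set w | D (v, w)] = \int[P y]_w (\1_D (v, w))%:E)%E.
Proof.
move=> mD; have mDv := measurable_section v mD.
transitivity (\int[P y]_w (\1_[set w | D (v, w)] w)%:E)%E.
  by rewrite integral_indic// setIT.
by apply: eq_integral => w _; rewrite !indicE; congr (_%:R%:E);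
  apply/idP/idP; rewrite !inE.
Qed.

Lemma measurable_indic_section (D : set (R * Omega)) : measurable D ->
  measurable_fun setT (fun z : R * Omega => (\1_D (z.1, z.2) : R)%:E).
Proof.
move=> mD; apply/measurable_EFinP.
rewrite (_ : (fun z : R * Omega => _) = \1_D); first exact: measurable_indic.
by apply/funext => -[].
Qed.

Lemma indic_section_measurable (D : set (R * Omega)) w (c : R) : measurable D ->
  measurable_fun setT (fun v : R => (\1_D (v + c, w) : R)%:E).
Proof.
move=> mD; apply/measurable_EFinP.
apply: (measurableT_comp (f := \1_D : R * Omega -> R)); first exact: measurable_indic.
by apply: measurable_fun_pair => //; exact: measurable_funD.
Qed.

Local Lemma indic_EFin_ge0 (D : set (R * Omega)) v w :
  (0 <= (\1_D (v, w) : R)%:E)%E.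
Proof. by rewrite lee_fin. Qed.

Lemma tonelli_probability y (D : set (R * Omega)) : measurable D ->
  (\int[mu]_v P y [set w | D (v, w)] =
   \int[P y]_w \int[mu]_v (\1_D (v, w))%:E)%E.
Proof.
move=> mD; under eq_integral do rewrite probability_section//.
apply: (@tonelli _ _ _ _ _ mu (P y) _ _ (fun v w => (\1_D (v, w))%:E)).
- exact: sigma_finiteT.
- exact: sigma_finiteT.
- exact: indic_EFin_ge0.
- exact: measurable_indic_section.
Qed.

Lemma probability_section_measurable y (D : set (R * Omega)) : measurable D ->
  measurable_fun setT (fun v => P y [set w | D (v, w)]).
Proof.
move=> mD.
have := @measurable_fun_integral1 _ _ _ _ R (P y) (sigma_finiteT _)
  (fun v w => (\1_D (v, w))%:E) (fun v w => indic_EFin_ge0 D v w) (measurable_indic_section mD) setT measurableT.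
by apply: eq_measurable_fun => v _; rewrite probability_section.
Qed.

Lemma section_time_measurable (D : set (R * Omega)) : measurable D ->
  measurable_fun setT (fun w => \int[mu]_v (\1_D (v, w) : R)%:E)%E.
Proof.
move=> mD.
have m1 : measurable_fun setT
    (fun z : Omega * R => (\1_D (z.2, z.1) : R)%:E).
  exact: (measurableT_comp (measurable_indic_section mD) (@measurable_swap _ _ _ _)).
exact: (@measurable_fun_integral1 _ _ _ _ R mu (sigma_finiteT _)
  (fun w v => (\1_D (v, w))%:E) (fun w v => indic_EFin_ge0 D v w) m1 setT measurableT).
Qed.

Variables (x s : R) (A : set Omega) (a b y : R).
Hypotheses (s0 : 0 <= s) (hA : history s A) (Ey : E y).
Let B := `]a, b[%classic : set R.
Let tau := hit_time s x.

Lemma delayed_const (I : set R) v : I v -> 0 <= s + v ->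
  [set w | delayed a b I A (cst s) (v, w)] = A `&` in_at (s + v) B.
Proof.
by move=> Iv sv; apply/seteqP; split => [w [? ? ? ?]|w [? ?]]; split.
Qed.

Lemma integral_delayed_const (I : set R) (I0 : forall v, I v -> 0 < v) :
  (\int[mu]_v P y [set w | delayed a b I A (cst s) (v, w)] =
   \int[mu]_(v in I) P y (A `&` in_at (s + v) B))%E.
Proof.
rewrite [RHS]integral_mkcond; apply: eq_integral => v _; rewrite patchE.
case: ifPn => [/[!inE] Iv|]; last first.
  rewrite notin_setE => nIv; rewrite (_ : [set w | _] = set0) ?measure0//.
  by apply/seteqP; split => w // [].
by rewrite delayed_const// addr_ge0// ltW// I0.
Qed.

Lemma delayed_probability_measurable (I : set R) : measurable I ->
  (forall v, I v -> 0 < v) ->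
  measurable_fun I (fun v => P y (A `&` in_at (s + v) B)).
Proof.
move=> mI I0; have mA := history_measurable Xmeas hA.
have := probability_section_measurable y (delayed_measurable a b mI mA (mcst s)).
move=> /(measurable_funS measurableT (@subsetT _ I)).
apply: eq_measurable_fun => v /[!inE] Iv.
by rewrite delayed_const// addr_ge0// ltW// I0.
Qed.

(** For each fixed delay the strong Markov property splits off the probability of the hit;
    integrating over the delays turns this into a statement on occupation times. *)
Lemma integral_delayed_hit (I : set R) (c : \bar R) : measurable I ->
  (forall v, I v -> 0 < v) ->
  (\int[mu]_v P y [set w | delayed a b I
      (A `&` [set w | (tau w < c)%E] `&` [set w | (tau w < +oo)%E])
      (fine \o tau) (v, w)] =
   P y (A `&` [set w | (tau w < c)%E] `&` [set w | (tau w < +oo)%E]) *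
   \int[mu]_(v in I) transition v x B)%E.
Proof.
move=> mI I0.
have mv : measurable_fun I (fun v => transition v x B).
  have := probability_section_measurable x (delayed_measurable a b mI measurableT (mcst 0)).
  move=> /(measurable_funS measurableT (@subsetT _ I)).
  apply: eq_measurable_fun => v /[!inE] Iv; congr (P x _).
  have v0 := ltW (I0 _ Iv).
  apply/seteqP; split => [w [/= ? ? ?]|w ?]; rewrite ?add0r//.
  by split => //=; rewrite add0r.
rewrite -ge0_integralZl//.
rewrite [RHS]integral_mkcond; apply: eq_integral => v _; rewrite patchE.
case: ifPn => [/[!inE] Iv|]; last first.
  rewrite notin_setE => nIv; rewrite (_ : [set w | _] = set0) ?measure0//.
  by apply/seteqP; split => w // [].
have v0 := ltW (I0 _ Iv).
rewrite -(strong_markov_hit Xcont Xmeas Xmarkov)//; last exact: measurable_itv.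
congr (P y _); apply/seteqP; split => [w /= [_ [[? ?] ?] _ ?]//|w /= [[? ?] [? ?]]].
split => //=; have [_ st _] := hit_time_at Xcont s0 (x := x) (w := w) ltac:(by []).
by rewrite addr_ge0// (le_trans s0).
Qed.

(** The point [x] separates [C] from [B], so a path that is in [C] at time [s] visits [B] only after
    a hit of [x]. Counted from the hit, the delay of each such visit is shorter than counted from
    [s], and it stays in [I] because [I] is closed downwards. *)
Lemma occupation_le (I : set R) (C : set R) : measurable I -> (forall v, I v -> 0 < v) ->
  (forall v u, I v -> 0 < u <= v -> I u) ->
  A `<=` in_at s C ->
  (forall c z, C c -> B z -> (z < x < c) \/ (c < x < z)) ->
  (\int[mu]_(v in I) P y (A `&` in_at (s + v) B) <=
   P y (A `&` [set w | (tau w < +oo)%E]) *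
   \int[mu]_(v in I) transition v x B)%E.
Proof.
move=> mI I0 Idown AC CB.
have mA := history_measurable Xmeas hA.
have mtau := hit_time_measurable Xcont Xmeas x s0.
have mfine : measurable_fun setT (fine \o tau).
  exact: (measurableT_comp (@fine_measurable _ setT measurableT)).
have mA' c : measurable (A `&` [set w | (tau w < c)%E] `&` [set w | (tau w < +oo)%E]).
  by apply: measurableI; [apply: measurableI|] => //; exact: hit_before_measurable.
have <- : A `&` [set w | (tau w < +oo)%E] `&` [set w | (tau w < +oo)%E] =
    A `&` [set w | (tau w < +oo)%E] by rewrite -setIA setIid.
rewrite -(integral_delayed_hit _ mI I0) -integral_delayed_const//.
have mD1 := delayed_measurable a b mI mA (mcst s).
have mD2 := delayed_measurable a b mI (mA' +oo%E) mfine.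
rewrite (tonelli_probability y mD1) (tonelli_probability y mD2).
apply: ge0_le_integral; [exact: measurableT| | | |].
- by move=> w _; apply: integral_ge0 => v _; exact: indic_EFin_ge0.
- exact: section_time_measurable.
- exact: section_time_measurable.
move=> w _.
have hit_w v : delayed a b I A (cst s) (v, w) ->
    (tau w <= (s + v)%:E)%E /\ ~ B x.
  move=> [/= Iv Aw sv0 [svz Bv]].
  have [sz Cs] := AC _ Aw.
  have v0 := ltW (I0 _ Iv).
  split; last by move=> Bx; have [] := CB _ _ Cs Bx; rewrite ltxx ?andbF.
  have [|u /andP[su uv] ux] := path_IVT (x := x) Xcont s0 (ltac:(lra) : s <= s + v) svz.
    by have [/andP[h1 h2]|/andP[h1 h2]] := CB _ _ Cs Bv;
      rewrite ge_min le_max (ltW h1) (ltW h2) ?orbT.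
  apply: (@le_trans _ _ u%:E); last by rewrite lee_fin.
  by apply: ereal_inf_lbound; exists u.
have [tauoo|] := leP +oo%E (tau w).
  rewrite [X in (X <= _)%E](_ : _ = 0%E); last first.
    apply: integral0_eq => v _; rewrite indicE.
    case: (boolP (_ \in _)) => // /set_mem.
    move=> /hit_w[] /(le_trans tauoo); by rewrite leNgt ltry.
  by apply: integral_ge0 => v _; exact: indic_EFin_ge0.
move=> /[dup] tauoo /(hit_time_at Xcont s0)[tauE st [_ tauX]].
rewrite -/tau in tauE st tauX.
set D2 := delayed _ _ _ _ (fine \o tau).
(* On a fixed path the translation by [s - fine (tau w)] aligns the clock started at the hit with
   the one started at [s]. *)
rewrite -(@lebesgue_integral_shift _ (fun v => (\1_D2 (v, w))%:E) (s - fine (tau w))); last 2 first.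
- by have := indic_section_measurable w 0 mD2; under eq_fun do rewrite addr0.
- by move=> v; rewrite lee_fin.
apply: ge0_le_integral; [exact: measurableT| | | |].
- by move=> v _; rewrite lee_fin.
- by have := indic_section_measurable w 0 mD1; under eq_fun do rewrite addr0.
- exact: indic_section_measurable.
- move=> v _; rewrite lee_fin !indicE ler_nat.
  case: (boolP (_ \in delayed _ _ I A _)) => // /set_mem D1v.
  have [tv Bx] := hit_w v D1v.
  rewrite mem_set//.
  move: D1v tv; rewrite [tau w]tauE lee_fin => -[/= Iv Aw sv0 svB] tv.
  have tv' : fine (tau w) + (v + (s - fine (tau w))) = s + v by ring.
  split => /=; rewrite ?tv'//.
  (* The delay after the hit is strictly positive: were it 0, the path would be at [x], which is not
     in [B]. *)
  apply: (Idown _ _ Iv); apply/andP; split; last lra.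
  rewrite lt_neqAle; apply/andP; split; last lra.
  apply/eqP => h0; apply: Bx; rewrite -tauX.
  have -> : fine (tau w) = s + v by lra.
  by case: svB.
Qed.

(** Nothing is assumed about the positions of [x] and [B]: visits to [B] after the hit are among all
    visits after [s]. A hit before [s + c] lengthens a delay by less than [c], so [J] must contain
    the delays of [I] enlarged in this way; [c] is infinite when the horizon is. *)
Lemma occupation_ge (I J : set R) (c : \bar R) : measurable I -> measurable J ->
  (forall v, I v -> 0 < v) -> (forall v, J v -> 0 < v) ->
  (forall v u, I v -> 0 <= u -> (u%:E < c)%E -> J (v + u)) ->
  (P y (A `&` [set w | (tau w < s%:E + c)%E]) *
   \int[mu]_(v in I) transition v x B <=
   \int[mu]_(v in J) P y (A `&` in_at (s + v) B))%E.
Proof.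
move=> mI mJ I0 J0 IJ.
have mA := history_measurable Xmeas hA.
have mtau := hit_time_measurable Xcont Xmeas x s0.
have mfine : measurable_fun setT (fine \o tau).
  exact: (measurableT_comp (@fine_measurable _ setT measurableT)).
have mA' : measurable (A `&` [set w | (tau w < s%:E + c)%E] `&` [set w | (tau w < +oo)%E]).
  by apply: measurableI; [apply: measurableI|] => //; exact: hit_before_measurable.
rewrite [X in P y X](_ : _ = A `&` [set w | (tau w < s%:E + c)%E] `&`
    [set w | (tau w < +oo)%E]); last first.
  apply/esym/setIidl => w [_] /= /lt_le_trans; apply; exact: leey.
rewrite -(integral_delayed_hit _ mI I0) -integral_delayed_const//.
have mD1 := delayed_measurable a b mJ mA (mcst s).
have mD2 := delayed_measurable a b mI mA' mfine.
rewrite (tonelli_probability y mD1) (tonelli_probability y mD2).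
apply: ge0_le_integral; [exact: measurableT| | | |].
- by move=> w _; apply: integral_ge0 => v _; exact: indic_EFin_ge0.
- exact: section_time_measurable.
- exact: section_time_measurable.
move=> w _.
have [tauoo|] := leP +oo%E (tau w).
  rewrite [X in (X <= _)%E](_ : _ = 0%E); last first.
    apply: integral0_eq => v _; rewrite indicE.
    case: (boolP (_ \in _)) => // /set_mem.
    by move=> -[/= _ [_]]; rewrite ltNge tauoo.
  by apply: integral_ge0 => v _; exact: indic_EFin_ge0.
move=> /[dup] tauoo /(hit_time_at Xcont s0)[tauE st [_ tauX]].
rewrite -/tau in tauE st tauX.
set D1 := delayed _ _ J _ _.
rewrite -(@lebesgue_integral_shift _ (fun v => (\1_D1 (v, w))%:E) (fine (tau w) - s)); last 2 first.
- by have := indic_section_measurable w 0 mD1; under eq_fun do rewrite addr0.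
- by move=> v; rewrite lee_fin.
apply: ge0_le_integral; [exact: measurableT| | | |].
- by move=> v _; rewrite lee_fin.
- by have := indic_section_measurable w 0 mD2; under eq_fun do rewrite addr0.
- exact: indic_section_measurable.
- move=> v _; rewrite lee_fin !indicE ler_nat.
  case: (boolP (_ \in delayed _ _ I _ _)) => // /set_mem.
  move=> -[/= Iv [[Aw tc] _] sv0 svB].
  rewrite mem_set//.
  have tv' : s + (v + (fine (tau w) - s)) = fine (tau w) + v by ring.
  split => /=; rewrite ?tv'//.
  apply: IJ => //; first by rewrite subr_ge0.
  by rewrite EFinB -tauE lteBlDl.
Qed.

End occupation.

(** * The transition density *)

Section state_space.
Context {R : realType}.
Variables l r : \bar R.
Local Notation E := (state_space l r).

Lemma state_space_between a b x : E a -> E b -> a <= x <= b -> E x.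
Proof.
rewrite /state_space/= => /andP[la ar] /andP[lb br] /andP[ax xb].
by rewrite (lt_le_trans la) ?lee_fin//= (le_lt_trans _ br)// lee_fin.
Qed.

Lemma state_space_open : open E.
Proof.
rewrite (_ : E = [set x | (l < x%:E)%E] `&` [set x | (x%:E < r)%E]); last first.
  by apply/seteqP; split => x /=; rewrite /state_space/= => /andP.
apply: openI.
- case: l => [c| |].
  + rewrite (_ : [set x | _] = `]c, +oo[%classic); first exact: rray_open.
    by apply/seteqP; split => x /=; rewrite in_itv/= andbT lte_fin.
  + rewrite (_ : [set x | _] = set0); first exact: open0.
    by apply/seteqP; split => x //=; rewrite ltNge leey.
  + rewrite (_ : [set x | _] = setT); first exact: openT.
    by apply/seteqP; split => x //=; rewrite ltNyr.
- case: r => [c| |].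
  + rewrite (_ : [set x | _] = `]-oo, c[%classic); first exact: lray_open.
    by apply/seteqP; split => x /=; rewrite in_itv/= lte_fin.
  + rewrite (_ : [set x | _] = setT); first exact: openT.
    by apply/seteqP; split => x //=; rewrite ltry.
  + rewrite (_ : [set x | _] = set0); first exact: open0.
    by apply/seteqP; split => x //=; rewrite ltNge leNye.
Qed.

Lemma state_space_measurable : measurable E.
Proof. exact: open_measurable state_space_open. Qed.

Lemma state_space_margin x : E x -> exists2 e, 0 < e &
  forall y, `|y - x| <= e -> E y.
Proof.
move=> Ex; have /nbhs_ballP[e /= e0 He] := open_nbhs_nbhs (conj state_space_open Ex).
exists (e / 2); first by rewrite divr_gt0.
by move=> y hy; apply: He; rewrite /ball/= distrC; lra.
Qed.

End state_space.

Lemma approx_from_above {R : realType} (l : \bar R) (c : R) : (l < c%:E)%E ->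
  exists a : nat -> R, [/\ nonincreasing_seq a, forall n, (l < (a n)%:E)%E &
    forall x, (l < x%:E)%E -> exists n, a n < x].
Proof.
case: l => [l| |] //.
- rewrite lte_fin => lc; exists (fun n => l + (c - l) / n.+1%:R).
  have cl0 : 0 < c - l by rewrite subr_gt0.
  split.
  + move=> n k nk; rewrite lerD2l ler_pM2l// lef_pV2 ?posrE//.
    by rewrite ler_nat.
  + by move=> n; rewrite lte_fin ltrDl divr_gt0.
  + move=> x; rewrite lte_fin => lx.
    have e0 : 0 < (x - l) / (c - l) by rewrite divr_gt0// subr_gt0.
    have [n _ /(_ n (leqnn n)) hn] := near_infty_natSinv_lt (PosNum e0).
    exists n; rewrite -ltrBrDl mulrC -ltr_pdivlMr//.
- move=> _; exists (fun n => - n%:R); split.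
  + by move=> n k nk; rewrite lerN2 ler_nat.
  + by move=> n; rewrite ltNyr.
  + move=> x _; exists (Num.bound `|x|); rewrite ltrNl.
    by apply: le_lt_trans (archi_boundP (normr_ge0 x)); rewrite -normrN ler_norm.
Qed.

Lemma state_space_exhaustion {R : realType} (l r : \bar R) : (l < r)%E ->
  exists a b : nat -> R,
  [/\ nonincreasing_seq a, nondecreasing_seq b,
      forall n x, a n <= x <= b n -> state_space l r x &
      forall x, state_space l r x -> exists n, a n < x < b n].
Proof.
move=> lr.
have [c /andP[lc cr]] : exists c : R, (l < c%:E < r)%E.
  case: l lr => [l| |]; case: r => [r| |] //.
  - by rewrite lte_fin => lr; exists ((l + r) / 2); rewrite !lte_fin; apply/andP; split; lra.
  - by exists (l + 1); rewrite lte_fin ltrDl ltr01 ltry.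
  - by exists (r - 1); rewrite lte_fin ltrBlDr ltrDl ltr01 ltNyr.
  - by exists 0; rewrite ltNyr ltry.
have [a [a1 a2 a3]] := approx_from_above lc.
(* The upper end point is treated as the lower end point of the reflected interval. *)
have [b [b1 b2 b3]] : exists b : nat -> R, [/\ nonincreasing_seq b,
    forall n, (- r < (b n)%:E)%E &
    forall x, (- r < x%:E)%E -> exists n, b n < x].
  by apply: (@approx_from_above _ _ (- c)); rewrite EFinN lteN2.
exists a, (fun n => - b n); split => //.
- by move=> n k nk; rewrite lerN2; exact: b1.
- move=> n x /andP[ax xb]; rewrite /state_space/= (lt_le_trans (a2 n)) ?lee_fin//=.
  by rewrite -lteN2 (lt_le_trans (b2 n))// -EFinN lee_fin lerNr.
- move=> x; rewrite /state_space/= => /andP[lx xr].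
  have [n1 h1] := a3 x lx.
  have [n2 h2] := b3 (- x) ltac:(by rewrite EFinN lteN2).
  exists (maxn n1 n2); apply/andP; split.
    by apply: le_lt_trans h1; apply: a1; exact: leq_maxl.
  by rewrite ltrNr; apply: le_lt_trans h2; apply: b1; exact: leq_maxr.
Qed.

Section density.
Context {R : realType} {d : measure_display} {Omega : measurableType d}.
Variables (l r : \bar R) (m k : {measure set R -> \bar R})
  (p : R -> R -> R -> R) (zeta : Omega -> \bar R) (X : R -> Omega -> R)
  (P : R -> probability Omega R).
Hypothesis lr : (l < r)%E.
Let E := state_space l r.
Hypothesis RD : regular_diffusion E zeta X P m k.
Hypothesis TD : transition_density E zeta X P m p.

Notation in_at := (in_at zeta X).
Notation history := (history zeta X).
Notation transition := (transition zeta X P).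

Definition density_domain : set (R * R * R) :=
  [set z | [/\ 0 < z.1.1, state_space l r z.1.2 & state_space l r z.2]].

(* Extending the density by 0 makes it measurable and symmetric on the whole
   space, so that integrals over the state space become integrals over R. *)
Definition ext_density t x y : R :=
  ((fun z : R * R * R => p z.1.1 z.1.2 z.2) \_ density_domain) (t, x, y).

Local Notation q := ext_density.

Lemma ext_density_in t x y : 0 < t -> E x -> E y -> q t x y = p t x y.
Proof. by move=> t0 Ex Ey; rewrite /ext_density patchE mem_set. Qed.

Lemma ext_density_out t x y : ~ [/\ 0 < t, E x & E y] -> q t x y = 0.
Proof. by move=> h; rewrite /ext_density patchE memNset. Qed.

Lemma ext_density_ge0 t x y : 0 <= q t x y.
Proof.
rewrite /ext_density patchE; case: ifPn => // /set_mem[/= t0 Ex Ey].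
exact: (density_ge0 TD).
Qed.

Lemma ext_density_sym t x y : q t x y = q t y x.
Proof.
have [[t0 Ex Ey]|h] := pselect [/\ 0 < t, E x & E y].
  by rewrite !ext_density_in//; exact: (density_sym TD).
rewrite !ext_density_out// => -[? ? ?]; apply: h; by split.
Qed.

Lemma density_domain_open : open density_domain.
Proof.
rewrite openE => -[[t x] y] [/= t0 Ex Ey]; rewrite /interior.
have [ex ex0 hx] := state_space_margin Ex.
have [ey ey0 hy] := state_space_margin Ey.
apply/nbhs_ballP; exists (Num.min t (Num.min ex ey)) => /=.
  by rewrite !lt_min t0 ex0.
move=> [[t' x'] y'] [[/= bt bx] by_].
have min1 : Num.min t (Num.min ex ey) <= t by rewrite ge_min lexx.
have min2 : Num.min t (Num.min ex ey) <= ex by rewrite !ge_min lexx orbT.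
have min3 : Num.min t (Num.min ex ey) <= ey by rewrite !ge_min lexx !orbT.
move: bt bx by_; rewrite /ball/= => bt bx by_.
split => /=.
- by move: (lt_le_trans bt min1); rewrite ltr_norml; lra.
- by apply: hx; rewrite distrC (le_trans (ltW bx)).
- by apply: hy; rewrite distrC (le_trans (ltW by_)).
Qed.

Lemma ext_density_measurable :
  measurable_fun setT (fun z : R * R * R => q z.1.1 z.1.2 z.2).
Proof.
rewrite (_ : (fun z => _) = (fun z : R * R * R => p z.1.1 z.1.2 z.2) \_ density_domain).
  apply/(measurable_restrictT _ _).1.
    exact: open_measurable3 density_domain_open.
  exact: open_continuous_measurable_fun3 density_domain_open (density_continuous TD).
by apply/funext => -[[]].
Qed.

Lemma ext_density_continuous t x y : 0 < t -> E x -> E y ->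
  {for (t, x, y), continuous (fun z : R * R * R => q z.1.1 z.1.2 z.2)}.
Proof.
move=> t0 Ex Ey.
have := density_continuous TD.
rewrite continuous_open_subspace; last exact: density_domain_open.
move=> /(_ (t, x, y)); rewrite inE => /(_ (And3 t0 Ex Ey)) cp.
have -> : (fun z : R * R * R => q z.1.1 z.1.2 z.2) = (fun z : R * R * R => p z.1.1 z.1.2 z.2) \_ density_domain.
  by apply/funext => -[[]].
have Dt : density_domain (t, x, y) by [].
have nD := open_nbhs_nbhs (conj density_domain_open Dt).
rewrite /prop_for /continuous_at patchE mem_set//.
apply: cvg_trans cp; apply: near_eq_cvg; near=> z.
by rewrite patchE mem_set//; near: z.
Unshelve. all: by end_near. Qed.

Lemma ext_density_continuous2 t x y : 0 < t -> E x -> E y ->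
  {for y, continuous (q t x)}.
Proof.
move=> t0 Ex Ey.
apply: (@continuous_comp _ _ _ (fun y => (t, x, y)) (fun z : R * R * R => q z.1.1 z.1.2 z.2)).
  by rewrite /continuous_at; apply: (@cvg_pair _ _ _ (nbhs y) (nbhs (t, x)) (nbhs y));
    [exact: cvg_cst|exact: cvg_id].
exact: ext_density_continuous.
Qed.

Lemma ext_density_continuous_time t x y : 0 < t -> E x -> E y ->
  {for t, continuous (fun s => q s x y)}.
Proof.
move=> t0 Ex Ey.
apply: (@continuous_comp _ _ _ (fun t => (t, x, y)) (fun z : R * R * R => q z.1.1 z.1.2 z.2)).
  rewrite /continuous_at; apply: (@cvg_pair _ _ _ (nbhs t) (nbhs (t, x)) (nbhs y)); last exact: cvg_cst.
  by apply: (@cvg_pair _ _ _ (nbhs t) (nbhs t) (nbhs x)); [exact: cvg_id|exact: cvg_cst].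
exact: ext_density_continuous.
Qed.

Lemma ext_density_bounded t1 t2 a1 b1 a2 b2 : 0 < t1 -> E a1 -> E b1 ->
  E a2 -> E b2 -> exists2 M, 0 <= M & forall t x y, t1 <= t <= t2 ->
    a1 <= x <= b1 -> a2 <= y <= b2 -> q t x y <= M.
Proof.
move=> t10 Ea1 Eb1 Ea2 Eb2.
have [|M M0 HM] := @compact_box_bounded R _ _ t1 t2 a1 b1 a2 b2 (density_continuous TD).
  move=> [[t x] y] [[/=]]; rewrite !in_itv/= => /andP[t1t _] hx hy; split => /=.
  - exact: lt_le_trans t1t.
  - exact: state_space_between hx.
  - exact: state_space_between hy.
exists M => // t x y ht hx hy.
rewrite ext_density_in; last 3 first.
- by case/andP: ht => h _; exact: lt_le_trans h.
- exact: state_space_between hx.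
- exact: state_space_between hy.
by apply: (le_trans (ler_norm _)); exact: HM.
Qed.

Lemma speed_itv_fin a b : E a -> E b -> (m `[a, b]%classic < +oo)%E.
Proof. by move=> Ea Eb; have [_] := speed_radon RD; apply. Qed.

Lemma speed_sigma_finite : sigma_finite setT m.
Proof.
have [mE0 mab] := speed_radon RD.
have [a [b [an bn abE Eab]]] := state_space_exhaustion lr.
(* The complement of the state space is null, so adding it to every interval covers the line without
   changing any measure. *)
exists (fun n => `[a n, b n]%classic `|` ~` E).
  apply/esym/seteqP; split => // x _.
  have [Ex|nEx] := pselect (E x); last by exists 0%N => //; right.
  have [n /andP[ax xb]] := Eab x Ex.
  by exists n => //; left; rewrite /= in_itv/= !ltW.
move=> n; have mE : measurable (~` E) by apply: measurableC; exact: state_space_measurable.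
split; first exact: measurableU.
apply: (@le_lt_trans _ _ (m `[a n, b n]%classic + m (~` E))%E).
  by apply: measureU2 => //; exact: measurable_itv.
rewrite mE0 adde0.
have [ab|ba] := leP (a n) (b n); last by rewrite set_itv_ge ?measure0// bnd_simp -ltNge.
by apply: mab; apply: (abE n); rewrite ?lexx ?ab.
Qed.

Lemma transition_ext_density t x B : 0 < t -> E x -> measurable B ->
  transition t x B = (\int[m]_(y in B) (q t x y)%:E)%E.
Proof.
move=> t0 Ex mB; rewrite (density_transition TD)//.
rewrite setIC integral_mkcondr; apply: eq_integral => y _.
rewrite patchE; case: ifPn => [/set_mem Ey|]; first by rewrite ext_density_in.
by rewrite notin_setE => Ey; rewrite ext_density_out// => -[].
Qed.

Lemma ext_density_measurable2 t x : measurable_fun setT (q t x).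
Proof.
exact: (measurableT_comp ext_density_measurable (measurable_fun_pair (measurable_cst (t, x)) (@measurable_id _ _ setT))).
Qed.

Lemma ext_density_sub_markov t x : (\int[m]_y (q t x y)%:E <= 1)%E.
Proof.
have [[t0 Ex]|h] := pselect (0 < t /\ E x).
  by rewrite -transition_ext_density// probability_le1//; exact: event_measurable RD _ _ (ltW t0) _.
rewrite (eq_integral (fun=> 0%E)) ?integral0// => y _.
by rewrite ext_density_out// => -[? ? ?]; apply: h.
Qed.

Lemma ext_density_measurable_pair t :
  measurable_fun setT (fun z : R * R => (q t z.1 z.2)%:E).
Proof.
apply/measurable_EFinP.
apply: (measurableT_comp (f := fun z : R * R * R => q z.1.1 z.1.2 z.2) ext_density_measurable (g := fun z : R * R => (t, z.1, z.2))).
by do 2 (apply: measurable_fun_pair => //).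
Qed.

Lemma transition_ext_density_measurable t B : measurable B ->
  measurable_fun setT (fun x => \int[m]_(y in B) (q t x y)%:E)%E.
Proof.
move=> mB.
by apply: (@measurable_fun_integral1 _ _ _ _ R m speed_sigma_finite (fun x y => (q t x y)%:E)) => //;
  [move=> x y; rewrite lee_fin; exact: ext_density_ge0|exact: ext_density_measurable_pair].
Qed.

(** A deterministic time is optional, so this is the strong Markov property at the constant time
    [t], with the remaining expectation evaluated through the density of the position at [t]. *)
Lemma markov_ext_density t s y B C : 0 < t -> 0 < s -> E y -> measurable B ->
  measurable C ->
  (P y (in_at t C `&` in_at (t + s) B) =
   \int[m]_(z in C) (\int[m]_(b in B) (q s z b)%:E * (q t y z)%:E))%E.
Proof.
move=> t0 s0 Ey mB mC.
have hC u : history u (in_at t C `&` [set w | (cst t%:E w < u%:E)%E]).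
  have [tu|ut] := ltP t u.
    rewrite setIidl; last by move=> w _ /=; rewrite lte_fin.
    by apply: in_at_history => //; exact: ltW.
  rewrite (_ : _ `&` _ = set0); first exact: history0.
  by apply/seteqP; split => w //= -[_]; rewrite lte_fin ltNge ut.
have opt : optional_time zeta X (cst t%:E).
  split=> [w|u _]; first by rewrite lee_fin ltW.
  have [tu|ut] := ltP t u.
    rewrite (_ : [set w | _] = setT); first exact: historyT.
    by apply/seteqP; split => w //= _; rewrite lte_fin.
  rewrite (_ : [set w | _] = set0); first exact: history0.
  by apply/seteqP; split => w //=; rewrite lte_fin ltNge ut.
have := diffusion_strong_markov RD opt (fun u _ => hC u) Ey (ltW s0) mB.
rewrite /= => H.
transitivity (\int[P y]_(w in in_at t setT `&` X t @^-1` C)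
    (fun z => \int[m]_(b in B) (q s z b)%:E)%E (X t w))%E; last first.
  apply: ge0_integral_density => //.
  - by apply: (event_measurable RD) => //; exact: ltW.
  - move=> mt D mD; rewrite (_ : _ `&` _ = in_at t D).
      by apply: (event_measurable RD) => //; exact: ltW.
    by apply/seteqP; split => [w [[? _] ?]|w [? ?]].
  - by move=> z; exact: ext_density_ge0.
  - exact: ext_density_measurable2.
  - move=> D mD; rewrite -transition_ext_density// /transition; congr (P y _).
    by apply/seteqP; split => [w [[? _] ?]|w [? ?]].
  - by move=> z; apply: integral_ge0 => b _; rewrite lee_fin ext_density_ge0.
  - exact: transition_ext_density_measurable.
have {H} : (P y (in_at t C `&` in_at (t + s) B) =
   \int[P y]_(w in in_at t C `&` [set w | (t%:E < zeta w)%E]) transition s (X t w) B)%E.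
  exact: H.
rewrite (_ : in_at t C `&` [set w | (t%:E < zeta w)%E] = in_at t setT `&` X t @^-1` C); last first.
  by apply/seteqP; split => [w /= [[? ?] ?]|w /= [[? _] ?]].
move=> ->; apply: eq_integral => w /[!inE] -[[tz _] _].
rewrite transition_ext_density//.
exact: (state_in RD (ltW t0) tz).
Qed.

End density.

(** * Support of the speed measure and the averaged Chapman-Kolmogorov equation *)

Section chapman_kolmogorov.
Context {R : realType} {d : measure_display} {Omega : measurableType d}.
Variables (l r : \bar R) (m k : {measure set R -> \bar R})
  (p : R -> R -> R -> R) (zeta : Omega -> \bar R) (X : R -> Omega -> R)
  (P : R -> probability Omega R).
Hypothesis lr : (l < r)%E.
Let E := state_space l r.
Hypothesis RD : regular_diffusion E zeta X P m k.
Hypothesis TD : transition_density E zeta X P m p.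

Notation in_at := (in_at zeta X).
Notation hit_time := (hit_time zeta X).
Notation transition := (transition zeta X P).
Notation q := (ext_density l r p).

Let Xcont := path_continuous RD.
Let Xmeas := event_measurable RD.
Let q0 := ext_density_ge0 TD.
Let qsym := ext_density_sym TD.

Lemma hits_hit_time c : hits zeta X c = [set w | (hit_time 0%R c w < +oo)%E].
Proof.
apply/seteqP; split => w /=.
  by move=> [t [t0 ht]]; apply/hit_time_ltP; exists t; rewrite ltry.
by move=> /hit_time_ltP[t [t0 _ ht]]; exists t.
Qed.

(** Otherwise the path would almost surely be outside the interval at all positive rational times.
    By continuity it could then never hit [c], against regularity. *)
Lemma transition_gt0 y a b c : E y -> E c -> a < c < b ->
  exists2 t : R, 0 < t & (0 < transition t y `]a, b[%classic)%E.
Proof.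
move=> Ey Ec /andP[ac cb]; apply: contrapT => H.
have H0 t : 0 < t -> transition t y `]a, b[%classic = 0%E.
  move=> t0; apply/eqP; rewrite eq_le measure_ge0 andbT leNgt.
  by apply/negP => tr0; apply: H; exists t.
(* [pickle] enumerates the rational times by natural numbers, so that countably many null events can
   be united. *)
pose F n := if @unpickle rat n is Some p then
  if 0 < (ratr p : R) then in_at (ratr p) `]a, b[%classic else set0 else set0.
have PF n : P y (F n) = 0%E.
  rewrite /F; case: unpickle => [p'|]; last exact: measure0.
  by case: ifPn => [/H0//|_]; exact: measure0.
have mF n : measurable (F n).
  rewrite /F; case: unpickle => [p'|] //.
  by case: ifPn => // /ltW p0; apply: Xmeas => //; exact: measurable_itv.
have : (P y).-negligible (\bigcup_n F n).
  by apply: negligible_bigcup => n; apply/negligibleP; [exact: mF|exact: PF].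
move=> /(measure_negligible (bigcup_measurable (fun n _ => mF n))) PU.
have := regular RD Ey Ec; apply/negP; rewrite -leNgt -PU.
apply: le_measure; rewrite ?inE.
- by rewrite hits_hit_time; exact: hit_before_measurable.
- exact: bigcup_measurable.
move=> w [t [t0 [tz /= Xt]]].
have [h h0 Hh] := path_near Xcont t0 tz (ltac:(by rewrite lt_min !subr_gt0 ac) : 0 < Num.min (c - a) (b - c)).
have [s] := @rat_in_itvoo R t (t + h) ltac:(lra).
rewrite in_itv/= => /andP[ts sh].
exists (pickle s); first exact: I.
rewrite /F pickleK (le_lt_trans t0 ts).
have [||sz] := Hh (ratr s); [lra|rewrite gtr0_norm; lra|].
rewrite Xt lt_min => /andP[h1 h2]; split => //=.
rewrite in_itv/=; move: h1 h2; rewrite !ltr_norml; lra.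
Qed.

(** Some transition probability into the interval is positive and has a density with respect to [m].
    That [m] charges every interval is what lets averages determine continuous functions. *)
Lemma speed_itv_gt0 a b : E a -> E b -> a < b -> (0 < m `]a, b[%classic)%E.
Proof.
move=> Ea Eb ab.
have Ec : E ((a + b) / 2) by apply: (state_space_between Ea Eb); lra.
have [t t0] := transition_gt0 Ec Ec (ltac:(lra) : a < (a + b) / 2 < b).
rewrite (transition_ext_density TD)//.
move=> h; rewrite lt0e measure_ge0 andbT; apply/eqP => m0.
move: h; rewrite (@ge0_negligible_integral _ _ _ _ _ `]a, b[%classic) ?setDv ?integral_set0 ?ltxx//.
- apply/measurable_EFinP; apply: measurable_funTS; exact: (ext_density_measurable2 TD).
- by move=> z _; rewrite lee_fin.
Qed.

Lemma speed_itvoo_fin a b : E a -> E b -> (m `]a, b[%classic < +oo)%E.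
Proof.
move=> Ea Eb; apply: (le_lt_trans _ (speed_itv_fin RD Ea Eb)).
by apply: le_measure; rewrite ?inE//; exact: subset_itvW.
Qed.

(** Intervals on a single side of [x] suffice, and the side may be chosen. This matters when [x] is
    itself the separating point and only the far side can be tested. *)
Lemma le_near_speed (F G : R -> R) x : E x ->
  {for x, continuous F} -> {for x, continuous G} ->
  measurable_fun setT F -> measurable_fun setT G -> (forall y, 0 <= G y) ->
  (exists2 e0, 0 < e0 & (forall e, 0 < e < e0 -> 
     (\int[m]_(y in `]x, (x + e)%R[) (F y)%:E <= \int[m]_(y in `]x, (x + e)%R[) (G y)%:E)%E) \/
    (forall e, 0 < e < e0 ->
     (\int[m]_(y in `](x - e)%R, x[) (F y)%:E <= \int[m]_(y in `](x - e)%R, x[) (G y)%:E)%E)) ->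
  F x <= G x.
Proof.
move=> Ex cF cG mF mG G0 [e0 e00 H].
apply: (@le_of_integral_le_near _ m) => // e e_gt0.
have [e1 e10 He1] := state_space_margin Ex.
pose h := Num.min (Num.min e e0) e1 / 2.
have h0 : 0 < h by rewrite divr_gt0// !lt_min e_gt0 e00.
have he : h < e /\ h < e0 /\ h < e1.
  have : Num.min (Num.min e e0) e1 <= Num.min e e0 by rewrite ge_min lexx.
  have : Num.min (Num.min e e0) e1 <= e1 by rewrite ge_min lexx orbT.
  have : Num.min e e0 <= e by rewrite ge_min lexx.
  have : Num.min e e0 <= e0 by rewrite ge_min lexx orbT.
  by move: h0; rewrite /h; lra.
case: H => H.
- exists `]x, (x + h)%R[%classic; split.
  + exact: measurable_itv.
  + by move=> y; rewrite /ball/= in_itv/= ltr_norml; lra.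
  + have Exh : E (x + h) by apply: He1; rewrite addrAC subrr add0r gtr0_norm; lra.
    by rewrite speed_itv_gt0 ?speed_itvoo_fin// ltrDl.
  + by apply: H; lra.
- exists `](x - h)%R, x[%classic; split.
  + exact: measurable_itv.
  + by move=> y; rewrite /ball/= in_itv/= ltr_norml; lra.
  + have Exh : E (x - h) by apply: He1; rewrite addrAC subrr add0r normrN gtr0_norm; lra.
    by rewrite speed_itv_gt0 ?speed_itvoo_fin// ltrBlDr ltrDl.
  + by apply: H; lra.
Qed.

Definition convolution t s x y := (\int[m]_z (q t x z * q s z y)%:E)%E.

(** The Markov property at time [t] determines the law at time [t + s], and hence the convolution
    only in average over end points. *)
Lemma integral_convolution t s x B : 0 < t -> 0 < s -> E x -> measurable B ->
  (\int[m]_(b in B) convolution t s x b = \int[m]_(b in B) (q (t + s) x b)%:E)%E.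
Proof.
move=> t0 s0 Ex mB.
have ts0 : 0 < t + s by rewrite addr_gt0.
rewrite -(transition_ext_density TD)//.
have := markov_ext_density lr RD TD t0 s0 Ex mB measurableT.
rewrite (_ : in_at t setT `&` in_at (t + s) B = in_at (t + s) B); last first.
  apply/setIidr => w [tz _]; split => //.
  by rewrite (lt_trans _ tz)// lte_fin ltrDl.
rewrite {1}/transition => ->.
rewrite (@tonelli_in _ _ _ _ R m m (fun b z => (q t x z * q s z b)%:E)) //.
- apply: eq_integral => z _; rewrite muleC -ge0_integralZl//=.
  + by apply/measurable_EFinP; apply: measurable_funTS; exact: (ext_density_measurable2 TD).
  + by move=> b _; rewrite lee_fin.
  + by rewrite lee_fin.
- exact: (speed_sigma_finite lr RD).
- exact: (speed_sigma_finite lr RD).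
- by move=> b z; rewrite lee_fin mulr_ge0.
- under eq_fun do rewrite EFinM; apply: emeasurable_funM.
    apply/measurable_EFinP.
    exact: (measurableT_comp (ext_density_measurable2 TD t x)).
  exact: (measurableT_comp (ext_density_measurable_pair TD s) (@measurable_swap _ _ _ _)).
Qed.

End chapman_kolmogorov.

(** * The Chapman-Kolmogorov equation at every pair of points *)

Section chapman_kolmogorov_pointwise.
Context {R : realType} {d : measure_display} {Omega : measurableType d}.
Variables (l r : \bar R) (m k : {measure set R -> \bar R})
  (p : R -> R -> R -> R) (zeta : Omega -> \bar R) (X : R -> Omega -> R)
  (P : R -> probability Omega R).
Hypothesis lr : (l < r)%E.
Let E := state_space l r.
Hypothesis RD : regular_diffusion E zeta X P m k.
Hypothesis TD : transition_density E zeta X P m p.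

Notation q := (ext_density l r p).

Let q0 := ext_density_ge0 TD.
Let qsym := ext_density_sym TD.

Notation convolution := (convolution l r m p).

Let msf : sigma_finite setT m := speed_sigma_finite lr RD.
Let mq t x : measurable_fun setT (q t x) := ext_density_measurable2 TD t x.

(** The weight [c] trades a large square against a small one: the difference of the two sides is a
    multiple of the square of [c * a - b]. *)
Lemma mean_square_le (a b c : R) : 0 < c ->
  a * b <= c / 2 * a ^+ 2 + c^-1 / 2 * b ^+ 2.
Proof.
move=> c0.
have -> : c / 2 * a ^+ 2 + c^-1 / 2 * b ^+ 2 =
    a * b + (c * a - b) ^+ 2 * (c^-1 / 2) by field; rewrite gt_eqF.
by rewrite lerDl mulr_ge0 ?sqr_ge0// divr_ge0// invr_ge0 ltW.
Qed.

Lemma integral_exhaustion (a b : nat -> R) (f : R -> \bar R) :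
  nonincreasing_seq a -> nondecreasing_seq b ->
  (forall x, E x -> exists n, a n < x < b n) ->
  measurable_fun setT f -> (forall z, 0 <= f z)%E ->
  (forall z, ~ E z -> f z = 0%E) ->
  (\int[m]_(z in `[a n, b n]) f z)%E @[n --> \oo] --> (\int[m]_z f z)%E.
Proof.
move=> an bn Eab mf f0 fE.
have -> : (\int[m]_z f z = \int[m]_(z in \bigcup_n `[a n, b n]%classic) f z)%E.
  rewrite [RHS]integral_mkcond; apply: eq_integral => z _; rewrite patchE.
  case: ifPn => //; rewrite notin_setE => nz; apply: fE => /Eab[n /andP[za zb]].
  by apply: nz; exists n => //=; rewrite in_itv/= !ltW.
apply: ge0_nondecreasing_set_cvg_integral => //.
- move=> i j ij; rewrite subsetEset => z /=; rewrite !in_itv/= => /andP[az zb].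
  by rewrite (le_trans _ az) ?an//= (le_trans zb)// bn.
- by move=> n; exact: measurable_funTS.
Qed.

Lemma mul_density_measurable t s x y :
  measurable_fun setT (fun z => (q t x z * q s z y)%:E).
Proof.
apply/measurable_EFinP; apply: measurable_funM => //.
by rewrite (_ : (fun z => q s z y) = q s y)//; apply/funext => z; exact: qsym.
Qed.

Lemma mul_density_measurable_pair t s x :
  measurable_fun setT (fun z : R * R => (q t x z.2 * q s z.2 z.1)%:E).
Proof.
under eq_fun do rewrite EFinM; apply: emeasurable_funM.
  by apply/measurable_EFinP; exact: (measurableT_comp (mq t x)).
exact: (measurableT_comp (ext_density_measurable_pair TD s) (@measurable_swap _ _ _ _)).
Qed.

Definition truncated_convolution a b t s x y : R :=
  \int[m]_(z in `[a, b]) (q t x z * q s z y).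

Lemma truncated_convolutionE a b t s x y : 0 < t -> 0 < s -> E x -> E a -> E b ->
  (truncated_convolution a b t s x y)%:E =
  (\int[m]_(z in `[a, b]) (q t x z * q s z y)%:E)%E.
Proof.
move=> t0 s0 Ex Ea Eb.
rewrite /truncated_convolution /Rintegral fineK//.
have [Ey|nEy] := pselect (E y); last first.
  rewrite (eq_integral (fun=> 0%E)) ?integral0// => z _.
  by rewrite (ext_density_out _ _ (x := z)) ?mulr0// => -[].
have [M1 M10 HM1] := ext_density_bounded TD t t0 Ex Ex Ea Eb.
have [M2 M20 HM2] := ext_density_bounded TD s s0 Ea Eb Ey Ey.
rewrite ge0_fin_numE; last first.
  by apply: integral_ge0 => z _; rewrite lee_fin mulr_ge0.
apply: (@le_lt_trans _ _ (\int[m]_(z in `[a, b]) (M1 * M2)%:E)%E).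
  apply: ge0_le_integral => //.
  - by move=> z _; rewrite lee_fin mulr_ge0.
  - exact: measurable_funTS (mul_density_measurable _ _ _ _).
  - move=> z; rewrite /= in_itv/= => zab; rewrite lee_fin ler_pM//.
      by apply: HM1; rewrite ?lexx.
    by apply: HM2; rewrite ?lexx.
rewrite integral_cst//= lte_mul_pinfty ?lee_fin ?mulr_ge0//.
by apply: (speed_itv_fin RD Ea Eb).
Qed.

Lemma truncated_convolution_ge0 a b t s x y :
  0 <= truncated_convolution a b t s x y.
Proof.
rewrite /truncated_convolution /Rintegral fine_ge0//.
by apply: integral_ge0 => z _; rewrite lee_fin mulr_ge0.
Qed.

Lemma truncated_convolution_measurable a b t s x :
  measurable_fun setT (truncated_convolution a b t s x).
Proof.
apply: (measurableT_comp (@fine_measurable _ setT measurableT)).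
apply: (@measurable_fun_integral1 _ _ _ _ R m msf (fun y z => (q t x z * q s z y)%:E)) => //.
- by move=> y z; rewrite lee_fin mulr_ge0.
- exact: mul_density_measurable_pair.
Qed.

Lemma truncated_convolution_continuous a b t s x y :
  0 < t -> 0 < s -> E x -> E y -> E a -> E b ->
  {for y, continuous (truncated_convolution a b t s x)}.
Proof.
move=> t0 s0 Ex Ey Ea Eb.
have [e e0 He] := state_space_margin Ey.
have Eye1 : E (y - e) by apply: He; rewrite addrAC subrr add0r normrN gtr0_norm.
have Eye2 : E (y + e) by apply: He; rewrite addrAC subrr add0r gtr0_norm.
have [M1 M10 HM1] := ext_density_bounded TD t t0 Ex Ex Ea Eb.
have [M2 M20 HM2] := ext_density_bounded TD s s0 Ea Eb Eye1 Eye2.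
apply: (@continuous_Rintegral _ _ _ m `[a, b]%classic
  (fun y z => q t x z * q s z y) y e (M1 * M2)) => //.
- by apply: (speed_itv_fin RD Ea Eb).
- move=> y' _; apply/measurable_EFinP.
  exact: measurable_funTS (mul_density_measurable _ _ _ _).
- move=> y' z y'e; rewrite /= in_itv/= => zab.
  rewrite ger0_norm ?mulr_ge0// ler_pM//.
    by apply: HM1; rewrite ?lexx.
  apply: HM2; rewrite ?lexx//.
  by move: y'e; rewrite ltr_norml; lra.
- move=> y' z y'e; rewrite /= in_itv/= => zab.
  apply: cvgM; first exact: cvg_cst.
  apply: (ext_density_continuous2 TD) => //; last exact: He (ltW _).
  exact: state_space_between Ea Eb zab.
Qed.

Lemma convolution_measurable t s x : measurable_fun setT (convolution t s x).
Proof.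
apply: (@measurable_fun_integral1 _ _ _ _ R m msf (fun y z => (q t x z * q s z y)%:E)) => //.
- by move=> y z; rewrite lee_fin mulr_ge0.
- exact: mul_density_measurable_pair.
Qed.

(** Confining the intermediate point to a compact interval makes the convolution continuous in [y],
    so the inequality known in average holds at each point; the full convolution is not yet known to
    be continuous. *)
Lemma truncated_convolution_le a b t s x y :
  0 < t -> 0 < s -> E x -> E y -> E a -> E b ->
  truncated_convolution a b t s x y <= q (t + s) x y.
Proof.
move=> t0 s0 Ex Ey Ea Eb.
have ts0 : 0 < t + s by rewrite addr_gt0.
apply: (le_near_speed RD TD Ey) => //.
- exact: truncated_convolution_continuous.
- exact: (ext_density_continuous2 TD).
- exact: truncated_convolution_measurable.
exists 1 => //; left => e _.
rewrite -(integral_convolution lr RD TD)//.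
apply: ge0_le_integral => //.
- by move=> z _; rewrite lee_fin truncated_convolution_ge0.
- apply/measurable_EFinP; apply: measurable_funTS.
  exact: truncated_convolution_measurable.
- exact: measurable_funTS (convolution_measurable t s x).
move=> z _; rewrite truncated_convolutionE//.
apply: ge0_subset_integral => //.
- exact: mul_density_measurable.
- by move=> w _; rewrite lee_fin mulr_ge0.
Qed.

Lemma convolution_le t s x y : 0 < t -> 0 < s -> E x -> E y ->
  (convolution t s x y <= (q (t + s) x y)%:E)%E.
Proof.
move=> t0 s0 Ex Ey.
have [a [b [an bn abE Eab]]] := state_space_exhaustion lr.
have [n0 /andP[an0 bn0]] := Eab x Ex.
have cv : (\int[m]_(z in `[a n, b n]) (q t x z * q s z y)%:E)%E @[n --> \oo] -->
    convolution t s x y.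
  apply: integral_exhaustion => //.
  - exact: mul_density_measurable.
  - by move=> z; rewrite lee_fin mulr_ge0.
  - by move=> z nEz; rewrite ext_density_out ?mul0r// => -[].
apply: (cvge_to_le cv); exists n0 => // n /= n0n.
have [Ean Ebn] : E (a n) /\ E (b n).
  have an' := an _ _ n0n; have bn' := bn _ _ n0n.
  by split; apply: (abE n); apply/andP; split; lra.
rewrite -truncated_convolutionE// lee_fin.
exact: truncated_convolution_le.
Qed.

Lemma convolution_sqr t x : 0 < t -> E x ->
  (\int[m]_z ((q t x z) ^+ 2)%:E <= (q (t + t) x x)%:E)%E.
Proof.
move=> t0 Ex; apply: le_trans (convolution_le t0 t0 Ex Ex).
by under eq_integral do rewrite expr2 {2}qsym.
Qed.

(* The truncated convolutions are continuous, and the mass that they miss is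
   small locally uniformly in the end point, by the mean-square inequality. *)
Lemma convolution_ge t s x y : 0 < t -> 0 < s -> E x -> E y ->
  ((q (t + s) x y)%:E <= convolution t s x y)%E.
Proof.
move=> t0 s0 Ex Ey.
have ts0 : 0 < t + s by rewrite addr_gt0.
have cge0 : (0 <= convolution t s x y)%E.
  by apply: integral_ge0 => z _; rewrite lee_fin mulr_ge0.
have cfin : convolution t s x y \is a fin_num.
  rewrite ge0_fin_numE//; apply: le_lt_trans (convolution_le t0 s0 Ex Ey) _.
  exact: ltry.
apply/lee_addgt0Pr => eta eta0.
have [a [b [an bn abE Eab]]] := state_space_exhaustion lr.
have [n0 /andP[an0 bn0]] := Eab x Ex.
have [e e0 He] := state_space_margin Ey.
have Eye1 : E (y - e) by apply: He; rewrite addrAC subrr add0r normrN gtr0_norm.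
have Eye2 : E (y + e) by apply: He; rewrite addrAC subrr add0r gtr0_norm.
have [C1 C10 HC1] := ext_density_bounded TD (s + s) (addr_gt0 s0 s0) Eye1 Eye2 Eye1 Eye2.
(* With this weight the two halves of the mean-square inequality are at most [eta / 2] each: the
   first factor has squared tail at most [eta / c], the second has squared integral at most
   [C1 <= c * eta]. The summand 1 keeps [c] positive. *)
pose c := (C1 + 1) / eta.
have c0 : 0 < c by rewrite divr_gt0// ltr_wpDl.
pose g z := ((q t x z) ^+ 2)%:E.
have g0 z : (0 <= g z)%E by rewrite lee_fin sqr_ge0.
have mg : measurable_fun setT g.
  by apply/measurable_EFinP; exact: measurable_funX.
have gfin : (\int[m]_z g z)%E \is a fin_num.
  rewrite ge0_fin_numE; last by apply: integral_ge0.
  by apply: le_lt_trans (convolution_sqr t0 Ex) _; exact: ltry.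
have [n n0n Hn] : exists2 n, (n0 <= n)%N &
    (\int[m]_(z in ~` `[a n, b n]) g z <= (eta / c)%:E)%E.
  have cv : (\int[m]_(z in `[a n, b n]) g z)%E @[n --> \oo] --> (\int[m]_z g z)%E.
    apply: integral_exhaustion => // z nEz.
    by rewrite /g ext_density_out ?expr0n// => -[].
  have ec0 : 0 < eta / c by rewrite divr_gt0.
  have [n [n0n]] : exists n, (n0 <= n)%N /\
      (\int[m]_z g z - (eta / c)%:E < \int[m]_(z in `[a n, b n]) g z)%E.
    apply: contrapT => H.
    have : (\int[m]_z g z <= \int[m]_z g z - (eta / c)%:E)%E.
      apply: (cvge_to_le cv); exists n0 => // n /= n0n.
      by rewrite leNgt; apply/negP => h; apply: H; exists n.
    by rewrite leNgt lteBlDr// lteDl// lte_fin ec0.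
  move=> h; exists n => //; move: h.
  set K := `[_, _]%classic.
  have mK : measurable K by exact: measurable_itv.
  have -> : (\int[m]_z g z = \int[m]_(z in K) g z + \int[m]_(z in ~` K) g z)%E.
    rewrite -ge0_integral_setU ?setUv//; first exact: measurableC.
    by apply/disj_setPS; rewrite setICr.
  have IK : (\int[m]_(z in K) g z)%E \is a fin_num.
    rewrite ge0_fin_numE; last by apply: integral_ge0.
    apply: (@le_lt_trans _ _ (\int[m]_z g z)%E).
      exact: ge0_subset_integral.
    by rewrite -ge0_fin_numE//; exact: integral_ge0.
  rewrite lteBlDr// lteD2lE// => /ltW; exact.
have [Ean Ebn] : E (a n) /\ E (b n).
  have an' := an _ _ n0n; have bn' := bn _ _ n0n.
  by split; apply: (abE n); apply/andP; split; lra.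
pose G y' := truncated_convolution (a n) (b n) t s x y' + eta.
have Gle : q (t + s) x y <= G y.
  apply: (le_near_speed RD TD Ey) => //.
  - exact: (ext_density_continuous2 TD).
  - apply: cvgD; last exact: cvg_cst.
    exact: truncated_convolution_continuous.
  - apply: measurable_funD => //; exact: truncated_convolution_measurable.
  - by move=> y'; rewrite addr_ge0 ?truncated_convolution_ge0// ltW.
  exists e => //; left => e' /andP[e'0 e'e].
  rewrite -(integral_convolution lr RD TD)//.
  apply: ge0_le_integral => //.
  - by move=> y' _; apply: integral_ge0 => z _; rewrite lee_fin mulr_ge0.
  - exact: measurable_funTS (convolution_measurable t s x).
  - apply/measurable_EFinP; apply: measurable_funTS; apply: measurable_funD => //.
    exact: truncated_convolution_measurable.
  move=> y'; rewrite /= in_itv/= => /andP[yy' y'e].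
  have Ey' : E y' by apply: He; rewrite ger0_norm; lra.
  rewrite /G EFinD truncated_convolutionE//.
  set K := `[_, _]%classic.
  have mK : measurable K by exact: measurable_itv.
  have mCK : measurable (~` K) by exact: measurableC.
  have -> : (convolution t s x y' = \int[m]_(z in K) (q t x z * q s z y')%:E +
      \int[m]_(z in ~` K) (q t x z * q s z y')%:E)%E.
    rewrite -ge0_integral_setU ?setUv//.
    - exact: mul_density_measurable.
    - by move=> z _; rewrite lee_fin mulr_ge0.
    - by apply/disj_setPS; rewrite setICr.
  apply: leeD => //.
  pose h z := ((q s y' z) ^+ 2)%:E.
  have mh : measurable_fun setT h by apply/measurable_EFinP; exact: measurable_funX.
  apply: (@le_trans _ _ (\int[m]_(z in ~` K) ((c / 2)%:E * g z + (c^-1 / 2)%:E * h z))%E).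
    apply: ge0_le_integral => //.
    - by move=> z _; rewrite lee_fin mulr_ge0.
    - exact: measurable_funTS (mul_density_measurable _ _ _ _).
    - by apply: measurable_funTS; apply: emeasurable_funD; exact: measurable_funeM.
    - by move=> z _; rewrite -!EFinM -EFinD lee_fin [q s z y']qsym mean_square_le.
  have c2 : 0 <= c / 2 by rewrite divr_ge0// ltW.
  have ci2 : 0 <= c^-1 / 2 by rewrite divr_ge0// invr_ge0 ltW.
  have h0 z : (0 <= h z)%E by rewrite lee_fin sqr_ge0.
  rewrite ge0_integralD//; last 4 first.
  - by move=> z _; rewrite mule_ge0.
  - by apply: measurable_funTS; exact: measurable_funeM.
  - by move=> z _; rewrite mule_ge0.
  - by apply: measurable_funTS; exact: measurable_funeM.
  rewrite !ge0_integralZl//; last 2 first.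
  - exact: measurable_funTS.
  - exact: measurable_funTS.
  have -> : eta%:E = ((c / 2)%:E * (eta / c)%:E + (c^-1 / 2)%:E * (c * eta)%:E)%E.
    by rewrite -!EFinM -EFinD; congr (_%:E); field; rewrite gt_eqF.
  apply: leeD; apply: lee_wpmul2l; rewrite ?lee_fin//.
  apply: (@le_trans _ _ (\int[m]_z h z)%E); first exact: ge0_subset_integral.
  apply: (le_trans (convolution_sqr s0 Ey')).
  rewrite /c divfK ?gt_eqF// lee_fin.
  have := HC1 (s + s) y' y'; rewrite lexx => /(_ isT).
  have -> : y - e <= y' <= y + e by apply/andP; split; lra.
  move=> /(_ isT isT); lra.
rewrite -(fineK cfin) -EFinD lee_fin (le_trans Gle)// /G lerD2r.
rewrite -lee_fin truncated_convolutionE// fineK//.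
apply: ge0_subset_integral => //.
- exact: mul_density_measurable.
- by move=> z _; rewrite lee_fin mulr_ge0.
Qed.

Lemma chapman_kolmogorov t s x y : 0 < t -> 0 < s ->
  (\int[m]_z (q t x z * q s z y)%:E = (q (t + s) x y)%:E)%E.
Proof.
move=> t0 s0; have [Ex|nEx] := pselect (E x); last first.
  rewrite (@ext_density_out _ _ _ _ (t + s)); last by case.
  rewrite (eq_integral (fun=> 0%E)) ?integral0// => z _.
  by rewrite ext_density_out ?mul0r// => -[].
have [Ey|nEy] := pselect (E y); last first.
  rewrite (@ext_density_out _ _ _ _ (t + s)); last by case.
  rewrite (eq_integral (fun=> 0%E)) ?integral0// => z _.
  by rewrite (@ext_density_out _ _ _ _ s) ?mulr0// => -[].
apply/eqP; rewrite eq_le -/(convolution t s x y).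
by rewrite convolution_le// convolution_ge.
Qed.

(** By symmetry and Chapman-Kolmogorov, [q t x y] is the inner product of the densities from [x] and
    from [y] at time [t / 2], whose squared norms are [q t x x] and [q t y y]. *)
Lemma density_mean_le t x y c : 0 < t -> 0 < c ->
  q t x y <= c / 2 * q t x x + c^-1 / 2 * q t y y.
Proof.
move=> t0 c0; rewrite -lee_fin.
have t20 : 0 < t / 2 by rewrite divr_gt0.
have tE : t = t / 2 + t / 2 by rewrite -splitr.
rewrite EFinD !EFinM [in X in (_ <= X)%E]tE [in X in (X <= _)%E]tE.
rewrite -!chapman_kolmogorov//.
rewrite -!ge0_integralZl//; last 6 first.
- exact: mul_density_measurable.
- by move=> z _; rewrite lee_fin mulr_ge0.
- by rewrite lee_fin divr_ge0// invr_ge0 ltW.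
- exact: mul_density_measurable.
- by move=> z _; rewrite lee_fin mulr_ge0.
- by rewrite lee_fin divr_ge0// ltW.
rewrite -ge0_integralD//; last 4 first.
- by move=> z _; rewrite -EFinM lee_fin !mulr_ge0// ltW// invr_gt0.
- by apply: measurable_funeM; exact: mul_density_measurable.
- by move=> z _; rewrite -EFinM lee_fin !mulr_ge0// ltW// invr_gt0.
- by apply: measurable_funeM; exact: mul_density_measurable.
apply: ge0_le_integral => //.
- by move=> z _; rewrite lee_fin mulr_ge0.
- exact: mul_density_measurable.
- by apply: emeasurable_funD; apply: measurable_funeM; exact: mul_density_measurable.
move=> z _; rewrite -!EFinM -EFinD lee_fin.
by rewrite [q (t / 2) z x]qsym [q (t / 2) z y]qsym -!expr2 mean_square_le.
Qed.

End chapman_kolmogorov_pointwise.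

(** * Green functions *)

Section green.
Context {R : realType} {d : measure_display} {Omega : measurableType d}.
Variables (l r : \bar R) (m k : {measure set R -> \bar R})
  (p : R -> R -> R -> R) (zeta : Omega -> \bar R) (X : R -> Omega -> R)
  (P : R -> probability Omega R).
Hypothesis lr : (l < r)%E.
Let E := state_space l r.
Hypothesis RD : regular_diffusion E zeta X P m k.
Hypothesis TD : transition_density E zeta X P m p.

Notation in_at := (in_at zeta X).
Notation hit_time := (hit_time zeta X).
Notation transition := (transition zeta X P).
Notation q := (ext_density l r p).

Let Xcont := path_continuous RD.
Let Xmeas := event_measurable RD.
Let q0 := ext_density_ge0 TD.
Let qsym := ext_density_sym TD.

Notation mu := (@lebesgue_measure R).
Let msf : sigma_finite setT m := speed_sigma_finite lr RD.
Let mq t x : measurable_fun setT (q t x) := ext_density_measurable2 TD t x.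

Definition green (I : set R) x y : \bar R := (\int[mu]_(t in I) (q t x y)%:E)%E.

Lemma green_ge0 I x y : (0 <= green I x y)%E.
Proof. by apply: integral_ge0 => t _; rewrite lee_fin. Qed.

Lemma green_sym I x y : green I x y = green I y x.
Proof. by apply: eq_integral => t _; rewrite qsym. Qed.

Lemma density_time_measurable x y : measurable_fun setT (fun t => (q t x y)%:E).
Proof.
apply/measurable_EFinP.
apply: (measurableT_comp (f := fun z : R * R * R => q z.1.1 z.1.2 z.2) (ext_density_measurable TD) (g := fun t => (t, x, y))).
by do 2 (apply: measurable_fun_pair => //).
Qed.

Lemma density_time_measurable_pair x :
  measurable_fun setT (fun z : R * R => (q z.1 x z.2)%:E).
Proof.
apply/measurable_EFinP.
apply: (measurableT_comp (f := fun z : R * R * R => q z.1.1 z.1.2 z.2) (ext_density_measurable TD) (g := fun z : R * R => (z.1, x, z.2))).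
by do 2 (apply: measurable_fun_pair => //).
Qed.

Lemma green_measurable I x : measurable I -> measurable_fun setT (green I x).
Proof.
move=> mI; apply: (@measurable_fun_integral1 _ _ _ _ R mu (sigma_finiteT _) (fun y t => (q t x y)%:E)) => //.
- by move=> y t; rewrite lee_fin.
- exact: (measurableT_comp (density_time_measurable_pair x) (@measurable_swap _ _ _ _)).
Qed.

Lemma integral_green (I : set R) x B : measurable I -> (forall t, I t -> 0 < t) -> E x ->
  measurable B ->
  (\int[mu]_(t in I) transition t x B = \int[m]_(y in B) green I x y)%E.
Proof.
move=> mI I0 Ex mB.
under eq_integral => t /[!inE] It.
  rewrite (transition_ext_density TD (I0 _ It) Ex mB); over.
apply: tonelli_in => //.
- exact: sigma_finiteT.
- by move=> t y; rewrite lee_fin.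
- exact: density_time_measurable_pair.
Qed.

Lemma itv_exhaustion (N : R) (f : R -> \bar R) : measurable_fun setT f ->
  (forall t, 0 <= f t)%E ->
  (\int[mu]_(t in `[(n.+1%:R^-1)%R, N]) f t)%E @[n --> \oo] -->
  (\int[mu]_(t in `]0%R, N]) f t)%E.
Proof.
move=> mf f0.
have -> : `]0%R, N]%classic = \bigcup_n `[(n.+1%:R^-1 : R), N]%classic.
  apply/seteqP; split => [t|t [n _]]; rewrite /= !in_itv/= => /andP[t0 tN].
    have [n _ /(_ n (leqnn n)) hn] := near_infty_natSinv_lt (PosNum t0).
    by exists n => //=; rewrite in_itv/= tN andbT ltW.
  by rewrite tN (lt_le_trans _ t0).
apply: ge0_nondecreasing_set_cvg_integral => //.
- move=> i j ij; rewrite subsetEset => z /=; rewrite !in_itv/= => /andP[az ->].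
  by rewrite (le_trans _ az)//= lef_pV2 ?posrE// ler_nat.
- by move=> n; exact: measurable_funTS.
Qed.

Lemma lebesgue_itv_fin (a b : R) : (mu `[a, b]%classic < +oo)%E.
Proof.
by rewrite lebesgue_measure_itv/=; case: ifP => // _; rewrite -EFinB ltry.
Qed.

(** Times near 0 are cut off because the density is continuous, and therefore locally bounded, only
    at positive times. *)
Definition truncated_green a N x y : R := \int[mu]_(t in `[a, N]) q t x y.

Lemma truncated_greenE a N x y : 0 < a -> E x -> E y ->
  (truncated_green a N x y)%:E = green `[a, N] x y.
Proof.
move=> a0 Ex Ey.
rewrite /truncated_green /Rintegral fineK// ge0_fin_numE ?green_ge0//.
have [M M0 HM] := ext_density_bounded TD N a0 Ex Ex Ey Ey.
apply: (@le_lt_trans _ _ (\int[mu]_(t in `[a, N]) M%:E)%E).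
  apply: ge0_le_integral => //.
  - by move=> z _; rewrite lee_fin.
  - exact: measurable_funTS (density_time_measurable _ _).
  - move=> z; rewrite /= in_itv/= => zab; rewrite lee_fin.
    by apply: HM; rewrite ?lexx.
rewrite integral_cst//= lte_mul_pinfty ?lee_fin//.
exact: lebesgue_itv_fin.
Qed.

Lemma truncated_green_measurable a N x : measurable_fun setT (truncated_green a N x).
Proof.
apply: (measurableT_comp (@fine_measurable _ setT measurableT)).
exact: (green_measurable x (@measurable_itv R `[a, N])).
Qed.

Lemma truncated_green_continuous a N x y : 0 < a -> E x -> E y ->
  {for y, continuous (truncated_green a N x)}.
Proof.
move=> a0 Ex Ey.
have [e e0 He] := state_space_margin Ey.
have Eye1 : E (y - e) by apply: He; rewrite addrAC subrr add0r normrN gtr0_norm.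
have Eye2 : E (y + e) by apply: He; rewrite addrAC subrr add0r gtr0_norm.
have [M M0 HM] := ext_density_bounded TD N a0 Ex Ex Eye1 Eye2.
apply: (@continuous_Rintegral _ _ _ mu `[a, N]%classic
  (fun y t => q t x y) y e M) => //.
- exact: lebesgue_itv_fin.
- move=> y' _; apply/measurable_EFinP.
  exact: measurable_funTS (density_time_measurable _ _).
- move=> y' t y'e; rewrite /= in_itv/= => taN.
  rewrite ger0_norm//; apply: HM; rewrite ?lexx//.
  by move: y'e; rewrite ltr_norml; lra.
- move=> y' t y'e; rewrite /= in_itv/= => /andP[at_ _].
  apply: (ext_density_continuous2 TD) => //; last exact: He (ltW _).
  exact: lt_le_trans at_.
Qed.

(* Started at z, the path reaches y1 with positive probability after having
   been below x0 at a time bounded away from 0. *)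
Lemma delayed_hit_gt0 z x0 y1 : E z -> E y1 -> z < x0 -> x0 < y1 ->
  exists b c, [/\ 0 < b, 0 < c & (0 < P z (in_at b `]-oo, x0[%classic `&`
     [set w | (hit_time b y1 w < b%:E + c%:E)%E]))%E].
Proof.
move=> Ez Ey1 zx0 x0y1; apply: contrapT => H.
pose b n : R := n.+1%:R^-1.
pose F n := in_at (b n) `]-oo, x0[%classic `&`
     [set w | (hit_time (b n) y1 w < (b n)%:E + n.+1%:R%:E)%E].
have b0 n : 0 < b n by rewrite /b invr_gt0.
have mF n : measurable (F n).
  apply: measurableI; first by apply: Xmeas; [exact: ltW|exact: measurable_itv].
  by apply: hit_before_measurable => //; exact: ltW.
have PF n : P z (F n) = 0%E.
  apply/eqP; rewrite eq_le measure_ge0 andbT leNgt.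
  by apply/negP => h; apply: H; exists (b n), n.+1%:R.
have : (P z).-negligible (\bigcup_n F n).
  by apply: negligible_bigcup => n; apply/negligibleP; [exact: mF|exact: PF].
move=> /(measure_negligible (bigcup_measurable (fun n _ => mF n))) PU.
have m0 : measurable (in_at 0 [set z]) by exact: Xmeas.
have mH : measurable (hits zeta X y1).
  by rewrite hits_hit_time; exact: hit_before_measurable.
have P0 : P z (~` in_at 0 [set z]) = 0%E.
  by rewrite probability_setC// (started_at RD Ez) subee.
have := regular RD Ez Ey1; apply/negP; rewrite -leNgt.
have <- : (P z (\bigcup_n F n) + P z (~` in_at 0 [set z]) = 0)%E.
  by rewrite PU P0 adde0.
apply: (@le_trans _ _ (P z ((\bigcup_n F n) `|` ~` in_at 0 [set z]))); last first.
  by apply: measureU2; [exact: bigcup_measurable|exact: measurableC].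
apply: le_measure; rewrite ?inE//.
  by apply: measurableU; [exact: bigcup_measurable|exact: measurableC].
move=> w [t [t0 [tz /= Xt]]].
have [[z0 /= X0]|] := pselect (in_at 0 [set z] w); last by right.
left.
have [h h0 Hh] := path_near Xcont (lexx 0) z0 (ltac:(by rewrite subr_gt0) : 0 < x0 - z).
have [n1 _ Hn1] := near_infty_natSinv_lt (PosNum h0).
exists (maxn n1 (Num.bound t)) => //.
set n := maxn _ _.
have bh : b n < h by apply: Hn1; exact: leq_maxl.
have close s : 0 <= s -> s < h -> (s%:E < zeta w)%E /\ X s w < x0.
  move=> s0 sh; have [||sz] := Hh s; [by []|by rewrite subr0 ger0_norm|].
  by rewrite X0 ltr_norml; split => //; lra.
have [bz Xb] := close (b n) (ltW (b0 n)) bh.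
split; first by split => //=; rewrite in_itv.
have bt : b n <= t.
  rewrite leNgt; apply/negP => tb.
  by have [_] := close t t0 (lt_trans tb bh); rewrite Xt; lra.
apply/hit_time_ltP; exists t; split => //.
rewrite -EFinD lte_fin (lt_trans (archi_boundP t0))//.
rewrite (@le_lt_trans _ _ n%:R) ?ler_nat ?leq_maxr//.
by rewrite -addn1 natrD; have := b0 n; lra.
Qed.

End green.

(** * Local boundedness of the Green function of a finite horizon *)

Section green_bound.
Context {R : realType} {d : measure_display} {Omega : measurableType d}.
Variables (l r : \bar R) (m k : {measure set R -> \bar R})
  (p : R -> R -> R -> R) (zeta : Omega -> \bar R) (X : R -> Omega -> R)
  (P : R -> probability Omega R).
Hypothesis lr : (l < r)%E.
Let E := state_space l r.
Hypothesis RD : regular_diffusion E zeta X P m k.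
Hypothesis TD : transition_density E zeta X P m p.

Notation in_at := (in_at zeta X).
Notation history := (history zeta X).
Notation hit_time := (hit_time zeta X).
Notation transition := (transition zeta X P).
Notation q := (ext_density l r p).

Let Xcont := path_continuous RD.
Let Xmeas := event_measurable RD.
Let Xmarkov := diffusion_strong_markov RD.
Let q0 := ext_density_ge0 TD.
Let qsym := ext_density_sym TD.

Notation mu := (@lebesgue_measure R).
Let msf : sigma_finite setT m := speed_sigma_finite lr RD.
Let mq t x : measurable_fun setT (q t x) := ext_density_measurable2 TD t x.
Notation green := (green l r p).
Notation truncated_green := (truncated_green l r p).

(** The density may blow up on the diagonal at time 0, so its time integral is bounded indirectly. A
    path from [x - 2 * e] that is still below [x - e] at time [b] visits [y0] with probability at
    least [pi]. Its occupation near [y0] after that visit is part of its occupation at times later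
    than [b], where its density is at most [M]. *)
Lemma green_diag_locally_bounded (N : R) x : 0 < N -> E x ->
  exists2 e, 0 < e & exists C, forall y, `|y - x| < e ->
    (green `]0%R, N] y y <= C%:E)%E.
Proof.
move=> N0 Ex; have [e' e'0 He'] := state_space_margin Ex.
pose e := e' / 4; have e0 : 0 < e by rewrite divr_gt0.
have e4 : e' = 4 * e by rewrite /e; field.
have EE u : `|u - x| <= 4 * e -> E u by rewrite -e4; exact: He'.
have Ez : E (x - 2 * e) by apply: EE; rewrite ler_norml; lra.
have Ex0 : E (x - e) by apply: EE; rewrite ler_norml; lra.
have Ey1 : E (x + e) by apply: EE; rewrite ler_norml; lra.
have Ey2 : E (x + 2 * e) by apply: EE; rewrite ler_norml; lra.
exists e => //.
have [b [c [b0 c0 Pgt]]] := @delayed_hit_gt0 _ _ _ _ _ _ _ _ _ _ RD _ (x - e) _ Ez Ey1 ltac:(lra) ltac:(lra).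
set A := in_at b _ in Pgt.
have hA : history b A by apply: in_at_history => //; exact: ltW.
have [M M0 HM] := ext_density_bounded TD (b + (N + c)) b0 Ez Ez Ex0 Ey2.
set F := _ `&` _ in Pgt.
have mF : measurable F.
  apply: measurableI; first exact: history_measurable hA.
  by apply: hit_before_measurable => //; exact: ltW.
have Pfin : P (x - 2 * e) F \is a fin_num by apply: fin_num_measure.
pose pi := fine (P (x - 2 * e) F).
have pi0 : 0 < pi by rewrite fine_gt0// Pgt ltey_eq Pfin.
(* None of the constants depends on [y0]: the horizon is [N] after a visit that takes place before
   [b + c], and [pi] is the probability of a passage up to [x + e], beyond all admissible [y0]. *)
exists ((N + c) * M / pi) => y0; rewrite ltr_norml => /andP[y0l y0r].
have Ey0 : E y0 by apply: EE; rewrite ler_norml; lra.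
have key e1 : 0 < e1 < e ->
    (pi%:E * \int[m]_(y in `]y0, (y0 + e1)%R[) green `]0%R, N] y0 y <=
     ((N + c) * M)%:E * m `]y0, (y0 + e1)%R[%classic)%E.
  move=> /andP[e10 e1e].
  have Ey0e : E (y0 + e1) by apply: EE; rewrite ler_norml; lra.
  set B := `]y0, (y0 + e1)%R[%classic.
  have mB : measurable B by exact: measurable_itv.
  have mBfin : m B \is a fin_num.
    by rewrite ge0_fin_numE//; exact: (speed_itvoo_fin RD Ey0 Ey0e).
  have J0 (v : R) : `]0, (N + c)]%classic v -> 0 < v by rewrite /= in_itv/= => /andP[].
  have I0 (v : R) : `]0, N]%classic v -> 0 < v by rewrite /= in_itv/= => /andP[].
  have mA (J : set R) : measurable J -> (forall v, J v -> 0 < v) ->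
    measurable_fun J (fun v => P (x - 2 * e) (A `&` in_at (b + v) B)).
    by move=> mJ J0'; apply: delayed_probability_measurable => //; exact: ltW.
  rewrite -(integral_green lr RD TD)//.
  apply: (@le_trans _ _ (\int[mu]_(v in `]0%R, (N + c)%R]) P (x - 2 * e) (A `&` in_at (b + v) B))%E).
    apply: (@le_trans _ _ (P (x - 2 * e) (A `&` [set w | (hit_time b y0 w < b%:E + c%:E)%E]) *
        \int[mu]_(v in `]0%R, N]) transition v y0 B)%E).
      apply: lee_wpmul2r.
        by apply: integral_ge0 => v _; exact: measure_ge0.
      (* On the way from below [x - e] up to [x + e] the path crosses [y0], so the hit of [y0] comes
         no later. *)
      rewrite fineK//; apply: le_measure; rewrite ?inE//.
        apply: measurableI; first exact: history_measurable hA.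
        by apply: hit_before_measurable => //; exact: ltW.
      move=> w [Aw /=] /hit_time_ltP[u [bu ubc [uz Xu]]]; split => //.
      have [bz /=] := Aw; rewrite in_itv/= => Xb.
      have [|v /andP[bv vu] vy0] := path_IVT (x := y0) Xcont (ltW b0) bu uz.
        by rewrite Xu ge_min le_max; apply/andP; split; apply/orP; [left|right]; lra.
      apply/hit_time_ltP; exists v; split => //.
      by apply: le_lt_trans ubc; rewrite lee_fin.
    apply: (occupation_ge Xcont Xmeas Xmarkov y0 y0 (y0 + e1) (ltW b0) hA Ez) => //.
    move=> v u /=; rewrite !in_itv/= lte_fin => /andP[v0 vN] u0 uc.
    by apply/andP; split; lra.
  apply: (@le_trans _ _ (\int[mu]_(v in `]0%R, (N + c)%R]) (M%:E * m B))%E).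
    apply: ge0_le_integral => //.
    - exact: mA.
    - move=> v /=; rewrite in_itv/= => /andP[v0 vNc].
      have bv0 : 0 < b + v by rewrite addr_gt0.
      apply: (@le_trans _ _ (transition (b + v) (x - 2 * e) B)).
        apply: le_measure; rewrite ?inE//.
          apply: measurableI; first exact: history_measurable hA.
          by apply: Xmeas => //; exact: ltW.
        by apply: Xmeas => //; exact: ltW.
      rewrite (transition_ext_density TD)//.
      rewrite -integral_cst//; apply: ge0_le_integral => //.
      + by move=> y _; rewrite lee_fin.
      + by apply/measurable_EFinP; exact: measurable_funTS.
      + move=> y; rewrite /B/= in_itv/= => /andP[y1 y2]; rewrite lee_fin.
        by apply: HM; apply/andP; split; lra.
  rewrite -(fineK mBfin) -EFinM integral_cst//= lebesgue_measure_itv/=.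
  rewrite lte_fin addr_gt0// -EFinB -!EFinM lee_fin subr0.
  by rewrite mulrC mulrA.
have bound n : truncated_green n.+1%:R^-1 N y0 y0 <= (N + c) * M / pi.
  have n0 : 0 < n.+1%:R^-1 :> R by rewrite invr_gt0.
  apply: (le_near_speed RD TD (F := truncated_green n.+1%:R^-1 N y0) (G := cst ((N + c) * M / pi)) Ey0) => //.
  - exact: (truncated_green_continuous TD).
  - exact: cvg_cst.
  - exact: (truncated_green_measurable TD).
  - by move=> y; rewrite /= divr_ge0 ?mulr_ge0// ?ltW// addr_gt0.
  exists e => //; left => e1 e1e.
  have /andP[e10 e1e'] := e1e.
  have Ey0e : E (y0 + e1) by apply: EE; rewrite ler_norml; lra.
  rewrite [leRHS](_ : _ = ((N + c) * M / pi)%:E * m `]y0, (y0 + e1)%R[%classic)%E; last first.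
    by rewrite -integral_cst.
  rewrite [_ * _ / _]mulrC EFinM -muleA.
  have piV : (pi%:E * (pi^-1)%:E = 1)%E by rewrite -EFinM mulfV ?gt_eqF.
  rewrite -(@lee_pmul2l _ pi%:E)// ?lte_fin// [leRHS]muleA piV mul1e.
  apply: le_trans (key _ e1e).
  apply: lee_wpmul2l; first by rewrite lee_fin ltW.
  apply: ge0_le_integral => //.
  - move=> y _; rewrite lee_fin /truncated_green /Rintegral fine_ge0//.
    by apply: integral_ge0 => t _; rewrite lee_fin.
  - by apply/measurable_EFinP; apply: measurable_funTS; exact: (truncated_green_measurable TD).
  - by apply: measurable_funTS; exact: (green_measurable TD).
  move=> y; rewrite /= in_itv/= => /andP[y1 y2].
  have Ey : E y by apply: EE; rewrite ler_norml; lra.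
  rewrite (truncated_greenE TD)//; apply: ge0_subset_integral => //.
  - by apply: measurable_funTS; exact: (density_time_measurable TD).
  - by move=> t _; rewrite lee_fin.
  - by move=> t; rewrite /= !in_itv/= => /andP[nt ->]; rewrite andbT (lt_le_trans n0).
have qt0 (v : R) : (0 <= (q v y0 y0)%:E)%E by rewrite lee_fin.
have cv := @itv_exhaustion R N _ (density_time_measurable TD y0 y0) qt0.
apply: (cvge_to_le cv); apply: nearW => n.
rewrite -[leLHS]/(green `[(n.+1%:R^-1)%R, N] y0 y0).
by rewrite -(truncated_greenE TD) ?lee_fin ?invr_gt0.
Qed.

Lemma green_diag_fin (N : R) x : E x -> (green `]0%R, N] x x < +oo)%E.
Proof.
move=> Ex; have [N0|N0] := ltP 0 N; last first.
  by rewrite set_itv_ge -?leNgt// /green integral_set0 ltry.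
have [e e0 [C HC]] := green_diag_locally_bounded N0 Ex.
by apply: le_lt_trans (HC x _) (ltry _); rewrite subrr normr0.
Qed.

(** Integrated over time, the mean-square bound on the density reduces Green functions off the
    diagonal to those on it; the free weight later makes short times negligible. *)
Lemma green_mean_le (I : set R) x y c : measurable I -> (forall t, I t -> 0 < t) -> 0 < c ->
  (green I x y <= (c / 2)%:E * green I x x + (c^-1 / 2)%:E * green I y y)%E.
Proof.
move=> mI I0 c0; have mt u v := density_time_measurable TD u v.
have c2 : 0 <= c / 2 by rewrite divr_ge0// ltW.
have ci2 : 0 <= c^-1 / 2 by rewrite divr_ge0// invr_ge0 ltW.
have intZ u c' : 0 <= c' -> (c'%:E * green I u u =
    \int[mu]_(t in I) (c'%:E * (q t u u)%:E))%E.
  move=> c'0; rewrite ge0_integralZl//; first exact: measurable_funTS (mt u u).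
  by move=> t _; rewrite lee_fin.
rewrite !intZ//.
rewrite -ge0_integralD//; last 4 first.
- by move=> t _; rewrite mule_ge0// lee_fin.
- by apply: measurable_funTS; apply: measurable_funeM; exact: mt.
- by move=> t _; rewrite mule_ge0// lee_fin.
- by apply: measurable_funTS; apply: measurable_funeM; exact: mt.
apply: ge0_le_integral => //.
- by move=> t _; rewrite lee_fin.
- exact: measurable_funTS (mt x y).
- by apply: measurable_funTS; apply: emeasurable_funD; apply: measurable_funeM; exact: mt.
move=> t It; rewrite -!EFinM -EFinD lee_fin.
exact: (density_mean_le lr RD TD _ _ (I0 _ It) c0).
Qed.

Lemma green_fin (N : R) x y : E x -> E y -> (green `]0%R, N] x y < +oo)%E.
Proof.
move=> Ex Ey; apply: (le_lt_trans (@green_mean_le _ _ _ 1 _ _ ltr01)) => //.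
  by move=> t; rewrite /= in_itv/= => /andP[].
by rewrite lte_add_pinfty// lte_mul_pinfty// ?lee_fin ?green_diag_fin// divr_ge0.
Qed.

End green_bound.

(** * Continuity of the Green function and its comparison through hitting probabilities *)

Section green_continuity.
Context {R : realType} {d : measure_display} {Omega : measurableType d}.
Variables (l r : \bar R) (m k : {measure set R -> \bar R})
  (p : R -> R -> R -> R) (zeta : Omega -> \bar R) (X : R -> Omega -> R)
  (P : R -> probability Omega R).
Hypothesis lr : (l < r)%E.
Let E := state_space l r.
Hypothesis RD : regular_diffusion E zeta X P m k.
Hypothesis TD : transition_density E zeta X P m p.

Notation in_at := (in_at zeta X).
Notation history := (history zeta X).
Notation hit_time := (hit_time zeta X).
Notation q := (ext_density l r p).

Let Xcont := path_continuous RD.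
Let Xmeas := event_measurable RD.
Let Xmarkov := diffusion_strong_markov RD.
Let q0 := ext_density_ge0 TD.
Let qsym := ext_density_sym TD.

Notation mu := (@lebesgue_measure R).
Notation green := (green l r p).
Notation truncated_green := (truncated_green l r p).

Let I0 (N v : R) : `]0, N]%classic v -> 0 < v.
Proof. by rewrite /= in_itv/= => /andP[]. Qed.

Lemma green_setD (I J : set R) x y : measurable I -> measurable J -> J `<=` I ->
  green I x y = (green J x y + green (I `\` J) x y)%E.
Proof.
move=> mI mJ JI; rewrite /green -{1}(setDUK JI) ge0_integral_setU//.
- exact: measurableD.
- by apply: measurable_funTS; exact: (density_time_measurable TD).
- by move=> t _; rewrite lee_fin.
- by apply/disj_setPS => t [Jt [_]].
Qed.

Lemma green_subset (I J : set R) x y : measurable I -> measurable J -> J `<=` I ->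
  (green J x y <= green I x y)%E.
Proof.
move=> mI mJ JI; rewrite (@green_setD I J)// leeDl//.
by apply: integral_ge0 => t _; rewrite lee_fin.
Qed.

Definition green_fun N x y : R := fine (green `]0%R, N] x y).

Lemma green_fun_ge0 N x y : 0 <= green_fun N x y.
Proof. by rewrite /green_fun fine_ge0//; exact: (green_ge0 TD). Qed.

Lemma green_funE N x y : E x -> E y ->
  (green_fun N x y)%:E = green `]0%R, N] x y.
Proof.
move=> Ex Ey; rewrite /green_fun fineK// ge0_fin_numE ?(green_ge0 TD)//.
exact: (green_fin lr RD TD).
Qed.

Lemma green_fun_measurable N x : measurable_fun setT (green_fun N x).
Proof.
apply: (measurableT_comp (@fine_measurable _ setT measurableT)).
exact: (green_measurable TD x (@measurable_itv R `]0, N])).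
Qed.

(** The part from times above [1/(n+1)] is continuous. The remaining part is small uniformly near
    [y] by [green_mean_le]: at [x] it is the vanishing tail of a finite integral, near [y] it is
    locally bounded. *)
Lemma green_fun_continuous N x y : 0 < N -> E x -> E y ->
  {for y, continuous (green_fun N x)}.
Proof.
move=> N0 Ex Ey; apply/cvgrPdist_lt => eta eta0.
have [e e0 [C HC]] := green_diag_locally_bounded lr RD TD N0 Ey.
pose C' := `|C| + 1.
have C'0 : 0 < C' by rewrite ltr_wpDl.
have CC' : C <= C' by rewrite (le_trans (ler_norm _))// lerDl.
(* With this weight the term at [x], where the short times contribute at most [eta / (4 * c)], and
   the term near [y], bounded through [C'], are both at most [eta / 8]. *)
pose c := 4 * C' / eta.
have c0 : 0 < c by rewrite divr_gt0// mulr_gt0.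
pose J n := `[(n.+1%:R^-1 : R), N]%classic.
have JI n : J n `<=` `]0, N]%classic.
  move=> t; rewrite /J/= !in_itv/= => /andP[nt ->]; rewrite andbT.
  by rewrite (lt_le_trans _ nt)// invr_gt0.
have mJ n : measurable (J n) by exact: measurable_itv.
have mI : measurable `]0, N]%classic by exact: measurable_itv.
have gfin u v : E u -> E v -> green `]0%R, N] u v \is a fin_num.
  by move=> Eu Ev; rewrite -green_funE.
have [n Hn] : exists n, (green (`]0%R, N]%classic `\` J n) x x <= (eta / (4 * c))%:E)%E.
  apply: contrapT => H.
  have qt0 (v : R) : (0 <= (q v x x)%:E)%E by rewrite lee_fin.
  have cv := @itv_exhaustion R N _ (density_time_measurable TD x x) qt0.
  have ec0 : 0 < eta / (4 * c) by rewrite divr_gt0// mulr_gt0.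
  have : (green `]0%R, N] x x <= green `]0%R, N] x x - (eta / (4 * c))%:E)%E.
    apply: (cvge_to_le cv); apply: nearW => n.
    rewrite -[leLHS]/(green (J n) x x) leeBrDr//.
    rewrite [leRHS](@green_setD _ (J n))//; apply: leeD => //.
    by rewrite leNgt; apply/negP => h; apply: H; exists n; exact: ltW.
  by rewrite leNgt lteBlDr ?gfin// lteDl ?gfin// lte_fin ec0.
pose D := `]0, N]%classic `\` J n.
have mD : measurable D by exact: measurableD.
have Dtail y' : E y' -> `|y' - y| < e -> (0 <= green D x y' <= (eta / 4)%:E)%E.
  move=> Ey' y'e; apply/andP; split; first exact: (green_ge0 TD).
  apply: (le_trans (green_mean_le lr RD TD _ _ mD _ c0)).
    by move=> t [+ _]; exact: I0.
  have -> : (eta / 4)%:E = ((c / 2)%:E * (eta / (4 * c))%:E + (c^-1 / 2)%:E * C'%:E)%E.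
    rewrite -!EFinM -EFinD; congr (_%:E); rewrite /c; field.
    by rewrite !gt_eqF.
  apply: leeD; apply: lee_wpmul2l; [by rewrite lee_fin divr_ge0// ltW|exact: Hn|
    by rewrite lee_fin divr_ge0// invr_ge0 ltW|].
  apply: (@le_trans _ _ (green `]0%R, N] y' y')).
    by apply: green_subset => //; exact: subDsetl.
  by apply: (le_trans (HC _ y'e)); rewrite lee_fin.
have GE y' : E y' -> green_fun N x y' = truncated_green n.+1%:R^-1 N x y' + fine (green D x y').
  move=> Ey'; have Df : green D x y' \is a fin_num.
    rewrite ge0_fin_numE ?(green_ge0 TD)//.
    apply: (le_lt_trans (@green_subset `]0, N]%classic D _ _ _ _ _)) => //.
      exact: subDsetl.
    by rewrite -ge0_fin_numE ?gfin// (green_ge0 TD).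
  apply: EFin_inj; rewrite green_funE// (@green_setD _ (J n))// EFinD.
  by rewrite (truncated_greenE TD) ?invr_gt0// fineK.
have n0 : 0 < n.+1%:R^-1 :> R by rewrite invr_gt0.
have eta20 : 0 < eta / 2 by rewrite divr_gt0.
have /cvgrPdist_lt/(_ _ eta20) cT := truncated_green_continuous TD (N := N) n0 Ex Ey.
have nE := open_nbhs_nbhs (conj (@state_space_open R l r) Ey).
near=> y'.
have Ey' : E y' by near: y'.
have y'e : `|y' - y| < e.
  by near: y'; apply/nbhs_ballP; exists e => // u; rewrite /ball/= distrC.
have tr : `|truncated_green n.+1%:R^-1 N x y - truncated_green n.+1%:R^-1 N x y'| < eta / 2.
  by near: y'.
have bounds u : E u -> `|u - y| < e -> 0 <= fine (green D x u) <= eta / 4.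
  move=> Eu ue; have /andP[D0 D1] := Dtail u Eu ue.
  have Df : green D x u \is a fin_num by rewrite ge0_fin_numE// (le_lt_trans D1)// ltry.
  by rewrite -!lee_fin fineK// D0 D1.
rewrite !GE//.
have := bounds y' Ey' y'e.
have := bounds y Ey ltac:(by rewrite subrr normr0).
move: tr; rewrite !ltr_norml; lra.
Unshelve. all: by end_near. Qed.

Lemma probability_start z F : E z -> measurable F ->
  P z (in_at 0 [set z] `&` F) = P z F.
Proof.
move=> Ez mF; have m0 : measurable (in_at 0 [set z]) by exact: Xmeas.
have P0 : P z (~` in_at 0 [set z]) = 0%E.
  by rewrite probability_setC// (started_at RD Ez) subee.
apply/eqP; rewrite eq_le; apply/andP; split.
  by apply: le_measure; rewrite ?inE//; exact: measurableI.
rewrite -[leRHS]adde0 -P0.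
apply: le_trans (measureU2 _ _ _); last 2 first.
- exact: measurableI.
- exact: measurableC.
apply: le_measure; rewrite ?inE//.
  by apply: measurableU; [exact: measurableI|exact: measurableC].
by move=> w Fw; have [?|?] := pselect (in_at 0 [set z] w); [left|right].
Qed.

Lemma in_at_start_history z : history 0 (in_at 0 [set z]).
Proof. exact: in_at_history. Qed.

Lemma integral_green_start (I : set R) z a b : measurable I ->
  (forall t, I t -> 0 < t) -> E z ->
  (\int[m]_(y in `]a, b[) green I z y =
   \int[mu]_(v in I) P z (in_at 0 [set z] `&` in_at (0 + v) `]a, b[%classic))%E.
Proof.
move=> mI It Ez; rewrite -(integral_green lr RD TD)//.
apply: eq_integral => v /[!inE] Iv; rewrite probability_start// ?add0r//.
by apply: Xmeas => //; exact: ltW (It _ Iv).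
Qed.

Lemma hit_before_fin z x c : P z [set w | (hit_time 0%R x w < c)%E] \is a fin_num.
Proof. by apply: fin_num_measure; exact: hit_before_measurable. Qed.

(** A path from [z] reaches the far side only through [x], which gives the inequality between
    occupation times of intervals there. Continuity of both Green functions brings it to the point
    [b]. *)
Lemma green_hit_le N z x b : 0 < N -> E z -> E x -> E b ->
  (z < x <= b) \/ (b <= x < z) ->
  (green `]0%R, N] z b <= P z (hits zeta X x) * green `]0%R, N] x b)%E.
Proof.
move=> N0 Ez Ex Eb sep.
rewrite hits_hit_time -!green_funE// -(fineK (hit_before_fin z x +oo%E)).
set h := fine _.
have h0 : 0 <= h by rewrite fine_ge0.
rewrite -EFinM lee_fin.
have [e e0 He] := state_space_margin Eb.
have Eeq u a' b' : E u -> (forall y, a' < y < b' -> E y) ->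
  (\int[m]_(y in `]a', b'[) (green_fun N u y)%:E = \int[m]_(y in `]a', b'[) green `]0%R, N] u y)%E.
  move=> Eu Eab; apply: eq_integral => y /[!inE]/=; rewrite in_itv/= => /Eab Ey.
  by rewrite green_funE.
have main a' b' : (forall y, a' < y < b' -> E y) ->
  (forall c y, [set z] c -> `]a', b'[%classic y -> y < x < c \/ c < x < y) ->
  (\int[m]_(y in `]a', b'[) (green_fun N z y)%:E <=
   \int[m]_(y in `]a', b'[) (h * green_fun N x y)%:E)%E.
  move=> Eab sep'; rewrite Eeq//.
  under [leRHS]eq_integral do rewrite EFinM.
  rewrite ge0_integralZl//; last 2 first.
  - by apply/measurable_EFinP; apply: measurable_funTS; exact: green_fun_measurable.
  - by move=> y _; rewrite lee_fin green_fun_ge0.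
  rewrite Eeq// integral_green_start//; last exact: I0.
  rewrite -(integral_green lr RD TD)//; last exact: I0.
  rewrite /h fineK ?hit_before_fin//.
  apply: (le_trans (occupation_le Xcont Xmeas Xmarkov (lexx 0) (in_at_start_history z) Ez _ _ _ _ sep')) => //.
  - exact: I0.
  - by move=> v u; rewrite /= !in_itv/= => /andP[v0 vN] /andP[u0 uv]; rewrite u0 (le_trans uv).
  rewrite probability_start//; exact: hit_before_measurable.
apply: (le_near_speed RD TD (F := green_fun N z) (G := fun b => h * green_fun N x b) Eb).
- exact: green_fun_continuous.
- by apply: cvgM; [exact: cvg_cst|exact: green_fun_continuous].
- exact: green_fun_measurable.
- by apply: measurable_funM => //; exact: green_fun_measurable.
- by move=> y; rewrite mulr_ge0 ?green_fun_ge0.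
(* The test intervals start at [b] and extend away from [z], so that [x] separates them strictly
   from [z] even if [b] equals [x]. *)
exists e => //; case: sep => /andP[s1 s2]; [left|right] => e' /andP[e'0 e'e]; apply: main.
- by move=> y /andP[y1 y2]; apply: He; rewrite ler_norml; lra.
- by move=> c y -> /=; rewrite in_itv/= => /andP[y1 y2]; right; apply/andP; split; lra.
- by move=> y /andP[y1 y2]; apply: He; rewrite ler_norml; lra.
- by move=> c y -> /=; rewrite in_itv/= => /andP[y1 y2]; left; apply/andP; split; lra.
Qed.

(** After a hit of [x] before time [c], a further horizon [N] fits into the horizon [N + c]; hence
    the longer horizon on the right and no assumption on the order of the points. *)
Lemma green_hit_ge N c z x b : 0 < N -> 0 < c -> E z -> E x -> E b ->
  (P z [set w | hit_time 0%R x w < c%:E] * green `]0%R, N] x b <=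
   green `]0%R, (N + c)%R] z b)%E.
Proof.
move=> N0 c0 Ez Ex Eb.
have Nc0 : 0 < N + c by rewrite addr_gt0.
rewrite -!green_funE// -(fineK (hit_before_fin z x c%:E)).
set h := fine _.
have h0 : 0 <= h by rewrite fine_ge0.
rewrite -EFinM lee_fin.
have [e e0 He] := state_space_margin Eb.
have Eeq M u a' b' : E u -> (forall y, a' < y < b' -> E y) ->
  (\int[m]_(y in `]a', b'[) (green_fun M u y)%:E = \int[m]_(y in `]a', b'[) green `]0%R, M] u y)%E.
  move=> Eu Eab; apply: eq_integral => y /[!inE]/=; rewrite in_itv/= => /Eab Ey.
  by rewrite green_funE.
apply: (le_near_speed RD TD (F := fun b => h * green_fun N x b) (G := green_fun (N + c) z) Eb).
- by apply: cvgM; [exact: cvg_cst|exact: green_fun_continuous].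
- exact: green_fun_continuous.
- by apply: measurable_funM => //; exact: green_fun_measurable.
- exact: green_fun_measurable.
- by move=> y; exact: green_fun_ge0.
exists e => //; left => e' /andP[e'0 e'e].
have Eab y : b < y < b + e' -> E y.
  by move=> /andP[y1 y2]; apply: He; rewrite ler_norml; lra.
rewrite [leRHS]Eeq//.
under [leLHS]eq_integral do rewrite EFinM.
rewrite ge0_integralZl//; last 2 first.
- by apply/measurable_EFinP; apply: measurable_funTS; exact: green_fun_measurable.
- by move=> y _; rewrite lee_fin green_fun_ge0.
rewrite Eeq// [leRHS]integral_green_start//; last exact: I0.
rewrite -(integral_green lr RD TD)//; last exact: I0.
rewrite /h fineK ?hit_before_fin//.
rewrite -(@probability_start z)//; last exact: hit_before_measurable.
have -> : [set w | (hit_time 0%R x w < c%:E)%E] =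
    [set w | (hit_time 0%R x w < 0%R%:E + c%:E)%E].
  by apply/seteqP; split => w /=; rewrite add0e.
apply: (occupation_ge Xcont Xmeas Xmarkov x b (b + e') (lexx 0) (in_at_start_history z) Ez) => //; try exact: I0.
move=> v u /=; rewrite !in_itv/= lte_fin => /andP[v0 vN] u0 uc.
by apply/andP; split; lra.
Qed.

End green_continuity.

(** * The potential kernel *)

Section transience.
Context {R : realType} {d : measure_display} {Omega : measurableType d}.
Variables (l r : \bar R) (m k : {measure set R -> \bar R})
  (p : R -> R -> R -> R) (zeta : Omega -> \bar R) (X : R -> Omega -> R)
  (P : R -> probability Omega R).
Hypothesis lr : (l < r)%E.
Let E := state_space l r.
Hypothesis RD : regular_diffusion E zeta X P m k.
Hypothesis TD : transition_density E zeta X P m p.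

Notation hit_time := (hit_time zeta X).
Notation transition := (transition zeta X P).
Notation q := (ext_density l r p).

Let Xcont := path_continuous RD.
Let Xmeas := event_measurable RD.
Let q0 := ext_density_ge0 TD.
Let qsym := ext_density_sym TD.

Notation mu := (@lebesgue_measure R).
Notation green := (green l r p).
Let msf : sigma_finite setT m := speed_sigma_finite lr RD.
Let mt x y : measurable_fun setT (fun t => (q t x y)%:E) :=
  density_time_measurable TD x y.

Lemma green_shift (I J : set R) s x y : measurable I -> measurable J ->
  (forall t, I t <-> J (t + s)) ->
  (\int[mu]_(t in I) (q (s + t) x y)%:E = green J x y)%E.
Proof.
move=> mI mJ IJ; rewrite /green [RHS]integral_mkcond.
rewrite -(@lebesgue_integral_shift _ _ s).
- rewrite integral_mkcond; apply: eq_integral => t _; rewrite !patchE addrC.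
  have -> : (t + s \in J) = (t \in I).
    by apply/idP/idP => /set_mem h; apply/mem_set; apply/IJ.
  by [].
- by apply/(measurable_restrictT _ _).1 => //; exact: measurable_funTS (mt x y).
- by move=> t; rewrite patchE; case: ifP => // _; rewrite lee_fin.
Qed.

(** Applying the semigroup for a time [s] shifts the window of time by [s], by Chapman-Kolmogorov
    under the time integral. *)
Lemma semigroup_green (I J : set R) s x y : 0 < s -> measurable I -> measurable J ->
  (forall t, I t -> 0 < t) -> (forall t, I t <-> J (t + s)) ->
  (\int[m]_z ((q s x z)%:E * green I z y) = green J x y)%E.
Proof.
move=> s0 mI mJ I0 IJ; rewrite -(green_shift x y mI mJ IJ).
transitivity (\int[m]_z \int[mu]_(t in I) (q s x z * q t z y)%:E)%E.
  apply: eq_integral => z _; rewrite -ge0_integralZl//.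
  - exact: measurable_funTS (mt z y).
  - by move=> t _; rewrite lee_fin.
  - by rewrite lee_fin.
rewrite (@tonelli_in _ _ _ _ R m mu (fun z t => (q s x z * q t z y)%:E) setT I) //.
- by apply: eq_integral => t /[!inE] It; exact: (chapman_kolmogorov lr RD TD _ _ s0 (I0 _ It)).
- exact: sigma_finiteT.
- by move=> z t; rewrite lee_fin mulr_ge0.
- under eq_fun do rewrite EFinM; apply: emeasurable_funM.
    apply/measurable_EFinP; apply: measurableT_comp => //.
    exact: (ext_density_measurable2 TD).
  rewrite (_ : (fun z : R * R => (q z.2 z.1 y)%:E) =
      (fun z : R * R => (q z.1 y z.2)%:E) \o (@unstable.swap R R)).
    apply: measurableT_comp; last exact: measurable_swap.
    exact: (density_time_measurable_pair TD).
  by apply/funext => z; rewrite /= qsym.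
Qed.

Definition potential x y := green `]0%R, +oo[ x y.

Lemma potential_kernelE x y : E x -> E y -> potential_kernel p x y = potential x y.
Proof.
move=> Ex Ey; apply: eq_integral => t; rewrite inE/= in_itv/= andbT => t0.
by rewrite ext_density_in.
Qed.

Lemma potential_ge0 x y : (0 <= potential x y)%E.
Proof. exact: (green_ge0 TD). Qed.

Lemma potential_sym x y : potential x y = potential y x.
Proof. exact: (green_sym TD). Qed.

Lemma green_le_potential N x y : (green `]0%R, N] x y <= potential x y)%E.
Proof.
apply: ge0_subset_integral => //.
- exact: measurable_funTS (mt x y).
- by move=> t _; rewrite lee_fin.
- by move=> t; rewrite /= !in_itv/= andbT => /andP[].
Qed.

Lemma green_cvg_potential x y :
  green `]0%R, n%:R] x y @[n --> \oo] --> potential x y.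
Proof.
rewrite /potential.
have -> : `]0, +oo[%classic = \bigcup_n `]0, (n%:R : R)]%classic.
  apply/seteqP; split => [t|t [n _]]; rewrite /= !in_itv/= andbT.
    move=> t0; exists (Num.bound t) => //=; rewrite in_itv/= t0.
    by rewrite ltW// archi_boundP// ltW.
  by case/andP.
apply: ge0_nondecreasing_set_cvg_integral => //.
- move=> i j ij; rewrite subsetEset => z /=; rewrite !in_itv/= => /andP[-> az].
  by rewrite (le_trans az)// ler_nat.
- by move=> n; exact: measurable_funTS (mt x y).
- by move=> n t _; rewrite lee_fin.
Qed.

Lemma potential_le x y C : (forall n : nat, green `]0%R, n.+1%:R] x y <= C)%E ->
  (potential x y <= C)%E.
Proof.
move=> H; apply: (cvge_to_le (@green_cvg_potential x y)).
exists 1%N => // n /= n0; case: n n0 => // n _; exact: H.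
Qed.

Lemma potential_hit_le z x b : E z -> E x -> E b ->
  (z < x <= b) \/ (b <= x < z) ->
  (potential z b <= P z (hits zeta X x) * potential x b)%E.
Proof.
move=> Ez Ex Eb sep; apply: potential_le => n.
apply: (le_trans (green_hit_le lr RD TD _ Ez Ex Eb sep)) => //.
apply: lee_wpmul2l; first exact: measure_ge0.
exact: green_le_potential.
Qed.

Lemma hits_cvg z x :
  P z [set w | (hit_time 0%R x w < n.+1%:R%:E)%E] @[n --> \oo] --> P z (hits zeta X x).
Proof.
rewrite hits_hit_time.
have -> : [set w | (hit_time 0%R x w < +oo)%E] =
    \bigcup_n [set w | (hit_time 0%R x w < n.+1%:R%:E)%E].
  apply/seteqP; split => w /=.
    move=> /(hit_time_at Xcont (lexx 0))[hE hs _].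
    exists (Num.bound (fine (hit_time 0%R x w))) => //=.
    rewrite [ltLHS]hE lte_fin (lt_trans (archi_boundP hs))// ltr_nat.
    exact: ltnSn.
  by move=> [n _] /= /lt_le_trans; apply; exact: leey.
apply: nondecreasing_cvg_mu.
- by move=> n; exact: hit_before_measurable.
- by apply: bigcup_measurable => n _; exact: hit_before_measurable.
- move=> i j ij; rewrite subsetEset => w /= /lt_le_trans; apply.
  by rewrite lee_fin ler_nat.
Qed.

Lemma potential_hit_before_ge z x b n : E z -> E x -> E b ->
  (P z [set w | hit_time 0%R x w < n.+1%:R%:E] * potential x b <=
   potential z b)%E.
Proof.
move=> Ez Ex Eb.
have h := hit_before_fin RD z x n.+1%:R%:E.
have cv : (P z [set w | hit_time 0%R x w < n.+1%:R%:E] *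
    green `]0%R, k%:R] x b)%E @[k --> \oo] -->
    (P z [set w | hit_time 0%R x w < n.+1%:R%:E] * potential x b)%E.
  by apply: cvgeZl => //; exact: green_cvg_potential.
apply: (cvge_to_le cv); exists 1%N => // -[//|j] _ /=.
apply: (le_trans (green_hit_ge lr RD TD _ _ Ez Ex Eb)) => //.
exact: green_le_potential.
Qed.

(** The upper bound is the limit of the finite horizons. For the lower bound the hits before [n + 1]
    exhaust all hits, and finiteness of [potential x b] lets the limit pass through the product. *)
Lemma potential_hit z x b : E z -> E x -> E b ->
  (z < x <= b) \/ (b <= x < z) -> (potential x b < +oo)%E ->
  (potential z b = P z (hits zeta X x) * potential x b)%E.
Proof.
move=> Ez Ex Eb sep xb; apply/eqP; rewrite eq_le potential_hit_le//=.
have ufin : potential x b \is a fin_num by rewrite ge0_fin_numE// potential_ge0.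
have cv := cvgeZr ufin (@hits_cvg z x).
by apply: (cvge_to_le cv); apply: nearW => n; exact: potential_hit_before_ge.
Qed.

Lemma hit_before_gt0 z x : E z -> E x -> exists n,
  (0 < P z [set w | (hit_time 0%R x w < n.+1%:R%:E)%E])%E.
Proof.
move=> Ez Ex; apply: contrapT => H.
have := regular RD Ez Ex; apply/negP; rewrite -leNgt.
apply: (cvge_to_le (@hits_cvg z x)); apply: nearW => n.
by rewrite leNgt; apply/negP => h; apply: H; exists n.
Qed.

(** A point [u] that reaches [b0] with positive probability inherits an infinite potential towards
    [b0]. By symmetry the potential from [b0] to [u] is infinite too, and it is at most the one from
    [u] to [u]. So every diagonal value is infinite, and with it every value. *)
Lemma potential_pinfty b0 x y : E b0 -> E x -> E y ->
  potential b0 b0 = +oo%E -> potential x y = +oo%E.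
Proof.
move=> Eb0 Ex Ey ub0.
have step u v : E u -> E v -> potential v v = +oo%E -> potential u v = +oo%E.
  move=> Eu Ev uv; have [n hn] := hit_before_gt0 Eu Ev.
  apply/eqP; rewrite -leye_eq -(gt0_muley hn) -uv.
  exact: potential_hit_before_ge.
have diag u : E u -> potential u u = +oo%E.
  move=> Eu; have [->//|ub] := eqVneq u b0.
  apply/eqP; rewrite -leye_eq -(step u b0 Eu Eb0 ub0) potential_sym.
  apply: (@le_trans _ _ (P b0 (hits zeta X u) * potential u u)%E).
    apply: potential_hit_le => //.
    by move: ub; rewrite neq_lt => /orP[h|h]; [right|left]; rewrite h lexx.
  rewrite -[leRHS]mul1e; apply: lee_wpmul2r; first exact: potential_ge0.
  by apply: probability_le1; rewrite hits_hit_time; exact: hit_before_measurable.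
exact: (step x y Ex Ey (diag y Ey)).
Qed.

(* The mass escaping from [W] would have to be compensated by the bounded
   quantity [green `]0, s] b b]. *)
Lemma green_ratio_large b s a' b' eps : E b -> potential b b = +oo%E -> 0 < s ->
  0 < eps <= 1 -> (0 < transition s b `]a', b'[%classic)%E ->
  exists z n, a' < z < b' /\
    ((1 - eps)%:E * green `]0%R, n.+1%:R] b b < green `]0%R, n.+1%:R] z b)%E.
Proof.
move=> Eb ub s0 /andP[eps0 eps1] W0; apply: contrapT => H.
set W := `]a', b'[%classic in W0.
have mW : measurable W by exact: measurable_itv.
have mCW : measurable (~` W) by exact: measurableC.
rewrite (transition_ext_density TD)// in W0.
have mq := ext_density_measurable2 TD s b.
have mqE : measurable_fun setT (fun z => (q s b z)%:E) by exact/measurable_EFinP.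
have qle A : measurable A -> (\int[m]_(z in A) (q s b z)%:E <= 1)%E.
  move=> mA; apply: le_trans (ext_density_sub_markov RD TD s b).
  by apply: ge0_subset_integral => // z _; rewrite lee_fin.
have qge0 A : (0 <= \int[m]_(z in A) (q s b z)%:E)%E.
  by apply: integral_ge0 => z _; rewrite lee_fin.
have qfin A : measurable A -> (\int[m]_(z in A) (q s b z)%:E)%E \is a fin_num.
  by move=> mA; rewrite ge0_fin_numE//; apply: le_lt_trans (qle A mA) _; exact: ltry.
have qsum : (\int[m]_(z in W) (q s b z)%:E + \int[m]_(z in ~` W) (q s b z)%:E <= 1)%E.
  rewrite -ge0_integral_setU//; last 3 first.
  - exact: measurable_funTS.
  - by move=> z _; rewrite lee_fin.
  - by apply/disj_setPS; rewrite setICr.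
  by apply: qle; exact: measurableU.
pose pi := fine (\int[m]_(z in W) (q s b z)%:E)%E.
pose pi' := fine (\int[m]_(z in ~` W) (q s b z)%:E)%E.
have pi0 : 0 < pi by rewrite fine_gt0// W0 -ge0_fin_numE ?qfin.
have pisum : pi + pi' <= 1 by rewrite -lee_fin EFinD !fineK ?qfin.
have piE : pi%:E = (\int[m]_(z in W) (q s b z)%:E)%E by rewrite /pi fineK// qfin.
have pi'E : pi'%:E = (\int[m]_(z in ~` W) (q s b z)%:E)%E by rewrite /pi' fineK// qfin.
pose A := fine (green `]0%R, s] b b).
have bound n : (green `]0%R, n.+1%:R] b b <= (A / (eps * pi))%:E)%E.
  pose I : set R := `]0, n.+1%:R]%classic.
  pose J : set R := `]s, (n.+1%:R + s)]%classic.
  have mI : measurable I by exact: measurable_itv.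
  have mJ : measurable J by exact: measurable_itv.
  have I0 t : I t -> 0 < t by rewrite /I/= in_itv/= => /andP[].
  have IJ t : I t <-> J (t + s).
    by rewrite /I /J/= !in_itv/= ltrDr lerD2r.
  have gfin : green I b b \is a fin_num.
    by rewrite ge0_fin_numE ?(green_ge0 TD)// (green_diag_fin lr RD TD).
  have Afin : green `]0%R, s] b b \is a fin_num.
    by rewrite ge0_fin_numE ?(green_ge0 TD)// (green_diag_fin lr RD TD).
  pose g := fine (green I b b).
  have g0 : 0 <= g by rewrite fine_ge0//; exact: (green_ge0 TD).
  have gE : g%:E = green I b b by rewrite fineK.
  have le1 : (green I b b <= green `]0%R, s] b b + green J b b)%E.
    rewrite /green -ge0_integral_setU//; last 3 first.
    - exact: measurable_funTS (mt b b).
    - by move=> t _; rewrite lee_fin.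
    - apply/disj_setPS => t [] /=; rewrite !in_itv/= => /andP[_ ts] /andP[st _].
      by move: (le_lt_trans ts st); rewrite ltxx.
    apply: ge0_subset_integral => //.
    - exact: measurableU.
    - exact: measurable_funTS (mt b b).
    - by move=> t _; rewrite lee_fin.
    - move=> t; rewrite /I/= in_itv/= => /andP[t0 tn].
      have [ts|st] := leP t s; [left|right]; rewrite /J/= in_itv/=; apply/andP; split; lra.
  have mg : measurable_fun setT (fun z => green I z b).
    have := green_measurable TD b mI; apply: eq_measurable_fun => z _.
    exact: (green_sym TD).
  have le2 : (green J b b <= ((1 - eps) * g * pi + g * pi')%:E)%E.
    rewrite -(semigroup_green b b s0 mI mJ I0 IJ).
    rewrite -(setUv W) ge0_integral_setU//; last 3 first.
    - by rewrite setUv; apply: emeasurable_funM.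
    - by move=> z _; rewrite mule_ge0 ?lee_fin ?(green_ge0 TD).
    - by apply/disj_setPS; rewrite setICr.
    rewrite EFinD [((1 - eps) * g * pi)%:E]EFinM [(g * pi')%:E]EFinM piE pi'E.
    apply: leeD.
    - rewrite -ge0_integralZl//; last 3 first.
      + exact: measurable_funTS.
      + by move=> z _; rewrite lee_fin.
      + by rewrite lee_fin mulr_ge0// subr_ge0.
      apply: ge0_le_integral => //.
      + by move=> z _; rewrite mule_ge0 ?lee_fin ?(green_ge0 TD).
      + by apply: measurable_funTS; exact: emeasurable_funM.
      + by apply: measurable_funTS; apply: measurable_funeM.
      move=> z; rewrite /W/= in_itv/= => zW; rewrite muleC.
      apply: lee_wpmul2r; first by rewrite lee_fin.
      rewrite EFinM gE leNgt; apply/negP => h; apply: H.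
      by exists z, n.
    - rewrite -ge0_integralZl//; last 2 first.
      + exact: measurable_funTS.
      + by move=> z _; rewrite lee_fin.
      apply: ge0_le_integral => //.
      + by move=> z _; rewrite mule_ge0 ?lee_fin ?(green_ge0 TD).
      + by apply: measurable_funTS; exact: emeasurable_funM.
      + by apply: measurable_funTS; apply: measurable_funeM.
      move=> z _; rewrite muleC.
      have [Ez|nEz] := pselect (E z); last first.
        by rewrite ext_density_out ?mule0// => -[].
      apply: lee_wpmul2r; first by rewrite lee_fin.
      rewrite gE; have [->//|zb] := eqVneq z b.
      apply: (le_trans (green_hit_le lr RD TD (ltr0Sn _ n) Ez Eb Eb _)).
        by move: zb; rewrite neq_lt => /orP[h|h]; [left|right]; rewrite h lexx.
      rewrite -[leRHS]mul1e; apply: lee_wpmul2r; first exact: (green_ge0 TD).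
      by apply: probability_le1; rewrite hits_hit_time; exact: hit_before_measurable.
  (* As [pi + pi' <= 1], what remains is [eps * pi * g <= A], a bound that is the same for all
     horizons. *)
  have : g <= A + ((1 - eps) * g * pi + g * pi').
    by rewrite -lee_fin gE EFinD fineK//; apply: (le_trans le1); apply: leeD.
  rewrite -/I -gE lee_fin ler_pdivlMr ?mulr_gt0// => h.
  have : g * (pi + pi') <= g * 1 by apply: ler_wpM2l.
  lra.
by have := potential_le bound; rewrite ub leye_eq.
Qed.

Lemma hits_self z : E z -> P z (hits zeta X z) = 1%E.
Proof.
move=> Ez; apply/eqP; rewrite eq_le; apply/andP; split.
  by apply: probability_le1; rewrite hits_hit_time; exact: hit_before_measurable.
rewrite -(started_at RD Ez); apply: le_measure; rewrite ?inE.
- by apply: Xmeas.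
- by rewrite hits_hit_time; exact: hit_before_measurable.
by move=> w h; exists 0.
Qed.

(** Starting points [z] are taken beyond [a] as seen from [b], so that the way from [z] to [b] leads
    through [a]. The Green function from [z] is then at most that from [a], which is at most the
    hitting probability times the diagonal one. By [green_ratio_large] some [z] and some horizon
    bring the ratio above [1 - eps]. *)
Lemma potential_infinite_recurrent b0 : E b0 -> potential b0 b0 = +oo%E ->
  recurrent E zeta X P.
Proof.
move=> Eb0 ub0 a b Ea Eb.
have mh x : measurable (hits zeta X x).
  by rewrite hits_hit_time; exact: hit_before_measurable.
have [->|ab] := eqVneq a b; first exact: hits_self.
have ub := potential_pinfty Eb0 Eb Eb ub0.
have [e e0 He] := state_space_margin Ea.
(* The interval adjoins [a] on the side away from [b]; the point [c] in it serves to show that it is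
   reached from [b]. *)
have [a' [b' [Eab' [c Ec acb]]]] : exists a' b', (forall z, a' < z < b' ->
    E z /\ ((z < a <= b) \/ (b <= a < z))) /\ exists2 c, E c & a' < c < b'.
  move: ab; rewrite neq_lt => /orP[ab|ba].
    exists (a - e), a; split.
      move=> z /andP[z1 z2]; split; first by apply: He; rewrite ler_norml; lra.
      by left; rewrite z2 ltW.
    exists (a - e / 2); last by apply/andP; split; lra.
    by apply: He; rewrite ler_norml; lra.
  exists a, (a + e); split.
    move=> z /andP[z1 z2]; split; first by apply: He; rewrite ler_norml; lra.
    by right; rewrite z1 ltW.
  exists (a + e / 2); last by apply/andP; split; lra.
  by apply: He; rewrite ler_norml; lra.
have [s s0 W0] := transition_gt0 RD Eb Ec acb.
apply/eqP; rewrite eq_le probability_le1//=.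
apply/lee_addgt0Pr => eps0 eps00.
pose eps := Num.min eps0 1.
have eps01 : 0 < eps <= 1 by rewrite lt_min eps00 ltr01 ge_min lexx orbT.
have [z [n [zab hz]]] := green_ratio_large Eb ub s0 eps01 W0.
have [Ez sep] := Eab' z zab.
have n0 : 0 < n.+1%:R :> R by [].
have gfin : green `]0%R, n.+1%:R] b b \is a fin_num.
  by rewrite ge0_fin_numE ?(green_ge0 TD)// (green_diag_fin lr RD TD).
have h1 : (green `]0%R, n.+1%:R] z b <= green `]0%R, n.+1%:R] a b)%E.
  apply: (le_trans (green_hit_le lr RD TD n0 Ez Ea Eb sep)).
  rewrite -[leRHS]mul1e; apply: lee_wpmul2r; first exact: (green_ge0 TD).
  exact: probability_le1.
have h2 : (green `]0%R, n.+1%:R] a b <= P a (hits zeta X b) * green `]0%R, n.+1%:R] b b)%E.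
  apply: (green_hit_le lr RD TD n0 Ea Eb Eb).
  by move: ab; rewrite neq_lt => /orP[h|h]; [left|right]; rewrite h lexx.
have := lt_le_trans hz (le_trans h1 h2).
have hfin : P a (hits zeta X b) \is a fin_num by apply: fin_num_measure.
rewrite -(fineK gfin) -(fineK hfin) -!EFinM lte_fin -EFinD lee_fin => h.
have g0 : 0 <= fine (green `]0%R, n.+1%:R] b b) by rewrite fine_ge0//; exact: (green_ge0 TD).
have g1 : 0 < fine (green `]0%R, n.+1%:R] b b).
  rewrite lt_neqAle g0 andbT eq_sym; apply/eqP => g00.
  by move: h; rewrite g00 !mulr0 ltxx.
move: h; rewrite ltr_pM2r// => h.
have : eps <= eps0 by rewrite ge_min lexx.
lra.
Qed.

Lemma potential_fin x y : transient E zeta X P -> E x -> E y ->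
  (potential x y < +oo)%E.
Proof.
move=> tr Ex Ey; rewrite ltey; apply/eqP => uxy.
have [xy|xy] := eqVneq x y.
  by apply: tr; apply: (potential_infinite_recurrent Ex); rewrite {2}xy.
have uyy : potential y y = +oo%E.
  apply/eqP; rewrite -leye_eq -uxy.
  apply: (@le_trans _ _ (P x (hits zeta X y) * potential y y)%E).
    apply: potential_hit_le => //.
    by move: xy; rewrite neq_lt => /orP[h|h]; [left|right]; rewrite h lexx.
  rewrite -[leRHS]mul1e; apply: lee_wpmul2r; first exact: potential_ge0.
  by apply: probability_le1; rewrite hits_hit_time; exact: hit_before_measurable.
by apply: tr; exact: (potential_infinite_recurrent Ey).
Qed.

Lemma potential_gt0_of_density t x z : 0 < t -> E x -> E z -> 0 < q t x z ->
  (0 < potential x z)%E.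
Proof.
move=> t0 Ex Ez qt.
have c0 : 0 < q t x z / 2 by rewrite divr_gt0.
have /cvgrPdist_lt/(_ _ c0)/nbhs_ballP[e /= e0 He] :=
  ext_density_continuous_time TD t0 Ex Ez.
have e20 : 0 < e / 2 by rewrite divr_gt0.
apply: (@lt_le_trans _ _ (\int[mu]_(v in `[t, (t + e / 2)%R]) (q t x z / 2)%:E)%E).
  rewrite integral_cst//= lebesgue_measure_itv/= lte_fin ltrDl e20.
  by rewrite -EFinB -EFinM lte_fin mulr_gt0// addrAC subrr add0r.
apply: (@le_trans _ _ (\int[mu]_(v in `[t, (t + e / 2)%R]) (q v x z)%:E)%E).
  apply: ge0_le_integral => //.
  - by move=> v _; rewrite lee_fin ltW.
  - exact: measurable_funTS (mt x z).
  move=> v /=; rewrite in_itv/= => /andP[tv vt]; rewrite lee_fin.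
  have := He v; rewrite /ball/= ltr_norml => /(_ ltac:(by apply/andP; split; lra)).
  by rewrite ltr_norml; lra.
apply: ge0_subset_integral => //.
- exact: measurable_funTS (mt x z).
- by move=> v _; rewrite lee_fin.
- by move=> v; rewrite /= !in_itv/= andbT => /andP[tv _]; exact: lt_le_trans tv.
Qed.

Lemma potential_le_diag x y : E x -> E y -> (potential x y <= potential y y)%E.
Proof.
move=> Ex Ey; have [->//|xy] := eqVneq x y.
apply: (@le_trans _ _ (P x (hits zeta X y) * potential y y)%E).
  apply: potential_hit_le => //.
  by move: xy; rewrite neq_lt => /orP[h|h]; [left|right]; rewrite h lexx.
rewrite -[leRHS]mul1e; apply: lee_wpmul2r; first exact: potential_ge0.
by apply: probability_le1; rewrite hits_hit_time; exact: hit_before_measurable.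
Qed.

Lemma potential_diag_gt0 x : E x -> (0 < potential x x)%E.
Proof.
move=> Ex; have [e e0 He] := state_space_margin Ex.
have [t t0 W0] := transition_gt0 RD (a := x - e) (b := x + e) Ex Ex ltac:(by rewrite ltrBlDr ltrDl e0).
rewrite (transition_ext_density TD)// in W0.
have [z [zW qz]] : exists z, `](x - e)%R, (x + e)%R[%classic z /\ 0 < q t x z.
  apply: contrapT => H; move: W0; rewrite integral0_eq ?ltxx// => z zW.
  congr (_%:E); apply/eqP; rewrite eq_le q0 andbT leNgt; apply/negP => h.
  by apply: H; exists z.
have Ez : E z.
  by apply: He; move: zW; rewrite /= in_itv/= ler_norml => /andP[z1 z2]; apply/andP; split; lra.
apply: lt_le_trans (potential_gt0_of_density t0 Ex Ez qz) _.
by rewrite potential_sym; exact: potential_le_diag.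
Qed.

(** The potential is positive everywhere, by symmetry, regularity and its positivity on the
    diagonal, and [m] charges the interval. This integral is the factor to be cancelled in the law
    of the hits after [s]. *)
Lemma integral_potential_gt0 x a b : transient E zeta X P -> E x -> E a -> E b ->
  a < b -> (0 < \int[m]_(y in `]a, b[) potential x y)%E.
Proof.
move=> tr Ex Ea Eb ab.
have mU : measurable_fun setT (potential x).
  by apply: (green_measurable TD); exact: measurable_itv.
rewrite lt0e integral_ge0 ?andbT; last by move=> y _; exact: potential_ge0.
apply/eqP => I0.
have mB : measurable `]a, b[%classic by exact: measurable_itv.
have : ae_eq m `]a, b[%classic (potential x) (cst 0%E).
  apply/ae_eq_integral_abs => //; first exact: measurable_funTS.
  by rewrite -[RHS]I0; apply: eq_integral => y _; rewrite gee0_abs// potential_ge0.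
move=> [N [mN N0 HN]].
have := speed_itv_gt0 RD TD Ea Eb ab; apply/negP; rewrite -leNgt -N0.
apply: le_measure; rewrite ?inE// => y yB; apply: HN => /= /(_ yB) /eqP.
have Ey : E y.
  apply: (state_space_between Ea Eb); move: yB; rewrite /= in_itv/= => /andP[y1 y2].
  by rewrite !ltW.
rewrite potential_sym; have [->|yx] := eqVneq y x.
  by rewrite gt_eqF// potential_diag_gt0.
rewrite (@potential_hit y x x) ?potential_fin//.
  by rewrite mule_eq0 !gt_eqF ?potential_diag_gt0 ?(regular RD).
by move: yx; rewrite neq_lt => /orP[h|h]; [left|right]; rewrite h lexx.
Qed.

End transience.

(** * The law of the last hitting time *)

Section last_hitting.
Context {R : realType} {d : measure_display} {Omega : measurableType d}.
Variables (l r : \bar R) (m k : {measure set R -> \bar R})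
  (p : R -> R -> R -> R) (zeta : Omega -> \bar R) (X : R -> Omega -> R)
  (P : R -> probability Omega R).
Hypothesis lr : (l < r)%E.
Let E := state_space l r.
Hypothesis RD : regular_diffusion E zeta X P m k.
Hypothesis TD : transition_density E zeta X P m p.

Notation in_at := (in_at zeta X).
Notation history := (history zeta X).
Notation hit_time := (hit_time zeta X).
Notation transition := (transition zeta X P).
Notation q := (ext_density l r p).

Let Xcont := path_continuous RD.
Let Xmeas := event_measurable RD.
Let Xmarkov := diffusion_strong_markov RD.
Let q0 := ext_density_ge0 TD.
Let qsym := ext_density_sym TD.

Notation mu := (@lebesgue_measure R).
Notation green := (green l r p).
Notation potential := (potential l r p).
Let msf : sigma_finite setT m := speed_sigma_finite lr RD.
Let mt x y : measurable_fun setT (fun t => (q t x y)%:E) :=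
  density_time_measurable TD x y.
Let I := `]0%R, +oo[%classic : set R.
Let mI : measurable I. Proof. exact: measurable_itv. Qed.
Let I0 v : I v -> 0 < v. Proof. by rewrite /I/= in_itv/= andbT. Qed.

Hypothesis tr : transient E zeta X P.

Definition hit_after s x := [set w | (hit_time s x w < +oo)%E].

Lemma potential_measurable x : measurable_fun setT (potential x).
Proof. exact: (green_measurable TD x mI). Qed.

Lemma potential_measurable_pair :
  measurable_fun setT (fun w : R * R => potential w.1 w.2).
Proof.
have f0 (zb : R * R) (t : R) : (0 <= (q t zb.1 zb.2)%:E)%E by rewrite lee_fin.
suff mf : measurable_fun setT (fun z : R * R * R => (q z.2 z.1.1 z.1.2)%:E).
  apply: (@measurable_fun_integral1 _ _ _ _ R mu (sigma_finiteT _) (fun (zb : R * R) t => (q t zb.1 zb.2)%:E)) => //.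
apply/measurable_EFinP.
apply: (measurableT_comp (f := fun z : R * R * R => q z.1.1 z.1.2 z.2)
  (ext_density_measurable TD) (g := fun w : R * R * R => (w.2, w.1.1, w.1.2))).
apply: measurable_fun_pair; last exact: measurableT_comp.
by apply: measurable_fun_pair => //; exact: measurableT_comp.
Qed.

Lemma potential_measurable_l x : measurable_fun setT (potential^~ x).
Proof.
by apply: eq_measurable_fun (potential_measurable x) => z _; rewrite (potential_sym TD).
Qed.

(** The expected time spent after [s] in a test interval beyond [x] is computed twice. The hit of
    [x] after [s] gives the hitting probability times the integral of [potential x]; the Markov
    property at [s] gives an integral of [potential z], which factors through [x] as well. The
    integral over the test interval is positive and finite and cancels. *)
Lemma hit_after_in_at_side s x y C a b : 0 < s -> E x -> E y -> measurable C ->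
  E a -> E b -> a < b ->
  (forall c z, C c -> `]a, b[%classic z -> (z < x < c) \/ (c < x < z)) ->
  (P y (in_at s C `&` hit_after s x) * potential x x =
   \int[m]_(z in C) ((q s y z)%:E * potential z x))%E.
Proof.
move=> s0 Ex Ey mC Ea Eb ab sep.
set B := `]a, b[%classic in sep.
have mB : measurable B by exact: measurable_itv.
have Bin z : B z -> E z.
  rewrite /B/= in_itv/= => /andP[az zb].
  by apply: (state_space_between Ea Eb); rewrite !ltW.
have UB0 : (0 < \int[m]_(z in B) potential x z)%E.
  exact: (integral_potential_gt0 lr RD TD).
have Ufin : potential x x \is a fin_num.
  by rewrite ge0_fin_numE ?(potential_ge0 TD)// (potential_fin lr RD TD tr).
have UBfin : (\int[m]_(z in B) potential x z)%E \is a fin_num.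
  rewrite ge0_fin_numE ?ltW//.
  apply: (@le_lt_trans _ _ (\int[m]_(z in B) potential x x)%E).
    apply: ge0_le_integral => //.
    - by move=> z _; exact: (potential_ge0 TD).
    - exact: measurable_funTS (potential_measurable x).
    move=> z Bz; rewrite (potential_sym TD).
    exact: (potential_le_diag lr RD TD (Bin _ Bz) Ex).
  have := integral_cst m mB (potential x x); rewrite /cst => ->.
  apply: lte_mul_pinfty => //; first exact: (potential_ge0 TD).
  exact: (speed_itvoo_fin RD Ea Eb).
have hA : history s (in_at s C) by apply: in_at_history => //; exact: ltW.
have occ : (\int[mu]_(v in I) P y (in_at s C `&` in_at (s + v) B) =
   P y (in_at s C `&` hit_after s x) * \int[m]_(z in B) potential x z)%E.
  rewrite -(integral_green lr RD TD)//.
  apply/eqP; rewrite eq_le; apply/andP; split.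
    apply: (occupation_le Xcont Xmeas Xmarkov (ltW s0) hA Ey mI I0 _ _ sep) => //.
    by move=> v u _ /andP[u0 _]; rewrite /I/= in_itv/= u0.
  have -> : hit_after s x = [set w | (hit_time s x w < s%:E + +oo)%E].
    by apply/seteqP; split => w; rewrite /hit_after /= addey.
  apply: (occupation_ge Xcont Xmeas Xmarkov x a b (ltW s0) hA Ey mI mI I0 I0).
  by move=> v u /I0 v0 u0 _; rewrite /I/= in_itv/= andbT ltr_wpDr.
(* Both sides contain the probability of hitting [x] from [z]: it relates [z] to the points of [B]
   and, equally, [z] to [x] itself. *)
have hit z : C z -> E z -> (\int[m]_(b in B) potential z b * potential x x =
    potential z x * \int[m]_(b in B) potential x b)%E.
  move=> Cz Ez.
  have sepb b' : B b' -> (z < x <= b') \/ (b' <= x < z).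
    move=> Bb; have [/andP[h1 h2]|/andP[h1 h2]] := sep z b' Cz Bb; [right|left].
      by rewrite h2 ltW.
    by rewrite h1 ltW.
  have c : a < (a + b) / 2 < b by apply/andP; split; lra.
  have zx : (z < x <= x) \/ (x <= x < z).
    have := sepb ((a + b) / 2); rewrite /B/= in_itv/= c => /(_ isT).
    by rewrite lexx => -[/andP[-> _]|/andP[_ ->]]; [left|right].
  rewrite [potential z x](@potential_hit _ _ _ _ _ _ _ _ _ _ _ lr RD TD z x x)//; last first.
    exact: (potential_fin lr RD TD).
  have -> : (\int[m]_(b in B) potential z b =
      P z (hits zeta X x) * \int[m]_(b in B) potential x b)%E.
    rewrite -ge0_integralZl//; last 2 first.
    - exact: measurable_funTS (potential_measurable x).
    - by move=> b' _; exact: (potential_ge0 TD).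
    apply: eq_integral => b' /[!inE] Bb.
    apply: (potential_hit lr RD TD) => //; [exact: Bin|exact: sepb|].
    exact: (potential_fin lr RD TD tr Ex (Bin _ Bb)).
  by rewrite -!muleA; congr (_ * _)%E; rewrite muleC.
have occ2 : (\int[mu]_(v in I) P y (in_at s C `&` in_at (s + v) B) =
    \int[m]_(z in C) ((q s y z)%:E * \int[m]_(b in B) potential z b))%E.
  transitivity (\int[mu]_(v in I) \int[m]_(z in C)
      (\int[m]_(b in B) (q v z b)%:E * (q s y z)%:E))%E.
    apply: eq_integral => v /[!inE] Iv.
    exact: (markov_ext_density lr RD TD s0 (I0 Iv) Ey mB mC).
  rewrite (@tonelli_in _ _ _ _ R mu m
    (fun v z => (\int[m]_(b in B) (q v z b)%:E * (q s y z)%:E)%E))//.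
  - apply: eq_integral => z _.
    have mzq : measurable_fun setT (fun w : R * R => (q w.1 z w.2)%:E).
      exact: (density_time_measurable_pair TD).
    have -> : (\int[m]_(b in B) potential z b =
        \int[mu]_(v in I) \int[m]_(b in B) (q v z b)%:E)%E.
      rewrite (@tonelli_in _ _ _ _ R mu m (fun v b => (q v z b)%:E))//.
        exact: sigma_finiteT.
      by move=> v b'; rewrite lee_fin.
    rewrite -ge0_integralZl//; last 3 first.
    + apply: measurable_funTS.
      apply: (@measurable_fun_integral1 _ _ R R R m msf (fun v b => (q v z b)%:E)) => //.
      by move=> v b'; rewrite lee_fin.
    + by move=> v _; apply: integral_ge0 => b' _; rewrite lee_fin.
    + by rewrite lee_fin.
    by apply: eq_integral => v _; rewrite muleC.
  - exact: sigma_finiteT.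
  - by move=> v z; rewrite mule_ge0 ?lee_fin//; apply: integral_ge0 => b' _; rewrite lee_fin.
  - apply: emeasurable_funM.
      apply: (@measurable_fun_integral1 _ _ (R * R)%type R R m msf
        (fun vz b => (q vz.1 vz.2 b)%:E)) => //.
        by move=> vz b'; rewrite lee_fin.
      by apply/measurable_EFinP; exact: (ext_density_measurable TD).
    apply/measurable_EFinP; apply: measurableT_comp => //.
    exact: (ext_density_measurable2 TD).
pose c := fine (\int[m]_(z in B) potential x z).
have cE : c%:E = (\int[m]_(z in B) potential x z)%E by rewrite /c fineK.
have c0 : c != 0 by rewrite gt_eqF// fine_gt0// UB0 -ge0_fin_numE ?ltW.
have cancel : (\int[m]_(z in B) potential x z * (c^-1)%:E = 1)%E.
  by rewrite -cE -EFinM mulfV.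
rewrite -[LHS]mule1 -[RHS]mule1 -cancel !muleA; congr (_ * _)%E.
have mq : measurable_fun setT (fun z => (q s y z)%:E).
  by apply/measurable_EFinP; exact: (ext_density_measurable2 TD).
have qE0 z : (0 <= (q s y z)%:E)%E by rewrite lee_fin.
rewrite muleAC -occ occ2 muleC -ge0_integralZl; [|exact: mC| | |exact: (potential_ge0 TD)].
- rewrite [RHS]muleC -ge0_integralZl; [|exact: mC| | |exact: ltW].
  + apply: eq_integral => z /[!inE] Cz.
    have [Ez|nEz] := pselect (E z); last first.
      by rewrite ext_density_out ?mul0e ?mule0// => -[].
    rewrite muleCA (muleC (potential x x)) hit//.
    by rewrite [RHS]muleCA (muleC (potential z x)).
  + apply: measurable_funTS; apply: emeasurable_funM => //.
    exact: potential_measurable_l.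
  + by move=> z _; apply: mule_ge0 => //; exact: (potential_ge0 TD).
- apply: measurable_funTS; apply: emeasurable_funM => //.
  apply: (@measurable_fun_integral1 _ _ R R R m msf (fun z b => potential z b)) => //.
    by move=> u v; exact: (potential_ge0 TD).
  exact: potential_measurable_pair.
- move=> z _; apply: mule_ge0 => //.
  by apply: integral_ge0 => b' _; exact: (potential_ge0 TD).
Qed.

(** The position at time [s] is below, above or at [x]. In the first two cases the test interval is
    taken on the opposite side of [x]; in the third the hit is immediate. The three integrals add up
    to the semigroup applied to the potential, which is the potential with its time window shifted
    by [s]. *)
Lemma hit_after_law s x y : 0 < s -> E x -> E y ->
  (P y (hit_after s x) * potential x x = green `]s, +oo[ y x)%E.
Proof.
move=> s0 Ex Ey.
have mH : measurable (hit_after s x).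
  by apply: hit_before_measurable => //; exact: ltW.
have [e e0 He] := state_space_margin Ex.
have Exe u : `|u - x| <= e -> E u by exact: He.
have Exl : E (x - e) by apply: He; rewrite ler_norml; lra.
have Exr : E (x + e) by apply: He; rewrite ler_norml; lra.
have mA (C : set R) : measurable C -> measurable (in_at s C `&` hit_after s x).
  by move=> mC; apply: measurableI => //; apply: Xmeas => //; exact: ltW.
have mq : measurable_fun setT (fun z => (q s y z)%:E).
  by apply/measurable_EFinP; exact: (ext_density_measurable2 TD).
have qE0 z : (0 <= (q s y z)%:E)%E by rewrite lee_fin.
pose L : set R := `]-oo, x[%classic.
pose G : set R := `]x, +oo[%classic.
have mL : measurable L by exact: measurable_itv.
have mG : measurable G by exact: measurable_itv.
have split : hit_after s x = (in_at s L `&` hit_after s x) `|`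
    ((in_at s G `&` hit_after s x) `|` (in_at s [set x] `&` hit_after s x)).
  apply/seteqP; split => [w Hw|w [[]|[[]|[]]]]//.
  have /hit_time_ltP[t [st _ [tz _]]] := Hw.
  have sz : (s%:E < zeta w)%E by rewrite (le_lt_trans _ tz)// lee_fin.
  have [h|h|h] := ltgtP (X s w) x.
  - by left; split => //; split => //; rewrite /L/= in_itv.
  - by right; left; split => //; split => //; rewrite /G/= in_itv/= andbT.
  - by right; right.
have PE : P y (hit_after s x) = (P y (in_at s L `&` hit_after s x) +
    (P y (in_at s G `&` hit_after s x) + P y (in_at s [set x] `&` hit_after s x)))%E.
  rewrite {1}split measureU; [|exact: mA|by apply: measurableU; exact: mA|].
    rewrite measureU; [by []|exact: mA|exact: mA|].
    apply/seteqP; split => // w [[[_ h1] _] [[_ /= h2] _]].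
    by move: h1; rewrite h2 /G/= in_itv/= ltxx.
  apply/seteqP; split => // w [[[_ +] _]].
  rewrite /L/= in_itv/= => h1 [[[_ +] _]|[[_ /= h2] _]].
    by rewrite /G/= in_itv/= andbT => /(lt_trans h1); rewrite ltxx.
  by move: h1; rewrite h2 ltxx.
have IE : (green `]s, +oo[ y x = \int[m]_(z in L) ((q s y z)%:E * potential z x) +
   (\int[m]_(z in G) ((q s y z)%:E * potential z x) +
    \int[m]_(z in [set x]) ((q s y z)%:E * potential z x)))%E.
  rewrite -(semigroup_green lr RD TD y x s0 mI _ I0); last 2 first.
  - exact: measurable_itv.
  - by move=> t; rewrite /I/= !in_itv/= !andbT ltrDr.
  have mf : measurable_fun setT (fun z => (q s y z)%:E * green I z x)%E.
    by apply: emeasurable_funM => //; exact: potential_measurable_l.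
  have f0 z : (0 <= (q s y z)%:E * green I z x)%E.
    by apply: mule_ge0 => //; exact: (green_ge0 TD).
  have -> : [set: R] = L `|` (G `|` [set x]).
    apply/seteqP; split => // z _; rewrite /L /G/= !in_itv/= andbT.
    by have [h|h|h] := ltgtP z x; [left|right; left|right; right].
  rewrite ge0_integral_setU//; last 3 first.
  - exact: measurableU.
  - exact: measurable_funTS.
  - apply/disj_setPS => z [+ [|]]; rewrite /L/= in_itv/= => h1.
      by rewrite /G/= in_itv/= andbT => /(lt_trans h1); rewrite ltxx.
    by move=> h2; move: h1; rewrite h2 ltxx.
  rewrite ge0_integral_setU//.
  - exact: measurable_funTS.
  - apply/disj_setPS => z [+ h2]; rewrite h2 /G/= in_itv/= ltxx//.
have U0 : (0 <= potential x x)%E by exact: (potential_ge0 TD).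
rewrite PE IE ge0_muleDl ?adde_ge0 ?measure_ge0//.
rewrite ge0_muleDl ?measure_ge0//.
have -> : (P y (in_at s L `&` hit_after s x) * potential x x =
    \int[m]_(z in L) ((q s y z)%:E * potential z x))%E.
  apply: (@hit_after_in_at_side s x y L x (x + e)) => //; first by rewrite ltrDl.
  by move=> c z; rewrite /L/= !in_itv/= => cx /andP[xz _]; right; rewrite cx.
have -> : (P y (in_at s G `&` hit_after s x) * potential x x =
    \int[m]_(z in G) ((q s y z)%:E * potential z x))%E.
  apply: (@hit_after_in_at_side s x y G (x - e) x) => //; first by rewrite ltrBlDr ltrDl.
  by move=> c z; rewrite /G/= !in_itv/= andbT => xc /andP[_ zx]; left; rewrite zx.
congr (_ + (_ + _))%E.
have -> : in_at s [set x] `&` hit_after s x = in_at s [set x].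
  by apply/setIidl => w sx; apply/hit_time_ltP; exists s; rewrite ltry lexx.
transitivity (transition s y [set x] * potential x x)%E; first by [].
rewrite (transition_ext_density TD)// muleC -ge0_integralZl//.
- by apply: eq_integral => z /[!inE] ->; rewrite muleC.
- exact: measurable_funTS.
Qed.

Lemma last_hitting_gtP x w s : 0 <= s ->
  (s%:E < last_hitting_time zeta X x w)%E <->
  exists2 t, s < t & in_at t [set x] w.
Proof.
move=> s0; split.
  move=> /ereal_sup_gt[_ [->|[t [t0 tx] <-]]].
    by rewrite lte_fin ltNge s0.
  by rewrite lte_fin => st; exists t.
move=> [t st tx]; apply: (@lt_le_trans _ _ t%:E); first by rewrite lte_fin.
by apply: ereal_sup_ubound; right; exists t => //; split => //; lra.
Qed.

Lemma last_hitting_ge0 x w : (0 <= last_hitting_time zeta X x w)%E.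
Proof. by apply: ereal_sup_ubound; left. Qed.

(** A last hit strictly after [s] needs a hit strictly after [s], whereas [hit_after] admits one at
    [s]. The union also reaches [s = 0], although [hit_after_law] requires a positive time. *)
Lemma last_hitting_gt_bigcup x s : 0 <= s ->
  [set w | (s%:E < last_hitting_time zeta X x w)%E] =
  \bigcup_n hit_after (s + n.+1%:R^-1) x.
Proof.
move=> s0; apply/seteqP; split => w.
  move=> /(last_hitting_gtP _ _ s0)[t st tx].
  have st0 : 0 < t - s by rewrite subr_gt0.
  have [n _ /(_ n (leqnn n)) hn] := near_infty_natSinv_lt (PosNum st0).
  exists n => //; apply/hit_time_ltP; exists t; split => //; last exact: ltry.
  by move: hn => /=; rewrite ltrBrDl => /ltW.
move=> [n _] /hit_time_ltP[t [st _ tx]]; apply/last_hitting_gtP => //.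
exists t => //; apply: lt_le_trans st.
by rewrite ltrDl invr_gt0.
Qed.

Lemma last_hitting_measurable x :
  measurable_fun setT (last_hitting_time zeta X x).
Proof.
apply: (measurability _ (ErealGenOInfty.measurableE R)).
move=> _ [_ [c ->]] <-; rewrite setTI.
rewrite (_ : _ @^-1` _ = [set w | (c%:E < last_hitting_time zeta X x w)%E]).
  have [c0|c0] := leP 0 c.
    rewrite last_hitting_gt_bigcup//; apply: bigcup_measurable => n _.
    by apply: hit_before_measurable => //; rewrite addr_ge0// invr_ge0.
  rewrite (_ : [set w | _] = setT)//.
  apply/seteqP; split => // w _ /=.
  by apply: lt_le_trans (last_hitting_ge0 x w); rewrite lte_fin.
by apply/seteqP; split => w; rewrite /= in_itv/= andbT.
Qed.

Lemma green_time_cvg x y s : 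
  green `](s + n.+1%:R^-1)%R, +oo[ y x @[n --> \oo] --> green `]s, +oo[ y x.
Proof.
rewrite /green.
have -> : `]s, +oo[%classic = \bigcup_n `](s + n.+1%:R^-1), +oo[%classic.
  apply/seteqP; split => [t|t [n _]]; rewrite /= !in_itv/= !andbT.
    move=> st; have st0 : 0 < t - s by rewrite subr_gt0.
    have [n _ /(_ n (leqnn n)) hn] := near_infty_natSinv_lt (PosNum st0).
    by exists n => //=; rewrite in_itv/= andbT -ltrBrDl.
  by apply: lt_trans; rewrite ltrDl invr_gt0.
apply: ge0_nondecreasing_set_cvg_integral => //.
- move=> i j ij; rewrite subsetEset => z /=; rewrite !in_itv/= !andbT.
  apply: le_lt_trans; rewrite lerD2l lef_pV2 ?posrE//.
  by rewrite ler_nat.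
- by move=> n; exact: measurable_funTS (mt y x).
- by move=> n t _; rewrite lee_fin.
Qed.

Lemma last_hitting_gt_law x y s : 0 <= s -> E x -> E y ->
  (P y [set w | (s%:E < last_hitting_time zeta X x w)%E] * potential x x =
   green `]s, +oo[ y x)%E.
Proof.
move=> s0 Ex Ey.
have Ufin : potential x x \is a fin_num.
  by rewrite ge0_fin_numE ?(potential_ge0 TD)// (potential_fin lr RD TD tr).
have mh n : measurable (hit_after (s + n.+1%:R^-1) x).
  by apply: hit_before_measurable => //; rewrite addr_ge0// invr_ge0.
have cv : P y (hit_after (s + n.+1%:R^-1) x) @[n --> \oo] -->
    P y [set w | (s%:E < last_hitting_time zeta X x w)%E].
  rewrite last_hitting_gt_bigcup//; apply: nondecreasing_cvg_mu => //.
    exact: bigcup_measurable.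
  move=> i j ij; rewrite subsetEset => w /hit_time_ltP[t [st too tx]].
  apply/hit_time_ltP; exists t; split => //; apply: le_trans st.
  by rewrite lerD2l lef_pV2 ?posrE// ler_nat.
have lawE n : (P y (hit_after (s + n.+1%:R^-1)%R x) * potential x x =
    green `](s + n.+1%:R^-1)%R, +oo[ y x)%E.
  by apply: hit_after_law => //; rewrite ltr_wpDl// invr_gt0.
have := cvgeZr Ufin cv; rewrite (funext lawE) => h.
exact: (cvg_unique _ h (@green_time_cvg x y s)).
Qed.

(** An infinite last hit exceeds every [n], so its probability times [potential x x] is at most the
    tail beyond [n] of the convergent integral [potential y x]. *)
Lemma last_hitting_fin x y : E x -> E y ->
  P y [set w | last_hitting_time zeta X x w = +oo%E] = 0%E.
Proof.
move=> Ex Ey.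
have mG := last_hitting_measurable x.
have mI' : measurable [set w | last_hitting_time zeta X x w = +oo%E].
  by rewrite -[X in measurable X]setTI; exact: (mG measurableT [set +oo%E]).
set Pi := P y _.
have Uxfin : potential x x \is a fin_num.
  by rewrite ge0_fin_numE ?(potential_ge0 TD)// (potential_fin lr RD TD tr).
have Uyfin : potential y x \is a fin_num.
  by rewrite ge0_fin_numE ?(potential_ge0 TD)// (potential_fin lr RD TD tr).
have Pfin : Pi \is a fin_num by exact: fin_num_measure.
have PUfin : (Pi * potential x x)%E \is a fin_num by exact: fin_numM.
have bound n : (green `]0%R, n.+1%:R] y x <= potential y x - Pi * potential x x)%E.
  rewrite leeBrDr//.
  have n0 : 0 <= n.+1%:R :> R by [].
  pose J := `]0, n.+1%:R]%classic : set R.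
  have mJ : measurable J by exact: measurable_itv.
  have JI : J `<=` I by move=> t; rewrite /I /J/= !in_itv/= andbT => /andP[].
  rewrite [potential y x](green_setD TD y x mI mJ JI).
  apply: leeD; first exact: lexx.
  have -> : I `\` J = `]n.+1%:R, +oo[%classic.
    apply/seteqP; split => t; rewrite /I /J/= !in_itv/= !andbT.
      move=> [t0 /negP]; rewrite t0/= -ltNge//.
    move=> nt; have t0 : 0 < t by apply: le_lt_trans nt.
    by split => //; rewrite t0/=; apply/negP; rewrite -ltNge.
  rewrite -(last_hitting_gt_law n0 Ex Ey); apply: lee_wpmul2r.
    exact: (potential_ge0 TD).
  apply: le_measure; rewrite ?inE//.
    rewrite last_hitting_gt_bigcup//; apply: bigcup_measurable => j _.
    by apply: hit_before_measurable => //; rewrite addr_ge0// invr_ge0.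
  by move=> w /= ->; rewrite ltry.
have := potential_le TD bound.
rewrite leeBrDr// -[leRHS]adde0 leeD2lE//.
move=> h; apply/eqP; rewrite eq_le measure_ge0 andbT leNgt; apply/negP => P0.
by move: h; rewrite leNgt mule_gt0// (potential_diag_gt0 lr RD TD).
Qed.

End last_hitting.

(** * Measures and signed integrals given by a density *)

Section density_measure.
Context d (T : measurableType d) (R : realType) (mu : {measure set T -> \bar R}).
Variable g : T -> R.
Hypotheses (g0 : forall y, 0 <= g y) (mg : measurable_fun setT g).

Definition density_set_fun (A : set T) : \bar R := (\int[mu]_(x in A) (g x)%:E)%E.

Let dm0 : density_set_fun set0 = 0%E.
Proof. exact: integral_set0. Qed.

Let dm_ge0 A : (0 <= density_set_fun A)%E.
Proof. by apply: integral_ge0 => x _; rewrite lee_fin. Qed.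

Let dm_sigma : semi_sigma_additive density_set_fun.
Proof.
move=> F mF tF mUF; rewrite /density_set_fun.
rewrite ge0_integral_bigcup//.
- apply: is_cvg_ereal_nneg_natsum_cond => n _ _; exact: dm_ge0.
- by apply/measurable_EFinP; exact: measurable_funTS.
- by move=> x _; rewrite lee_fin.
Qed.

Definition density_measure : {measure set T -> \bar R} :=
  HB.pack density_set_fun
    (isMeasure.Build d T R density_set_fun dm0 dm_ge0 dm_sigma).

End density_measure.

Lemma integral_density d1 d2 (T1 : measurableType d1) (T2 : measurableType d2)
    (R : realType) (P : {measure set T1 -> \bar R})
    (mu : {measure set T2 -> \bar R}) (D : set T1) (Z : T1 -> T2) (g : T2 -> R)
    (phi : T2 -> R) :
  measurable D -> measurable_fun D Z -> (forall y, 0 <= g y) ->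
  measurable_fun setT g ->
  (forall B, measurable B -> P (D `&` Z @^-1` B) = (\int[mu]_(y in B) (g y)%:E)%E) ->
  measurable_fun setT phi ->
  (\int[P]_(w in D) (phi (Z w))%:E = \int[mu]_y (phi y * g y)%:E)%E.
Proof.
move=> mD mZ g0 mg lawZ mphi.
have part (psi : T2 -> \bar R) : (forall y, 0 <= psi y)%E -> measurable_fun setT psi ->
    (\int[P]_(w in D) psi (Z w) = \int[mu]_y (psi y * (g y)%:E))%E.
  move=> psi0 mpsi; rewrite -(ge0_integral_density mD mZ g0 mg lawZ measurableT psi0 mpsi).
  by rewrite preimage_setT setIT.
have mphiE : measurable_fun setT (EFin \o phi) by exact/measurable_EFinP.
rewrite integralE [RHS]integralE; congr (_ - _)%E.
- transitivity (\int[P]_(w in D) (EFin \o phi)^\+%E (Z w))%E.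
    by apply: eq_integral => w _; rewrite !funeposE.
  rewrite (part _ (fun y => funepos_ge0 (EFin \o phi) y) (measurable_funepos mphiE)).
  apply: eq_integral => y _; rewrite !funeposE /= -!EFin_max -EFinM; congr (_%:E).
  by rewrite maxr_pMl// mul0r.
- transitivity (\int[P]_(w in D) (EFin \o phi)^\-%E (Z w))%E.
    by apply: eq_integral => w _; rewrite !funenegE.
  rewrite (part _ (fun y => funeneg_ge0 (EFin \o phi) y) (measurable_funeneg mphiE)).
  apply: eq_integral => y _; rewrite !funenegE /= -?EFinN -!EFin_max -EFinM; congr (_%:E).
  by rewrite maxr_pMl// mul0r mulNr.
Qed.

(** * The density of the last hitting time *)

Section last_hitting_density.
Context {R : realType} {d : measure_display} {Omega : measurableType d}.
Variables (l r : \bar R) (m k : {measure set R -> \bar R})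
  (p : R -> R -> R -> R) (zeta : Omega -> \bar R) (X : R -> Omega -> R)
  (P : R -> probability Omega R).
Hypothesis lr : (l < r)%E.
Let E := state_space l r.
Hypothesis RD : regular_diffusion E zeta X P m k.
Hypothesis TD : transition_density E zeta X P m p.

Notation q := (ext_density l r p).

Let q0 := ext_density_ge0 TD.
Let qsym := ext_density_sym TD.

Notation mu := (@lebesgue_measure R).
Notation potential := (potential l r p).
Hypothesis tr : transient E zeta X P.

Local Notation last := (last_hitting_time zeta X).

Definition last_hitting_support x := [set w | (0 < last x w < +oo)%E].

Lemma last_hitting_support_measurable x : measurable (last_hitting_support x).
Proof.
have mG := last_hitting_measurable RD x.
have -> : last_hitting_support x = setT `&` last x @^-1` `]0%E, +oo%E[%classic.
  by rewrite setTI; apply/seteqP; split => w; rewrite /= in_itv.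
by apply: mG => //; exact: emeasurable_itv.
Qed.

Lemma fine_last_hitting_measurable x : measurable_fun setT (fine \o last x).
Proof.
apply: (measurableT_comp (@fine_measurable _ setT measurableT)).
exact: (last_hitting_measurable RD x).
Qed.

(** Two finite measures that agree on the rays to the right are equal. On rays from nonnegative
    points this is the tail law; the value [+oo], which [fine] would send to 0, is excluded by the
    support and is null. *)
Lemma last_hitting_density x y B : E x -> E y -> measurable B ->
  P y (last_hitting_support x `&` (fine \o last x) @^-1` B) =
  (\int[mu]_(t in B) (q t y x / fine (potential x x))%:E)%E.
Proof.
move=> Ex Ey mB.
pose u := fine (potential x x).
have Ufin : potential x x \is a fin_num.
  by rewrite ge0_fin_numE ?(potential_ge0 TD)// (potential_fin lr RD TD tr).
have u0 : 0 < u.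
  by rewrite fine_gt0// (potential_diag_gt0 lr RD TD)//= -ge0_fin_numE// (potential_ge0 TD).
pose g t := q t y x / u.
have g0 t : 0 <= g t by rewrite /g divr_ge0// ltW.
have mg : measurable_fun setT g.
  by apply: measurable_funM => //; apply/measurable_EFinP; exact: (density_time_measurable TD).
have mD := last_hitting_support_measurable x.
have mZ := fine_last_hitting_measurable x.
pose Z : Omega -> measurableTypeR R := fine \o last x.
have mZ' : measurable_fun setT Z := mZ.
pose m1 := pushforward (mrestr (P y) mD) Z.
pose m2 := density_measure mu g0 mg.
have m1E A : m1 A = P y (last_hitting_support x `&` (fine \o last x) @^-1` A).
  by rewrite /m1 /pushforward /mrestr setIC.
have m1le A : measurable A -> (m1 A <= 1)%E.
  move=> mA; rewrite m1E; apply: probability_le1; apply: measurableI => //.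
  by rewrite -[X in measurable X]setTI; exact: mZ.
rewrite -m1E.
have ray (s : R) : 0 <= s -> m1 `]s, +oo[%classic = m2 `]s, +oo[%classic.
  move=> s0.
  have mGs : measurable [set w | (s%:E < last x w)%E].
    have -> : [set w | (s%:E < last x w)%E] = setT `&` last x @^-1` `]s%:E, +oo%E]%classic.
      by rewrite setTI; apply/seteqP; split => w; rewrite /= in_itv/= leey andbT.
    by apply: (last_hitting_measurable RD x) => //; exact: emeasurable_itv.
  have mGoo : measurable [set w | last x w = +oo%E].
    have -> : [set w | last x w = +oo%E] = setT `&` last x @^-1` [set +oo%E].
      by rewrite setTI.
    by apply: (last_hitting_measurable RD x).
  have -> : m1 `]s, +oo[%classic = P y [set w | (s%:E < last x w)%E].
    rewrite m1E; set A := _ `&` _.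
    have -> : [set w | (s%:E < last x w)%E] = A `|` [set w | last x w = +oo%E].
      apply/seteqP; split => w /=.
        have := @last_hitting_ge0 R d Omega zeta X x w.
        rewrite /A /last_hitting_support /=; case: (last x w) => [c| |]//.
          rewrite lee_fin lte_fin => c0 sc; left; split => /=.
            by rewrite !lte_fin (le_lt_trans s0 sc) ltry.
          by rewrite in_itv/= sc.
        by right.
      move=> [|->]; last by rewrite ltry.
      rewrite /A /last_hitting_support /= in_itv/= andbT => -[/andP[h1 h2]] h3.
      rewrite -(@fineK _ (last x w)) ?lte_fin//.
      by rewrite fin_numElt h2 (lt_trans _ h1)// ltNy0.
    have mA : measurable A.
      by apply: measurableI => //; rewrite -[X in measurable X]setTI; apply: mZ => //; exact: measurable_itv.
    rewrite measureU//; last first.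
      apply/seteqP; split => // w [[/andP[_ h] _] /= h'].
      by move: h; rewrite h' ltxx.
    have P0 : P y [set w | last x w = +oo%E] = 0%E := last_hitting_fin lr RD TD tr Ex Ey.
    exact: (esym (etrans (congr1 (adde (P y A)) P0) (adde0 _))).
  have law := last_hitting_gt_law lr RD TD tr s0 Ex Ey.
  have -> : m2 `]s, +oo[%classic = (green l r p `]s, +oo[ y x * (u^-1)%:E)%E.
    rewrite muleC -ge0_integralZl//.
    - by apply: eq_integral => t _; rewrite -EFinM mulrC.
    - by apply: measurable_funTS; exact: (density_time_measurable TD).
    - by move=> t _; rewrite lee_fin.
    - by rewrite lee_fin invr_ge0 ltW.
  rewrite -law -(fineK Ufin) -muleA -EFinM mulfV ?gt_eqF// mule1//.
transitivity (m2 B); last by [].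
apply: (@measure_unique _ R (measurableTypeR R) (@RGenOInfty.G R) (fun n => `]- n%:R, +oo[%classic) _ _ _ _ m1 m2) => //.
- exact: RGenOInfty.measurableE.
- move=> _ _ [a ->] [b ->]; exists (Num.max a b).
  by apply/seteqP; split => t; rewrite /= !in_itv/= !andbT gt_max => /andP.
- by move=> n; exists (- n%:R).
- apply/seteqP; split => // t _; exists (Num.bound `|t|) => //=.
  rewrite in_itv/= andbT ltrNl (le_lt_trans _ (archi_boundP (normr_ge0 t)))//.
  by rewrite -normrN ler_norm.
(* Neither measure charges the half-line up to 0: the support requires a positive last hit, and the
   density vanishes at times that are not positive. *)
- move=> _ [a ->]; have [a0|a0] := leP 0 a; first exact: ray.
  transitivity (m1 `]0, +oo[%classic).
    apply: (etrans (m1E _)); apply: (etrans _ (esym (m1E _))); congr (P y _).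
    apply/seteqP; split => w [Dw /= h]; split => //=.
      by rewrite in_itv/= andbT fine_gt0.
    by move: h; rewrite !in_itv/= !andbT; exact: lt_trans.
  rewrite ray//.
  rewrite /m2 /= /density_set_fun integral_mkcond [RHS]integral_mkcond.
  apply: eq_integral => t _; rewrite !patchE !mem_setE !in_itv/= !andbT.
  have [t0|t0] := ltP 0 t; first by rewrite (lt_trans a0).
  rewrite /g ext_density_out ?mul0r; first by case: ifP.
  by move=> [t0']; move: (le_lt_trans t0 t0'); rewrite ltxx.
- by move=> n; apply: le_lt_trans (m1le _ _) (ltry 1); exact: measurable_itv.
Qed.

End last_hitting_density.

(** * The Bessel function *)

Section bessel.
Context {R : realType}.
Implicit Types (x y t s : R) (n : nat).

Lemma is_cvg_pseries_le_inv_fact (f : nat -> R) x :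
  (forall n, `|f n| <= n`!%:R^-1) -> cvgn (pseries f x).
Proof.
move=> fle; apply: normed_cvg.
apply: series_le_cvg (is_cvg_series_exp_coeff `|x|) => n /=.
- exact: normr_ge0.
- by rewrite exp_coeff_ge0.
- by rewrite normrM normrX /exp_coeff /= mulrC ler_wpM2l// exprn_ge0.
Qed.

Definition bessel_coeff n : R := (-1) ^+ n / (n`!%:R) ^+ 2.

(** This power series is [J_0(2 sqrt x)] for [x >= 0]. It is entire in [x], so its continuity
    involves no square root. *)
Definition bessel_series x : R := limn (pseries bessel_coeff x).

Lemma bessel_coeff_norm n : `|bessel_coeff n| = (n`!%:R ^+ 2)^-1.
Proof.
rewrite /bessel_coeff normrM normrX normrN1 expr1n mul1r ger0_norm//.
Qed.

Let fact_ge1 n : 1 <= n`!%:R :> R.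
Proof. by rewrite ler1n fact_gt0. Qed.

Let factS_eq n : (n.+1)`!%:R = n.+1%:R * n`!%:R :> R.
Proof. by rewrite factS natrM. Qed.

Let bessel_coeff_le n : `|bessel_coeff n| <= n`!%:R^-1.
Proof.
rewrite bessel_coeff_norm lef_pV2 ?posrE ?exprn_gt0 ?ltr0n ?fact_gt0//.
by rewrite expr2 ler_peMl// ler0n.
Qed.

Let bessel_coeff_diffs_norm n :
  `|pseries_diffs bessel_coeff n| = (n`!%:R * n.+1`!%:R)^-1.
Proof.
rewrite /pseries_diffs normrM bessel_coeff_norm ger0_norm//.
by rewrite !factS_eq; field; rewrite !gt_eqF ?ltr0n ?fact_gt0.
Qed.

Let bessel_coeff_diffs_le n : `|pseries_diffs bessel_coeff n| <= n`!%:R^-1.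
Proof.
rewrite bessel_coeff_diffs_norm lef_pV2 ?posrE ?mulr_gt0 ?ltr0n ?fact_gt0//.
by rewrite ler_peMr// ler0n.
Qed.

Let bessel_coeff_diffs2_le n :
  `|pseries_diffs (pseries_diffs bessel_coeff) n| <= n`!%:R^-1.
Proof.
rewrite {1}/pseries_diffs normrM bessel_coeff_diffs_norm ger0_norm//.
rewrite [n.+1`!%:R]factS_eq invfM mulrA invfM mulrA mulfV ?mul1r ?pnatr_eq0//.
by rewrite ler_piMr ?invr_ge0// invf_le1// ltr0n fact_gt0.
Qed.

(** Termwise differentiation: the coefficients and their first two formal derivatives are bounded by
    inverse factorials, so the three series converge beyond [x]. *)
Lemma bessel_series_continuous : continuous bessel_series.
Proof.
move=> x; apply: differentiable_continuous; apply/derivable1_diffP.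
have cv f : (forall n, `|f n| <= n`!%:R^-1) -> cvgn (pseries f (`|x| + 1)).
  exact: is_cvg_pseries_le_inv_fact.
have [|//] := @pseries_snd_diffs R bessel_coeff (`|x| + 1) x
  (cv _ bessel_coeff_le) (cv _ bessel_coeff_diffs_le) (cv _ bessel_coeff_diffs2_le).
by rewrite [ltRHS]ger0_norm ?ltrDl// addr_ge0.
Qed.

(** The square root of a negative number is 0 by convention, hence the positive part, written as
    [(x + |x|) / 2]; the formula then holds and is continuous on the whole line. *)
Lemma besselJ0_sqrt x : besselJ0 (2 * Num.sqrt x) = bessel_series ((x + `|x|) / 2).
Proof.
rewrite /besselJ0 /bessel_series /pseries; congr (limn (series _)).
apply/funext => n.
have -> : 2 * Num.sqrt x / 2 = Num.sqrt x by field.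
rewrite exprM.
have -> : Num.sqrt x ^+ 2 = (x + `|x|) / 2.
  have [x0|x0] := leP 0 x; first by rewrite sqr_sqrtr// ger0_norm//; field.
  by rewrite ltr0_sqrtr// expr0n/= ltr0_norm// subrr mul0r.
by rewrite /bessel_coeff mulrAC.
Qed.

Lemma exp_coeff_le_expR y n : 0 <= y -> y ^+ n / n`!%:R <= expR y.
Proof.
move=> y0; case: n => [|n]; first by rewrite expr0 fact0 divr1 -expR0 ler_expR.
by apply: le_trans (expR_ge1Dxn n y0); rewrite lerDr.
Qed.

(* Each term [(t s)^n / n!^2] is [(b s)^n / n!] times [(t / b)^n / n!]. *)
Lemma bessel_series_bound t s b : 0 <= t -> 0 <= s -> 0 < b ->
  `|bessel_series (t * s)| <= expR (t / b) * expR (b * s).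
Proof.
move=> t0 s0 b0.
have cv : cvgn [normed series (fun n => bessel_coeff n * (t * s) ^+ n : R^o)].
  apply: series_le_cvg (is_cvg_series_exp_coeff `|t * s|) => n /=.
  - exact: normr_ge0.
  - by rewrite exp_coeff_ge0.
  - by rewrite normrM normrX /exp_coeff /= mulrC ler_wpM2l// exprn_ge0.
apply: (le_trans (lim_series_norm cv)).
have cv2 : cvgn (series (fun n => expR (t / b) * exp_coeff (b * s) n)).
  by apply: is_cvg_seriesZ; exact: is_cvg_series_exp_coeff.
rewrite -[leRHS](lim_seriesZ (expR (t / b)) (is_cvg_series_exp_coeff (b * s))).
apply: lim_series_le => //= n.
rewrite normrM bessel_coeff_norm normrX ger0_norm ?mulr_ge0//.
have -> : (n`!%:R ^+ 2)^-1 * (t * s) ^+ n =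
    ((t / b) ^+ n / n`!%:R) * ((b * s) ^+ n / n`!%:R).
  rewrite !exprMn exprVn; field.
  by rewrite gt_eqF ?ltr0n ?fact_gt0//= expf_neq0// gt_eqF.
apply: ler_pM => //.
- by rewrite divr_ge0// exprn_ge0// divr_ge0// ltW.
- by rewrite divr_ge0// exprn_ge0// mulr_ge0// ltW.
- by apply: exp_coeff_le_expR; rewrite divr_ge0// ltW.
Qed.

Definition bessel_kernel alpha t s : R :=
  besselJ0 (2 * Num.sqrt (t * s)) * expR (- (alpha * s)).

Lemma bessel_kernel_bound alpha t s : 0 < alpha -> 0 <= t -> 0 <= s ->
  `|bessel_kernel alpha t s| <= expR (2 * t / alpha) * expR (- (alpha / 2 * s)).
Proof.
move=> a0 t0 s0; rewrite /bessel_kernel besselJ0_sqrt normrM.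
rewrite [X in _ * X]ger0_norm ?expR_ge0//.
have -> : (t * s + `|t * s|) / 2 = t * s.
  by rewrite ger0_norm ?mulr_ge0//; field.
have a20 : 0 < alpha / 2 by rewrite divr_gt0.
apply: (@le_trans _ _ (expR (t / (alpha / 2)) * expR (alpha / 2 * s) * expR (- (alpha * s)))).
  by rewrite ler_wpM2r ?expR_ge0// bessel_series_bound.
rewrite -mulrA -expRD.
have -> : t / (alpha / 2) = 2 * t / alpha by field; rewrite gt_eqF.
by have -> : alpha / 2 * s + - (alpha * s) = - (alpha / 2 * s) by field.
Qed.

Lemma bessel_kernel_continuous alpha t : continuous (bessel_kernel alpha t).
Proof.
move=> s; apply: cvgM.
  under eq_fun do rewrite besselJ0_sqrt.
  rewrite besselJ0_sqrt.
  apply: (@continuous_comp _ _ _ (fun s => (t * s + `|t * s|) / 2) bessel_series);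
    last exact: bessel_series_continuous.
  apply: cvgMr_tmp; apply: cvgD; first by apply: cvgMl_tmp; exact: cvg_id.
  by apply: cvg_norm; apply: cvgMl_tmp; exact: cvg_id.
apply: (@continuous_comp _ _ _ (fun s => - (alpha * s)) expR); last exact: continuous_expR.
by apply: cvgN; apply: cvgMl_tmp; exact: cvg_id.
Qed.

Lemma bessel_kernel_measurable alpha t : measurable_fun setT (bessel_kernel alpha t).
Proof. by apply: continuous_measurable_fun; exact: bessel_kernel_continuous. Qed.

End bessel.

(** * Bochner integrals of kernels *)

Section L2_norm.
Context d (T : measurableType d) (R : realType).
Variable mu : {measure set T -> \bar R}.

(** The squared L^2 norm, free of roots and with values in the extended reals, is the form in which
    Tonelli's theorem applies directly. *)
Definition sqr_norm (h : T -> R) : \bar R := (\int[mu]_x (h x ^+ 2)%:E)%E.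

Lemma sqr_norm_ge0 h : (0 <= sqr_norm h)%E.
Proof. by apply: integral_ge0 => x _; rewrite lee_fin sqr_ge0. Qed.

Lemma Lnorm2E h : ('N[mu]_2%:E[EFin \o h] = sqr_norm h `^ 2^-1)%E.
Proof.
rewrite unlock; congr (_ `^ _)%E; apply: eq_integral => x _ /=.
by rewrite powR_mulrn// -normrX ger0_norm// sqr_ge0.
Qed.

Lemma Lnorm2_le h (c : R) : 0 <= c ->
  (sqr_norm h <= (c ^+ 2)%:E)%E -> ('N[mu]_2%:E[EFin \o h] <= c%:E)%E.
Proof.
move=> c0 hc; rewrite Lnorm2E.
have -> : c%:E = ((c ^+ 2)%:E `^ 2^-1)%E.
  by rewrite poweR_EFin -powR_mulrn// -powRrM mulfV ?powRr1// pnatr_eq0.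
apply: gt0_ler_poweR => //.
- by rewrite in_itv/= leey sqr_norm_ge0.
- by rewrite in_itv/= leey lee_fin sqr_ge0.
Qed.

Lemma sqr_norm_le h (c : R) : 0 <= c ->
  ('N[mu]_2%:E[EFin \o h] <= c%:E)%E -> (sqr_norm h <= (c ^+ 2)%:E)%E.
Proof.
move=> c0 hc.
have -> : sqr_norm h = ('N[mu]_2%:E[EFin \o h] `^ 2)%E.
  by rewrite Lnorm2E -poweRrM mulVf ?pnatr_eq0// poweRe1 ?sqr_norm_ge0.
rewrite -powR_mulrn// -poweR_EFin.
apply: gt0_ler_poweR => //.
- by rewrite in_itv/= leey Lnorm_ge0.
- by rewrite in_itv/= andbC leey; exact: c0.
Qed.

Lemma Lfun2P h : measurable_fun setT h -> (sqr_norm h < +oo)%E ->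
  h \in Lfun mu 2%:E.
Proof.
move=> mh hfin; rewrite inE; apply/andP; split; rewrite inE//=.
rewrite /finite_norm Lnorm2E; exact: poweR_lty.
Qed.

Lemma Lfun2_measurable h : h \in Lfun mu 2%:E -> measurable_fun setT h.
Proof. by rewrite inE => /andP[/[!inE]]. Qed.

Lemma Lfun2_sqr_norm h : h \in Lfun mu 2%:E -> (sqr_norm h < +oo)%E.
Proof. by move/Lfun2_integrable_sqr/integrable_lty; exact. Qed.

Lemma Lfun2_norm h : h \in Lfun mu 2%:E -> ('N[mu]_2%:E[EFin \o h] < +oo)%E.
Proof. by rewrite inE => /andP[_ /[!inE]]. Qed.

End L2_norm.

(** * Minkowski's inequality for integrals *)

Section minkowski_integral.
Context d1 d2 (T1 : measurableType d1) (T2 : measurableType d2) (R : realType).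
Variables (mu : {measure set T1 -> \bar R}) (m : {measure set T2 -> \bar R}).
Hypotheses (s1 : sigma_finite setT mu) (s2 : sigma_finite setT m).
Variables (D : set T1) (mD : measurable D).

(** The Cauchy-Schwarz inequality for [h] written as the product of the root of [a] and [h] over
    that root. It is derived from the weighted mean-square inequality, whose weight is optimised
    afterwards. *)
Lemma cauchy_schwarz_weight (a h : T1 -> R) (A : R) :
  (forall s, D s -> 0 < a s) -> measurable_fun setT a ->
  (forall s, 0 <= h s) -> measurable_fun setT h -> 0 < A ->
  (\int[mu]_(s in D) (a s)%:E <= A%:E)%E ->
  ((\int[mu]_(s in D) (h s)%:E) * (\int[mu]_(s in D) (h s)%:E) <=
   A%:E * \int[mu]_(s in D) (h s ^+ 2 / a s)%:E)%E.
Proof.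
move=> a0 ma h0 mh A0 aA.
set I := (\int[mu]_(s in D) (h s)%:E)%E.
set B := (\int[mu]_(s in D) (h s ^+ 2 / a s)%:E)%E.
have I0 : (0 <= I)%E by apply: integral_ge0 => s _; rewrite lee_fin.
have hB s : D s -> 0 <= h s ^+ 2 / a s.
  by move=> Ds; rewrite divr_ge0 ?sqr_ge0// ltW// a0.
have B0 : (0 <= B)%E by apply: integral_ge0 => s Ds; rewrite lee_fin hB.
have mhB : measurable_fun D (fun s => (h s ^+ 2 / a s)%:E).
  apply/measurable_EFinP; apply: measurable_funM.
    exact/measurable_funTS/measurable_funX.
  apply: (@measurable_comp _ _ _ _ _ _ [set x : R | 0 < x]) => //.
  - by apply: open_measurable; exact: open_gt.
  - by move=> _ [s Ds <-] /=; rewrite a0.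
  - apply: open_continuous_measurable_fun; first exact: open_gt.
    by move=> x /set_mem/= x0; apply: inv_continuous; rewrite gt_eqF.
  - exact: measurable_funTS.
have [->|Bfin] := eqVneq B +oo%E.
  by rewrite muleC mulyr gtr0_sg// mul1e leey.
have {}Bfin : B \is a fin_num by rewrite ge0_fin_numE// ltey.
have key c : 0 < c -> (I <= (c / 2 * A + c^-1 / 2 * fine B)%:E)%E.
  move=> c0; have c20 : 0 <= c / 2 by rewrite divr_ge0// ltW.
  have ci0 : 0 <= c^-1 / 2 by rewrite divr_ge0// invr_ge0 ltW.
  apply: (@le_trans _ _ (\int[mu]_(s in D) ((c / 2)%:E * (a s)%:E +
      (c^-1 / 2)%:E * (h s ^+ 2 / a s)%:E))%E).
    apply: ge0_le_integral => //.
    - by move=> s _; rewrite lee_fin.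
    - by apply/measurable_EFinP; exact: measurable_funTS.
    - apply: emeasurable_funD; apply: measurable_funeM => //.
      by apply/measurable_EFinP; exact: measurable_funTS.
    - move=> s Ds; rewrite -!EFinM -EFinD lee_fin.
      have as0 := a0 s Ds.
      have -> : c / 2 * a s + c^-1 / 2 * (h s ^+ 2 / a s) =
        h s + (c * a s - h s) ^+ 2 * (c^-1 / 2 / a s) by field; rewrite !gt_eqF.
      by rewrite lerDl mulr_ge0 ?sqr_ge0// divr_ge0// ltW.
  rewrite ge0_integralD//; last 4 first.
  - by move=> s Ds; rewrite mule_ge0// lee_fin// ltW// a0.
  - by apply: measurable_funeM; apply/measurable_EFinP; exact: measurable_funTS.
  - by move=> s Ds; rewrite mule_ge0// lee_fin ?hB.
  - exact: measurable_funeM.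
  rewrite !ge0_integralZl ?lee_fin//; last 2 first.
  - by apply/measurable_EFinP; exact: measurable_funTS.
  - by move=> s Ds; rewrite lee_fin ltW// a0.
  rewrite EFinD !EFinM fineK//; apply: leeD => //.
  by apply: lee_wpmul2l => //; rewrite lee_fin.
have Ifin : I \is a fin_num.
  by rewrite ge0_fin_numE//; apply: le_lt_trans (key 1 ltr01) _; rewrite ltry.
rewrite -(fineK Ifin) -(fineK Bfin) -!EFinM lee_fin.
move: key; rewrite -(fineK Ifin); set i := fine I; set b := fine B => key.
have b0 : 0 <= b by rewrite fine_ge0.
have := fine_ge0 I0; rewrite -/i le_eqVlt => /predU1P[<-|i0].
  by rewrite mul0r mulr_ge0// ltW.
(* This weight makes the first term exactly half of [i], which the left-hand side absorbs. *)
have := key (i / A) (divr_gt0 i0 A0); rewrite lee_fin.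
rewrite invf_div.
have -> : i / A / 2 * A = i / 2 by field; rewrite gt_eqF.
have -> : A / i / 2 * b = (A * b) / (2 * i) by field; rewrite gt_eqF.
move=> ik; have : i / 2 <= A * b / (2 * i) by lra.
rewrite ler_pdivlMr ?mulr_gt0//.
by have -> : i / 2 * (2 * i) = i * i by field.
Qed.

(** The bound [a s] on the norm of [H s] serves as the Cauchy-Schwarz weight. After exchanging the
    integrals, the squared norm of [H s] divided by [a s] is at most [a s], so a second factor [A]
    appears. The division is the reason for a strictly positive [a]. *)
Lemma minkowski_integral (H : T1 -> T2 -> R) (a : T1 -> R) (A : R) :
  (forall s x, 0 <= H s x) ->
  measurable_fun setT (fun z : T1 * T2 => H z.1 z.2) ->
  (forall s, 0 < a s) -> measurable_fun setT a -> 0 < A ->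
  (\int[mu]_(s in D) (a s)%:E <= A%:E)%E ->
  (forall s, D s -> (sqr_norm m (H s) <= (a s ^+ 2)%:E)%E) ->
  (\int[m]_x ((\int[mu]_(s in D) (H s x)%:E) * (\int[mu]_(s in D) (H s x)%:E))
    <= (A ^+ 2)%:E)%E.
Proof.
move=> H0 mH a0 ma A0 aA Ha.
have mHx x : measurable_fun setT (H ^~ x).
  exact: (measurableT_comp mH (@measurable_pair2 _ _ _ _ x)).
have mHs s : measurable_fun setT (H s).
  exact: (measurableT_comp mH (@measurable_pair1 _ _ _ _ s)).
have mai : measurable_fun setT (fun s => (a s)^-1).
  apply: (@measurable_comp _ _ _ _ _ _ [set x : R | 0 < x]) => //.
  - by apply: open_measurable; exact: open_gt.
  - by move=> _ [s Ds <-] /=.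
  - apply: open_continuous_measurable_fun; first exact: open_gt.
    by move=> x /set_mem/= x0; apply: inv_continuous; rewrite gt_eqF.
have m1 : measurable_fun setT (fun z : T1 * T2 => (H z.1 z.2 ^+ 2 / a z.1)%:E).
  apply/measurable_EFinP; apply: measurable_funM; first exact: measurable_funX.
  exact: (measurableT_comp mai).
have g0 s x : (0 <= (H s x ^+ 2 / a s)%:E)%E.
  by rewrite lee_fin divr_ge0 ?sqr_ge0// ltW.
have m1' : measurable_fun setT (fun z : T2 * T1 => (H z.2 z.1 ^+ 2 / a z.2)%:E).
  exact: (measurableT_comp m1 (@measurable_swap _ _ _ _)).
have mI : measurable_fun setT (fun x => (\int[mu]_(s in D) (H s x)%:E)%E).
  apply: (@measurable_fun_integral1 _ _ _ _ R mu s1 (fun x s => (H s x)%:E)) => //.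
    by move=> x s; rewrite lee_fin.
  apply/measurable_EFinP.
  exact: (measurableT_comp mH (@measurable_swap _ _ _ _)).
have mJ : measurable_fun setT (fun x => (\int[mu]_(s in D) (H s x ^+ 2 / a s)%:E)%E).
  by apply: (@measurable_fun_integral1 _ _ _ _ R mu s1 (fun x s => (H s x ^+ 2 / a s)%:E)).
have I0 x : (0 <= \int[mu]_(s in D) (H s x)%:E)%E.
  by apply: integral_ge0 => s _; rewrite lee_fin.
apply: (@le_trans _ _ (\int[m]_x (A%:E * \int[mu]_(s in D) (H s x ^+ 2 / a s)%:E))%E).
  apply: ge0_le_integral => //.
  - by move=> x _; exact: mule_ge0.
  - exact: emeasurable_funM.
  - exact: measurable_funeM.
  - by move=> x _; apply: cauchy_schwarz_weight.
rewrite ge0_integralZl//; last 2 first.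
- by move=> x _; apply: integral_ge0.
- by rewrite lee_fin ltW.
rewrite (tonelli_in (m1 := m) (m2 := mu) (f := fun x s => (H s x ^+ 2 / a s)%:E))//.
rewrite [A ^+ 2]expr2 (EFinM A A);  apply: lee_wpmul2l; first by rewrite lee_fin ltW.
apply: le_trans aA; apply: ge0_le_integral => //.
- by move=> s _; apply: integral_ge0.
- apply: measurable_funTS.
  exact: (@measurable_fun_integral1 _ _ _ _ R m s2 (fun s x => (H s x ^+ 2 / a s)%:E)).
- by apply/measurable_EFinP; exact: measurable_funTS.
- move=> s Ds.
  under eq_integral do rewrite mulrC EFinM.
  rewrite ge0_integralZl//; last 3 first.
  - by apply/measurable_EFinP; exact: measurable_funX.
  - by move=> x _; rewrite lee_fin sqr_ge0.
  - by rewrite lee_fin invr_ge0 ltW.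
  apply: (@le_trans _ _ ((a s)^-1%:E * (a s ^+ 2)%:E)%E).
    by apply: lee_wpmul2l; [rewrite lee_fin invr_ge0 ltW|exact: Ha].
  by rewrite -EFinM lee_fin expr2 mulrA mulVf ?mul1r// gt_eqF.
Qed.

End minkowski_integral.

(** * Comparison of the pointwise integral of a kernel with its Bochner integrals *)

Section bochner_kernel.
Context {R : realType}.
Variable m : {measure set R -> \bar R}.
Hypothesis msf : sigma_finite setT m.
Variables (D : set R) (mD : measurable D) (F : R -> R -> R).
Hypothesis mF : measurable_fun setT (fun z : R * R => F z.1 z.2).
Variables (a : R -> R) (A : R).
Hypotheses (a0 : forall s, 0 < a s) (ma : measurable_fun setT a) (A0 : 0 < A).
Hypothesis aA : (\int[lebesgue_measure]_(s in D) (a s)%:E <= A%:E)%E.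
Hypothesis Fa : forall s, D s -> (sqr_norm m (F s) <= (a s ^+ 2)%:E)%E.

Notation leb := (@lebesgue_measure R).
Let lsf : sigma_finite setT leb := sigma_finiteT _.

Let mFs s : measurable_fun setT (F s).
Proof. exact: (measurableT_comp mF (@measurable_pair1 _ _ _ _ s)). Qed.

Let mFx x : measurable_fun setT (F ^~ x).
Proof. exact: (measurableT_comp mF (@measurable_pair2 _ _ _ _ x)). Qed.

Lemma kernel_Lfun s : D s -> F s \in Lfun m 2%:E.
Proof.
by move=> Ds; apply: Lfun2P => //; apply: le_lt_trans (Fa Ds) _; rewrite ltry.
Qed.

(** Minkowski's inequality for the absolute values makes the square of their time integral
    integrable, so that integral is finite almost everywhere. *)
Lemma kernel_integrable_ae : {ae m, forall x, leb.-integrable D (EFin \o F ^~ x)}.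
Proof.
have mH : measurable_fun setT (fun z : R * R => `|F z.1 z.2|).
  exact: measurableT_comp.
have H0 s x : 0 <= `|F s x| by exact: normr_ge0.
have Ha s : D s -> (sqr_norm m (fun x => `|F s x|%R) <= (a s ^+ 2)%:E)%E.
  move=> Ds; rewrite /sqr_norm; under eq_integral do rewrite real_normK ?num_real//.
  exact: Fa.
have := minkowski_integral lsf msf mD H0 mH a0 ma A0 aA Ha.
set I := fun x => (\int[leb]_(s in D) (`|F s x|%R)%:E)%E => MI.
have I0 x : (0 <= I x)%E by apply: integral_ge0 => s _; rewrite lee_fin.
have mI : measurable_fun setT I.
  apply: (@measurable_fun_integral1 _ _ _ _ R leb lsf (fun x s => (`|F s x|%R)%:E)) => //.
  apply/measurable_EFinP.
  exact: (measurableT_comp mH (@measurable_swap _ _ _ _)).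
have II : m.-integrable setT (fun x => I x * I x)%E.
  apply/integrableP; split; first exact: emeasurable_funM.
  under eq_integral do rewrite gee0_abs ?mule_ge0//.
  by apply: le_lt_trans MI _; rewrite ltry.
have := integrable_ae measurableT II.
apply: filterS => x /(_ Logic.I) xfin.
apply/integrableP; split; first by apply/measurable_EFinP; exact: measurable_funTS (mFx x).
rewrite ltNge leye_eq; apply/negP => /eqP Ix.
by move: xfin; rewrite (_ : I x = +oo%E) ?mulyy//; exact: Ix.
Qed.

Lemma simple_eval_measurable (S : simple_L2 m) :
  measurable_fun setT (fun z : R * R => simple_eval S z.1 z.2).
Proof.
rewrite /simple_eval.
apply: (@measurable_sum _ _ _ setT _ _
  (fun i (z : R * R) => \1_(simple_set (s := S) i) z.1 * simple_coef (s := S) i z.2)) => i.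
apply: measurable_funM.
  apply: (measurableT_comp (measurable_indic _)) => //; exact: simple_measurable.
apply: (measurableT_comp (Lfun2_measurable (simple_in_L2 i))) => //.
Qed.

Let term_integrable (S : simple_L2 m) (i : 'I_(simple_size S)) x :
  leb.-integrable D (fun s => (\1_(simple_set (s := S) i) s * simple_coef (s := S) i x)%:E).
Proof.
under eq_fun do rewrite EFinM; apply: integrableZr => //.
have mS := simple_measurable (s := S) i.
apply/integrableP; split; first by apply/measurable_EFinP; exact: measurable_funTS.
under eq_integral do rewrite gee0_abs ?lee_fin//.
rewrite integral_indic//.
apply: le_lt_trans (simple_finite i); apply: le_measure; rewrite ?inE//.
exact: measurableI.
Qed.

Lemma simple_eval_integrable (S : simple_L2 m) x :
  leb.-integrable D (EFin \o simple_eval S ^~ x).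
Proof.
rewrite (_ : _ \o _ = (fun s => \sum_(i < simple_size S)
  (\1_(simple_set (s := S) i) s * simple_coef (s := S) i x)%:E)%E); last first.
  by apply/funext => s; rewrite /= /simple_eval -sumEFin.
by apply: integrable_sum => // i _.
Qed.

Lemma Rintegral_simple_eval (S : simple_L2 m) x :
  \int[leb]_(s in D) simple_eval S s x = simple_integral D S x.
Proof.
rewrite /Rintegral /simple_eval.
under eq_integral do rewrite -sumEFin.
rewrite integral_sum//.
rewrite /simple_integral; apply: EFin_inj; rewrite -sumEFin fineK; last first.
  apply/sum_fin_numP => i _ _; apply: integrable_fin_num => //; exact: term_integrable.
apply: eq_bigr => i _.
under eq_integral do rewrite EFinM.
have mS := simple_measurable (s := S) i.
have fS : leb (simple_set (s := S) i `&` D) \is a fin_num.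
  rewrite ge0_fin_numE//; apply: le_lt_trans (simple_finite i).
  by apply: le_measure; rewrite ?inE//; exact: measurableI.
rewrite integralZr//; last first.
  apply/integrableP; split; first by apply/measurable_EFinP; exact: measurable_funTS.
  under eq_integral do rewrite gee0_abs ?lee_fin//.
  by rewrite integral_indic// -ge0_fin_numE.
by rewrite integral_indic// EFinM fineK.
Qed.

Definition kernel_integral x := \int[leb]_(s in D) F s x.

Lemma kernel_integral_measurable : measurable_fun setT kernel_integral.
Proof.
rewrite /kernel_integral /Rintegral.
apply: (measurableT_comp (@fine_measurable _ setT measurableT)).
have mH : measurable_fun setT (fun z : R * R => (F z.2 z.1)%:E).
  apply/measurable_EFinP.
  exact: (measurableT_comp mF (@measurable_swap _ _ _ _)).
under eq_fun do rewrite integralE.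
apply: emeasurable_funB.
  apply: (@measurable_fun_integral1 _ _ _ _ R leb lsf (fun x => (EFin \o F ^~ x)^\+)%E) => //.
  have := measurable_funepos mH; apply: eq_measurable_fun => z _.
  by rewrite !funeposE.
apply: (@measurable_fun_integral1 _ _ _ _ R leb lsf (fun x => (EFin \o F ^~ x)^\-)%E) => //.
have := measurable_funeneg mH; apply: eq_measurable_fun => z _.
by rewrite !funenegE.
Qed.

Lemma dist_L2_measurable (S : simple_L2 m) :
  measurable_fun setT (fun s => dist_L2 m (F s) (simple_eval S s)).
Proof.
rewrite /dist_L2; under eq_fun do rewrite Lnorm2E.
apply: (measurableT_comp (measurable_poweR _)).
apply: (@measurable_fun_integral1 _ _ _ _ R m msf
  (fun s x => ((F s x - simple_eval S s x) ^+ 2)%:E)) => //.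
  by move=> s x; rewrite lee_fin sqr_ge0.
apply/measurable_EFinP/measurable_funX/measurable_funB => //.
exact: simple_eval_measurable.
Qed.

Lemma simple_eval_Lfun (S : simple_L2 m) s : simple_eval S s \in Lfun m 2%:E.
Proof.
rewrite (_ : simple_eval S s = \sum_(i < simple_size S)
    (\1_(simple_set (s := S) i) s *: (simple_coef (s := S) i : R -> R))); last first.
  apply/funext => x; rewrite /simple_eval fct_sumE.
  by apply: eq_bigr.
have p1 : (1 <= 2%:E :> \bar R)%E by rewrite lee_fin ler1n.
apply: (@rpred_sum _ (Lfun m 2%:E)) => i _; apply: (@rpredZ _ _ (Lfun m 2%:E)).
exact: simple_in_L2.
Qed.

Let p1 : (1 <= 2%:E :> \bar R)%E. Proof. by rewrite lee_fin ler1n. Qed.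

Lemma dist_L2_fin s (S : simple_L2 m) : D s ->
  dist_L2 m (F s) (simple_eval S s) \is a fin_num.
Proof.
move=> Ds; rewrite ge0_fin_numE ?Lnorm_ge0//; apply: Lfun2_norm.
apply: (@rpredB _ (Lfun m 2%:E)); first exact: kernel_Lfun.
exact: simple_eval_Lfun.
Qed.

Lemma kernel_integral_sub (S : simple_L2 m) x :
  leb.-integrable D (EFin \o F ^~ x) ->
  kernel_integral x - simple_integral D S x =
  \int[leb]_(s in D) (F s x - simple_eval S s x).
Proof.
move=> Fx; rewrite RintegralB// ?Rintegral_simple_eval//.
exact: simple_eval_integrable.
Qed.

(** This is Minkowski's inequality for the difference of the kernel and the simple function, in a
    form that needs no bound on the simple function itself. *)
Lemma dist_kernel_integral_le (S : simple_L2 m) :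
  (dist_L2 m kernel_integral (simple_integral D S) <=
   \int[leb]_(s in D) dist_L2 m (F s) (simple_eval S s))%E.
Proof.
set dst := fun s => dist_L2 m (F s) (simple_eval S s).
have dst0 s : (0 <= dst s)%E by exact: Lnorm_ge0.
have mdst : measurable_fun setT dst by exact: dist_L2_measurable.
set B := (\int[leb]_(s in D) dst s)%E.
have B0 : (0 <= B)%E by apply: integral_ge0 => s _.
have [->|Bfin] := eqVneq B +oo%E; first by rewrite leey.
have {}Bfin : B \is a fin_num by rewrite ge0_fin_numE// ltey.
apply/lee_addgt0Pr => e e0.
(* The distance may vanish, while the weight in [minkowski_integral] must be positive; the added
   term costs at most [e] in total. *)
pose b s := fine (dst s) + e / A * a s.
have eA0 : 0 < e / A by rewrite divr_gt0.
have b0 s : 0 < b s by rewrite ltr_wpDl ?fine_ge0// mulr_gt0.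
have mb : measurable_fun setT b.
  apply: measurable_funD; last exact: measurable_funM.
  exact: (measurableT_comp (@fine_measurable _ setT measurableT)).
have Be0 : 0 < fine B + e by rewrite ltr_wpDl ?fine_ge0.
have bB : (\int[leb]_(s in D) (b s)%:E <= (fine B + e)%:E)%E.
  rewrite (_ : (\int[leb]_(s in D) (b s)%:E =
      \int[leb]_(s in D) (dst s + (e / A)%:E * (a s)%:E))%E); last first.
    apply: eq_integral => s /set_mem Ds.
    by rewrite /b EFinD EFinM fineK//; exact: dist_L2_fin.
  rewrite ge0_integralD//; last 3 first.
  - exact: measurable_funTS.
  - by move=> s _; rewrite mule_ge0// lee_fin ltW.
  - by apply: measurable_funeM; apply/measurable_EFinP; exact: measurable_funTS.
  rewrite ge0_integralZl//; last 3 first.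
  - by apply/measurable_EFinP; exact: measurable_funTS.
  - by move=> s _; rewrite lee_fin ltW.
  - by rewrite lee_fin ltW.
  rewrite EFinD fineK//; apply: leeD => //.
  apply: (@le_trans _ _ ((e / A)%:E * A%:E)%E).
    by apply: lee_wpmul2l => //; rewrite lee_fin ltW.
  by rewrite -EFinM divfK ?gt_eqF.
pose H s x := `|F s x - simple_eval S s x|.
have H0 s x : 0 <= H s x by exact: normr_ge0.
have mH : measurable_fun setT (fun z : R * R => H z.1 z.2).
  apply: measurableT_comp => //; apply: measurable_funB => //.
  exact: simple_eval_measurable.
have Hb s : D s -> (sqr_norm m (H s) <= (b s ^+ 2)%:E)%E.
  move=> Ds; rewrite /sqr_norm /H.
  under eq_integral do rewrite real_normK ?num_real//.
  apply: (@sqr_norm_le _ _ _ _ (F s \- simple_eval S s)); first exact: ltW.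
  have := dist_L2_fin S Ds; rewrite -/(dst s) => dfin.
  rewrite -[X in (X <= _)%E]/(dst s) -(fineK dfin) lee_fin.
  by rewrite lerDl mulr_ge0// ltW.
have MI := minkowski_integral lsf msf mD H0 mH b0 mb Be0 bB Hb.
rewrite -(fineK Bfin) -EFinD; apply: Lnorm2_le; first exact: ltW.
apply: le_trans MI.
have mI : measurable_fun setT (fun x => (\int[leb]_(s in D) (H s x)%:E)%E).
  apply: (@measurable_fun_integral1 _ _ _ _ R leb lsf (fun x s => (H s x)%:E)) => //.
    by move=> x s; rewrite lee_fin.
  apply/measurable_EFinP.
  exact: (measurableT_comp mH (@measurable_swap _ _ _ _)).
have I0 x : (0 <= \int[leb]_(s in D) (H s x)%:E)%E.
  by apply: integral_ge0 => s _; rewrite lee_fin.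
apply: ae_ge0_le_integral => //.
- by move=> x _; rewrite lee_fin sqr_ge0.
- apply/measurable_EFinP/measurable_funX/measurable_funB.
    exact: kernel_integral_measurable.
  rewrite /simple_integral.
  apply: (@measurable_sum _ _ _ setT _ _
    (fun i x => fine (leb (simple_set (s := S) i `&` D)) * simple_coef (s := S) i x)) => i.
  by apply: measurable_funM => //; exact: Lfun2_measurable (simple_in_L2 i).
- by move=> x _; exact: mule_ge0.
- exact: emeasurable_funM.
have := kernel_integrable_ae; apply: filterS => x Fx _.
have FSx : leb.-integrable D (EFin \o (fun s => F s x - simple_eval S s x)).
  have := integrableB _ Fx (simple_eval_integrable S x); move=> /(_ mD).
  by apply: eq_integrable => // s _.
have Ifin : (\int[leb]_(s in D) (H s x)%:E)%E \is a fin_num.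
  rewrite ge0_fin_numE//.
  by case/integrableP: FSx.
rewrite -(fineK Ifin) -EFinM -expr2 lee_fin.
rewrite /= (kernel_integral_sub S Fx) -(real_normK (num_real _)).
rewrite ler_pXn2r ?nnegrE ?fine_ge0//.
exact: le_normr_Rintegral.
Qed.

Lemma kernel_integral_Lfun : kernel_integral \in Lfun m 2%:E.
Proof.
apply: Lfun2P; first exact: kernel_integral_measurable.
(* The simple function without terms is 0, so comparing with it bounds the norm of the pointwise
   integral itself. *)
pose S : simple_L2 m := @SimpleL2 R m 0 (fun=> set0) (fun=> cst 0)
  (fun=> measurable0) (fun=> ltac:(by rewrite measure0 ltry)) (fun i => ltac:(by case: i)).
have := dist_kernel_integral_le S.
have SE s x : simple_eval S s x = 0 by rewrite /simple_eval big_ord0.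
have SI x : simple_integral D S x = 0 by rewrite /simple_integral big_ord0.
have -> : dist_L2 m kernel_integral (simple_integral D S) =
    'N[m]_2%:E[EFin \o kernel_integral]%E.
  by apply: eq_Lnorm => x /=; rewrite SI subr0.
move=> h; have := @sqr_norm_le _ _ _ m kernel_integral A (ltW A0).
suff: ('N[m]_2%:E[EFin \o kernel_integral] <= A%:E)%E.
  by move=> /[swap]/[apply] /le_lt_trans; apply; rewrite ltry.
apply: (le_trans h); apply: le_trans aA; apply: ge0_le_integral => //.
- by move=> s _; exact: Lnorm_ge0.
- by apply: measurable_funTS; exact: dist_L2_measurable.
- by apply/measurable_EFinP; exact: measurable_funTS.
move=> s Ds; apply: Lnorm2_le; first exact: ltW.
apply: le_trans (Fa Ds); rewrite /sqr_norm.
by under eq_integral do rewrite /= SE subr0.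
Qed.

(** The integrals of one approximating sequence converge both to [g] and to the pointwise integral,
    so the norm of the difference is 0. *)
Lemma bochner_integral_unique g : is_bochner_integral m D F g ->
  {ae m, forall x, g x = kernel_integral x}.
Proof.
move=> [gL _ [S [_ S1 S2]]].
have gK : g \- kernel_integral \in Lfun m 2%:E.
  by apply: (@rpredB _ (Lfun m 2%:E)) => //; exact: kernel_integral_Lfun.
suff: 'N[m]_2%:E[EFin \o (g \- kernel_integral)%R]%E = 0%E.
  move/Lnorm_eq0_eq0 => /(_ _ _)/wrap[].
    by apply/measurable_EFinP; exact: Lfun2_measurable gK.
    by rewrite lte_fin ltr0n.
  by apply: filterS => x /(_ I)[] /eqP; rewrite subr_eq0 => /eqP.
apply/eqP; rewrite eq_le Lnorm_ge0 andbT.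
have mI n : measurable_fun setT (simple_integral D (S n)).
  apply: (@measurable_sum _ _ _ setT _ _
    (fun i x => fine (leb (simple_set (s := S n) i `&` D)) * simple_coef (s := S n) i x)) => i.
  by apply: measurable_funM => //; exact: Lfun2_measurable (simple_in_L2 i).
have cv : (dist_L2 m g (simple_integral D (S n)) +
    \int[leb]_(s in D) dist_L2 m (F s) (simple_eval (S n) s))%E @[n --> \oo] --> 0%E.
  by rewrite -[X in _ --> X]adde0; apply: cvgeD.
apply: (cvge_to_ge cv); apply: nearW => n.
apply: (@le_trans _ _ (dist_L2 m g (simple_integral D (S n)) +
    dist_L2 m (simple_integral D (S n)) kernel_integral))%E.
  rewrite (_ : g \- kernel_integral = (g \- simple_integral D (S n)) \+
     (simple_integral D (S n) \- kernel_integral)); last first.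
    by apply/funext => x /=; rewrite addrA subrK.
  apply: minkowski_EFin; last by rewrite ler1n.
    by apply: measurable_funB => //; exact: Lfun2_measurable gL.
  by apply: measurable_funB => //; exact: kernel_integral_measurable.
apply: leeD => //.
apply: le_trans (dist_kernel_integral_le (S n)).
rewrite /dist_L2 -oppe_Lnorm.
by rewrite (@eq_Lnorm _ _ _ _ _ _ (EFin \o (kernel_integral \- simple_integral D (S n))))// => x /=;
  rewrite opprB.
Qed.

End bochner_kernel.

Lemma ge0_cvge0 (R : realType) (u : nat -> \bar R) :
  (forall n, 0 <= u n)%E ->
  (forall e : R, 0 < e -> \forall n \near \oo, (u n <= e%:E)%E) ->
  u n @[n --> \oo] --> 0%E.
Proof.
move=> u0 ue; apply/fine_cvgP; split.
  have := ue 1 ltr01; apply: filterS => n un.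
  by rewrite ge0_fin_numE//; apply: le_lt_trans un _; rewrite ltry.
apply/cvgr0Pnorm_le => e e0; have := ue e e0; apply: filterS => n un.
rewrite /= ger0_norm ?fine_ge0// -lee_fin fineK// ge0_fin_numE//.
by apply: le_lt_trans un _; rewrite ltry.
Qed.

(** * Approximation of a right-continuous kernel by step functions *)

Section bochner_step.
Context {R : realType}.
Variable m : {measure set R -> \bar R}.
Hypothesis msf : sigma_finite setT m.
Variable F : R -> R -> R.
Hypothesis mF : measurable_fun setT (fun z : R * R => F z.1 z.2).
Variables (a : R -> R) (A : R).
Hypotheses (a0 : forall s, 0 < a s) (ma : measurable_fun setT a) (A0 : 0 < A).
Notation D := (`]0%R, +oo[%classic : set R).
Hypothesis aA : (\int[lebesgue_measure]_(s in D) (a s)%:E <= A%:E)%E.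
Hypothesis Fa : forall s, D s -> (sqr_norm m (F s) <= (a s ^+ 2)%:E)%E.
Hypothesis a_noninc : forall s t, 0 < s -> s <= t -> a t <= a s.
Hypothesis F_right_continuous : forall s e : R, 0 < s -> 0 < e ->
  exists2 h : R, 0 < h & forall t, s <= t -> t < s + h ->
    ('N[m]_2%:E[EFin \o (F s \- F t)%R] <= e%:E)%E.

Notation leb := (@lebesgue_measure R).
Let mD : measurable D. Proof. exact: measurable_itv. Qed.
Let mFs s : measurable_fun setT (F s).
Proof. exact: (measurableT_comp mF (@measurable_pair1 _ _ _ _ s)). Qed.

Let knot n j : R := j%:R / n.+1%:R.

Let knot_gt0 n j : D (knot n j.+1).
Proof. by rewrite /= in_itv/= andbT divr_gt0. Qed.

Lemma step_finite n j : (leb `[knot n j, knot n j.+1[%classic < +oo)%E.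
Proof. by rewrite lebesgue_measure_itv/=; case: ifPn => _; rewrite ?ltry. Qed.

(** The mesh is [1/(n+1)] and the horizon [n + 1], hence the square number of steps. Each step takes
    the value at its right end: the left end of the first one is 0, where no bound on [F] is
    available, and right-continuity then gives the convergence. *)
Definition step_fun n : simple_L2 m := @SimpleL2 R m (n.+1 * n.+1)
  (fun j => `[knot n j, knot n j.+1[%classic)
  (fun j => F (knot n j.+1))
  (fun j => measurable_itv _)
  (fun j => step_finite n j)
  (fun j => kernel_Lfun mF Fa (knot_gt0 n j)).

Lemma step_funE n s x : 0 <= s -> simple_eval (step_fun n) s x =
  if s < n.+1%:R then F (knot n (Num.truncn (s * n.+1%:R)).+1) x else 0.
Proof.
move=> s0; rewrite /simple_eval.
have n0 : 0 < n.+1%:R :> R by [].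
have E (j : 'I_(n.+1 * n.+1)) :
    \1_(simple_set (s := step_fun n) j) s = (Num.truncn (s * n.+1%:R) == j)%:R :> R.
  rewrite indicE; congr (nat_of_bool _)%:R.
  rewrite truncn_eq ?mulr_ge0//.
  apply/idP/idP; rewrite inE /= in_itv/= /knot ler_pdivrMr// ltr_pdivlMr//.
rewrite (eq_bigr _ (fun i _ => congr1 (fun z => z * _) (E i))).
have [sn|sn] := ltP s n.+1%:R.
  have kN : (Num.truncn (s * n.+1%:R) < n.+1 * n.+1)%N.
    by rewrite truncn_lt_nat ?mulr_ge0// natrM ltr_pM2r.
  rewrite (bigD1 (Ordinal kN))//= eqxx mul1r big1 ?addr0// => j jk.
  suff -> : (Num.truncn (s * n.+1%:R) == j) = false by rewrite mul0r.
  by apply/negbTE; apply: contra jk => /eqP jk; apply/eqP/val_inj.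
rewrite big1// => j _.
suff -> : (Num.truncn (s * n.+1%:R) == j) = false by rewrite mul0r.
apply/negbTE; apply/eqP => jk; have := ltn_ord j; rewrite -jk /=.
by rewrite truncn_lt_nat ?mulr_ge0// natrM ltr_pM2r// ltNge sn.
Qed.

Let knot_near n s : 0 <= s ->
  s < knot n (Num.truncn (s * n.+1%:R)).+1 <= s + n.+1%:R^-1.
Proof.
move=> s0; have n0 : 0 < n.+1%:R :> R by [].
have := truncn_itv (mulr_ge0 s0 (ltW n0)) => /andP[h1 h2].
rewrite /knot ltr_pdivlMr// h2/= ler_pdivrMr// mulrDl mulVf ?gt_eqF//.
by rewrite -natr1 lerD2r.
Qed.

Let Fnorm s : 0 < s -> ('N[m]_2%:E[EFin \o F s] <= (a s)%:E)%E.
Proof.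
by move=> s0; apply: Lnorm2_le (ltW (a0 s)) (Fa _); rewrite /= in_itv/= s0.
Qed.

(** The sampled time lies to the right of [s], so the nonincreasing bound [a] at [s] covers both
    functions; beyond the horizon the step function is 0. The bound dominates all the distances at
    once. *)
Lemma step_dist_le n s : 0 < s ->
  (dist_L2 m (F s) (simple_eval (step_fun n) s) <= (2 * a s)%:E)%E.
Proof.
move=> s0; rewrite /dist_L2.
have [sn|sn] := ltP s n.+1%:R; last first.
  rewrite (@eq_Lnorm _ _ _ _ _ _ (EFin \o F s)); last first.
    by move=> x /=; rewrite step_funE ?ltW// ltNge sn/= subr0.
  by apply: le_trans (Fnorm s0) _; rewrite lee_fin ler_peMl ?ler1n// ltW.
set t := knot n (Num.truncn (s * n.+1%:R)).+1.
have /andP[st _] := knot_near n (ltW s0).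
rewrite (@eq_Lnorm _ _ _ _ _ _ (EFin \o (F s \+ (fun x => - F t x)))); last first.
  by move=> x /=; rewrite step_funE ?ltW// sn.
apply: le_trans (@minkowski_EFin _ _ _ _ (F s) (fun x => - F t x) 2 _ _ _) _ => //.
- exact: measurable_funN.
- by rewrite ler1n.
have -> : (2 * a s)%:E = ((a s)%:E + (a s)%:E)%E.
  by rewrite -EFinD; congr (_%:E); ring.
apply: leeD; first exact: Fnorm.
rewrite (_ : EFin \o _ = \- (EFin \o F t))%E; last by apply/funext.
rewrite oppe_Lnorm; apply: le_trans (Fnorm (lt_trans s0 st)) _.
by rewrite lee_fin a_noninc// ltW.
Qed.

Lemma step_dist_cvg s : 0 < s ->
  dist_L2 m (F s) (simple_eval (step_fun n) s) @[n --> \oo] --> 0%E.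
Proof.
move=> s0; apply: ge0_cvge0 => [n|e e0]; first exact: Lnorm_ge0.
have [h h0 Hh] := F_right_continuous s0 e0.
near=> n.
have sn : s < n.+1%:R.
  apply: (@lt_le_trans _ _ n%:R); last by rewrite ler_nat.
  by near: n; exact: nbhs_infty_gtr.
have hn : n.+1%:R^-1 < h.
  rewrite invf_plt ?posrE// (@lt_le_trans _ _ n%:R) ?ler_nat//.
  by near: n; exact: nbhs_infty_gtr.
have /andP[st th] := knot_near n (ltW s0).
rewrite /dist_L2 (@eq_Lnorm _ _ _ _ _ _
  (EFin \o (F s \- F (knot n (Num.truncn (s * n.+1%:R)).+1)))); last first.
  by move=> x /=; rewrite step_funE ?ltW// sn.
apply: Hh; first exact: ltW.
by apply: le_lt_trans th _; rewrite ltrD2l.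
Unshelve. all: by end_near. Qed.

Theorem kernel_is_bochner_integral :
  is_bochner_integral m D F (kernel_integral D F).
Proof.
have D0 s : D s -> 0 < s by rewrite /= in_itv/= andbT.
have LF s : D s -> F s \in Lfun m 2%:E by move=> Ds; exact: (kernel_Lfun mF Fa Ds).
split.
- exact: (kernel_integral_Lfun msf mD mF a0 ma A0 aA Fa).
- exact: aeW.
have cv : (\int[leb]_(s in D) dist_L2 m (F s) (simple_eval (step_fun n) s))%E
    @[n --> \oo] --> 0%E.
  have [] := @dominated_convergence _ _ R leb D mD
    (fun n s => dist_L2 m (F s) (simple_eval (step_fun n) s)) (cst 0%E)
    (fun s => (2 * a s)%:E).
  - by move=> n; apply: measurable_funTS; exact: dist_L2_measurable.
  - exact: measurable_cst.
  - by apply: aeW => s /D0; exact: step_dist_cvg.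
  - rewrite (_ : (fun s => (2 * a s)%:E) = (fun s => 2%:E * (a s)%:E)%E)//.
    apply: integrableZl => //.
    apply/integrableP; split; first by apply/measurable_EFinP; exact: measurable_funTS.
    under eq_integral do rewrite gee0_abs ?lee_fin ?ltW//.
    by apply: le_lt_trans aA _; rewrite ltry.
  - apply: aeW => s n /D0 s0; rewrite gee0_abs ?Lnorm_ge0//.
    exact: step_dist_le.
  by move=> _ _; rewrite integral0.
exists step_fun; split => //.
  by apply: aeW => s /D0; exact: step_dist_cvg.
apply: (squeeze_cvge _ (cvg_cst 0%E) cv); apply: nearW => n.
rewrite Lnorm_ge0/=.
exact: (dist_kernel_integral_le msf mD mF a0 ma A0 aA Fa).
Qed.

Lemma bochner_integralE :
  {ae m, forall x, bochner_integral m D F x = kernel_integral D F x}.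
Proof.
apply: (bochner_integral_unique msf mD mF a0 ma A0 aA Fa).
exact: (xgetPex (cst 0) (ex_intro _ _ kernel_is_bochner_integral)).
Qed.

End bochner_step.

(* The increments of a midpoint convex function over steps of length h only
   grow when moving to the left. *)
Lemma midconvex_decrement (R : realType) (psi : R -> R) (M w h : R) (n : nat) :
  (forall s, 0 < s -> 0 <= psi s) -> (forall s, 0 < s -> psi s <= M) ->
  (forall s t, 0 < s -> 0 < t -> 2 * psi ((s + t) / 2) <= psi s + psi t) ->
  0 < w -> 0 <= h -> n%:R * h < w -> n%:R * (psi w - psi (w + h)) <= M.
Proof.
move=> psi0 psiM psiC w0 h0.
(* The induction carries two facts: the decrement [n] steps to the left is at least the one at [w],
   and [n] such decrements sum to at most the value reached there. *)
suff H : n%:R * h < w ->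
    psi w - psi (w + h) <= psi (w - n%:R * h) - psi (w - n%:R * h + h) /\
    n%:R * (psi w - psi (w + h)) <= psi (w - n%:R * h).
  by move=> nw; have [_] := H nw; move/le_trans; apply; apply: psiM; rewrite subr_gt0.
elim: n => [|n IH] nw.
  by rewrite !mul0r subr0 psi0.
have nw' : n%:R * h < w.
  by apply: le_lt_trans nw; rewrite ler_wpM2r// ler_nat.
have [I1 I2] := IH nw'.
have E1 : n.+1%:R * h = n%:R * h + h by rewrite -natr1 mulrDl mul1r.
have w1 : 0 < w - n.+1%:R * h by rewrite subr_gt0.
have := psiC _ _ w1 (_ : 0 < w - n%:R * h + h).
have -> : (w - n.+1%:R * h + (w - n%:R * h + h)) / 2 = w - n%:R * h.
  by rewrite E1; field.
have -> : w - n.+1%:R * h + h = w - n%:R * h by rewrite E1; ring.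
have w2 : 0 < w - n%:R * h + h by rewrite ltr_wpDr// subr_gt0.
move=> /(_ w2) C.
split; first by lra.
rewrite (_ : n.+1%:R * (psi w - psi (w + h)) =
  n%:R * (psi w - psi (w + h)) + (psi w - psi (w + h))); first by lra.
by rewrite -natr1; ring.
Qed.

(** * Symmetric semigroups on L^2 *)

Section symmetric_kernel.
Context {R : realType}.
Variable m : {measure set R -> \bar R}.
Hypothesis msf : sigma_finite setT m.
Variable q : R -> R -> R -> R.
Hypotheses (q0 : forall t x y, 0 <= q t x y)
  (qsym : forall t x y, q t x y = q t y x)
  (mq : measurable_fun setT (fun z : R * R * R => q z.1.1 z.1.2 z.2))
  (q_sub_markov : forall t x, (\int[m]_y (q t x y)%:E <= 1)%E)
  (q_semigroup : forall t s x y, 0 < t -> 0 < s ->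
    (\int[m]_z (q t x z * q s z y)%:E = (q (t + s) x y)%:E)%E).

Let mqx t x : measurable_fun setT (q t x).
Proof. exact: (measurableT_comp mq (@measurable_pair1 _ _ _ _ (t, x))). Qed.

Let mqp t : measurable_fun setT (fun z : R * R => q t z.1 z.2).
Proof.
apply: (measurableT_comp (f := fun z : R * R * R => q z.1.1 z.1.2 z.2)
  (g := fun z : R * R => ((t, z.1), z.2)) mq).
by apply: measurable_fun_pair => //; apply: measurable_fun_pair.
Qed.

Let mqpS t : measurable_fun setT (fun z : R * R => q t z.2 z.1).
Proof. exact: (measurableT_comp (mqp t) (@measurable_swap _ _ _ _)). Qed.

Definition kernel_apply (f : R -> R) t x : R := \int[m]_y (f y * q t x y).

Lemma kernel_sqr t x : 0 < t ->
  (\int[m]_y ((q t x y) ^+ 2)%:E = (q (t + t) x x)%:E)%E.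
Proof.
move=> t0; rewrite -(q_semigroup x x t0 t0); apply: eq_integral => y _.
by rewrite expr2 [q t y x]qsym.
Qed.

(** By the semigroup property [q t x] has the finite squared norm [q (t + t) x x], so its product
    with [f] is integrable. *)
Lemma kernel_apply_integrable f t x : 0 < t ->
  measurable_fun setT f -> (sqr_norm m f < +oo)%E ->
  m.-integrable setT (EFin \o (fun y => f y * q t x y)).
Proof.
move=> t0 mf ffin.
have mfq : measurable_fun setT (fun y => f y * q t x y) by exact: measurable_funM.
apply/integrableP; split; first exact/measurable_EFinP.
apply: (@le_lt_trans _ _ (\int[m]_y ((2^-1)%:E * ((f y ^+ 2)%:E + (q t x y ^+ 2)%:E)))%E).
  apply: ge0_le_integral => //.
  - by apply/measurable_EFinP; exact: measurableT_comp.
  - apply: measurable_funeM; apply: emeasurable_funD; apply/measurable_EFinP; exact: measurable_funX.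
  - move=> y _; rewrite -EFinD -EFinM lee_fin.
    rewrite normrM -(real_normK (num_real (f y))) -(real_normK (num_real (q t x y))).
    have := sqr_ge0 (`|f y| - `|q t x y|); lra.
rewrite ge0_integralZl//; last 2 first.
- by apply: emeasurable_funD; apply/measurable_EFinP; exact: measurable_funX.
- by move=> y _; rewrite -EFinD lee_fin addr_ge0// sqr_ge0.
rewrite ge0_integralD//; last 4 first.
- by move=> y _; rewrite lee_fin sqr_ge0.
- by apply/measurable_EFinP; exact: measurable_funX.
- by move=> y _; rewrite lee_fin sqr_ge0.
- by apply/measurable_EFinP; exact: measurable_funX.
rewrite kernel_sqr//; apply: lte_mul_pinfty; rewrite ?lee_fin ?invr_ge0//.
by apply: lte_add_pinfty => //; rewrite ltry.
Qed.

Lemma kernel_applyE f t x : 0 < t ->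
  measurable_fun setT f -> (sqr_norm m f < +oo)%E ->
  (kernel_apply f t x)%:E = (\int[m]_y (f y * q t x y)%:E)%E.
Proof.
move=> t0 mf ffin; rewrite /kernel_apply /Rintegral fineK//.
apply: integrable_fin_num => //; exact: kernel_apply_integrable.
Qed.

Lemma kernel_apply_measurable_pair f : measurable_fun setT f ->
  measurable_fun setT (fun z : R * R => kernel_apply f z.1 z.2).
Proof.
move=> mf.
rewrite /kernel_apply /Rintegral.
apply: (measurableT_comp (@fine_measurable _ setT measurableT)).
have mH : measurable_fun setT (fun z : R * R * R => (f z.2 * q z.1.1 z.1.2 z.2)%:E).
  by apply/measurable_EFinP; apply: measurable_funM => //; exact: measurableT_comp.
under eq_fun do rewrite integralE.
apply: emeasurable_funB.
  apply: (@measurable_fun_integral1 _ _ (R * R)%type R R m msf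
    (fun z : R * R => (fun y => (f y * q z.1 z.2 y)%:E)^\+)%E) => //.
  have := measurable_funepos mH; apply: eq_measurable_fun => z _.
  by rewrite !funeposE.
apply: (@measurable_fun_integral1 _ _ (R * R)%type R R m msf
  (fun z : R * R => (fun y => (f y * q z.1 z.2 y)%:E)^\-)%E) => //.
have := measurable_funeneg mH; apply: eq_measurable_fun => z _.
by rewrite !funenegE.
Qed.

Lemma kernel_apply_measurable f t : measurable_fun setT f ->
  measurable_fun setT (kernel_apply f t).
Proof.
move=> mf.
exact: (measurableT_comp (kernel_apply_measurable_pair mf) (@measurable_pair1 _ _ _ _ t)).
Qed.

Section nonnegative.
Variable f : R -> R.
Hypotheses (f0 : forall x, 0 <= f x) (mf : measurable_fun setT f)
  (ffin : (sqr_norm m f < +oo)%E).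

Lemma kernel_apply_ge0 t x : 0 <= kernel_apply f t x.
Proof. by apply: Rintegral_ge0 => y _; rewrite mulr_ge0. Qed.

(** Jensen's inequality for the square, with respect to the measure of density [q t x], whose mass
    is at most 1. *)
Lemma kernel_apply_sqr_le t x : 0 < t ->
  ((kernel_apply f t x ^+ 2)%:E <= \int[m]_y (f y ^+ 2 * q t x y)%:E)%E.
Proof.
move=> t0; set i := kernel_apply f t x; set W := (\int[m]_y _)%E.
have W0 : (0 <= W)%E by apply: integral_ge0 => y _; rewrite lee_fin mulr_ge0// sqr_ge0.
have [->|Wfin] := eqVneq W +oo%E; first by rewrite leey.
have {}Wfin : W \is a fin_num by rewrite ge0_fin_numE// ltey.
have mW : measurable_fun setT (fun y => (f y ^+ 2 * q t x y)%:E).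
  by apply/measurable_EFinP; apply: measurable_funM => //; exact: measurable_funX.
have := kernel_apply_ge0 t x; rewrite -/i le_eqVlt => /predU1P[<-|i0].
  by rewrite expr0n.
(* The mean-square inequality for [1] and [f y] is integrated with the value [i] itself as weight;
   the mass bound leaves [i / 2] to be absorbed on the left. *)
have : (i%:E <= (i / 2)%:E * 1 + (i^-1 / 2)%:E * W)%E.
  rewrite kernel_applyE//.
  have ci : 0 <= i^-1 / 2 by rewrite divr_ge0// invr_ge0 ltW.
  have ci2 : 0 <= i / 2 by rewrite divr_ge0// ltW.
  apply: (@le_trans _ _ (\int[m]_y ((i / 2)%:E * (q t x y)%:E +
      (i^-1 / 2)%:E * (f y ^+ 2 * q t x y)%:E))%E).
    apply: ge0_le_integral => //.
    - by move=> y _; rewrite lee_fin mulr_ge0.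
    - by apply/measurable_EFinP; exact: measurable_funM.
    - apply: emeasurable_funD; apply: measurable_funeM => //.
      exact/measurable_EFinP.
    - move=> y _; rewrite -!EFinM -EFinD lee_fin mulrA -mulrDl ler_wpM2r//.
      have := @mean_square_le _ 1 (f y) i i0; rewrite expr1n mulr1 mul1r; exact.
  rewrite ge0_integralD//; last 4 first.
  - by move=> y _; rewrite mule_ge0// lee_fin.
  - by apply: measurable_funeM; exact/measurable_EFinP.
  - by move=> y _; rewrite mule_ge0 ?lee_fin// mulr_ge0 ?sqr_ge0.
  - exact: measurable_funeM.
  rewrite !ge0_integralZl//; last 2 first.
  - exact/measurable_EFinP.
  - by move=> y _; rewrite lee_fin.
  - by apply: leeD => //; apply: lee_wpmul2l => //; rewrite lee_fin.
  by move=> y _; rewrite lee_fin mulr_ge0 ?sqr_ge0.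
rewrite mule1 -(fineK Wfin) -EFinM -EFinD !lee_fin.
set b := fine W => H.
have : i / 2 <= b / (2 * i).
  by have -> : b / (2 * i) = i^-1 / 2 * b; [field; rewrite gt_eqF|lra].
rewrite ler_pdivlMr ?mulr_gt0//.
by have -> : i / 2 * (2 * i) = i ^+ 2 by field.
Qed.

(** Jensen's inequality is applied in [y] and integrated in [x]. By symmetry the mass of the kernel
    in its first variable is at most 1 as well. *)
Lemma kernel_apply_contraction t : 0 < t ->
  (sqr_norm m (kernel_apply f t) <= sqr_norm m f)%E.
Proof.
move=> t0; rewrite /sqr_norm.
have m1 : measurable_fun setT (fun z : R * R => (f z.2 ^+ 2 * q t z.1 z.2)%:E).
  apply/measurable_EFinP; apply: measurable_funM => //.
  by apply: measurable_funX; exact: measurableT_comp.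
have g0 x y : (0 <= (f y ^+ 2 * q t x y)%:E)%E by rewrite lee_fin mulr_ge0// sqr_ge0.
apply: (@le_trans _ _ (\int[m]_x \int[m]_y (f y ^+ 2 * q t x y)%:E)%E).
  apply: ge0_le_integral => //.
  - by move=> x _; rewrite lee_fin sqr_ge0.
  - apply/measurable_EFinP; apply: measurable_funX; exact: kernel_apply_measurable.
  - exact: (@measurable_fun_integral1 _ _ _ _ R m msf (fun x y => (f y ^+ 2 * q t x y)%:E)).
  - by move=> x _; exact: kernel_apply_sqr_le.
rewrite (tonelli msf msf (f := fun x y => (f y ^+ 2 * q t x y)%:E))//.
apply: ge0_le_integral => //.
- by move=> y _; exact: integral_ge0.
- apply: (@measurable_fun_integral1 _ _ _ _ R m msf (fun y x => (f y ^+ 2 * q t x y)%:E)) => //.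
  exact: (measurableT_comp m1 (@measurable_swap _ _ _ _)).
- by apply/measurable_EFinP; exact: measurable_funX.
move=> y _; under eq_integral do rewrite EFinM qsym.
rewrite ge0_integralZl//; last 3 first.
- exact/measurable_EFinP.
- by move=> x _; rewrite lee_fin.
- by rewrite lee_fin sqr_ge0.
by rewrite -[leRHS]mule1; apply: lee_wpmul2l => //; rewrite lee_fin sqr_ge0.
Qed.

Lemma kernel_apply_fin t : 0 < t -> (sqr_norm m (kernel_apply f t) < +oo)%E.
Proof. by move=> t0; apply: le_lt_trans ffin; exact: kernel_apply_contraction. Qed.

Lemma kernel_apply_semigroup s t x : 0 < s -> 0 < t ->
  kernel_apply (kernel_apply f t) s x = kernel_apply f (s + t) x.
Proof.
move=> s0 t0; apply: EFin_inj.
rewrite kernel_applyE//; [|exact: kernel_apply_measurable|exact: kernel_apply_fin].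
rewrite kernel_applyE ?addr_gt0//.
have h0 z y : (0 <= (f y * q t z y * q s x z)%:E)%E by rewrite lee_fin !mulr_ge0.
have mh : measurable_fun setT (fun w : R * R => (f w.2 * q t w.1 w.2 * q s x w.1)%:E).
  apply/measurable_EFinP; apply: measurable_funM.
    by apply: measurable_funM => //; exact: measurableT_comp.
  exact: (measurableT_comp (mqx s x)).
transitivity (\int[m]_z \int[m]_y (f y * q t z y * q s x z)%:E)%E.
  apply: eq_integral => z _; under [RHS]eq_integral do rewrite mulrC EFinM.
  rewrite ge0_integralZl ?lee_fin//; last 2 first.
  - by apply/measurable_EFinP; exact: measurable_funM.
  - by move=> y _; rewrite lee_fin mulr_ge0.
  by rewrite -kernel_applyE// -EFinM mulrC.
rewrite (tonelli msf msf (f := fun z y => (f y * q t z y * q s x z)%:E))//.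
apply: eq_integral => y _.
rewrite EFinM -q_semigroup// -ge0_integralZl//; last 3 first.
- apply/measurable_EFinP; apply: measurable_funM => //.
  by rewrite (_ : (fun z => q t z y) = q t y)//; apply/funext => z; exact: qsym.
- by move=> z _; rewrite lee_fin mulr_ge0.
- by rewrite lee_fin.
by apply: eq_integral => z _; rewrite -EFinM; congr (_%:E); ring.
Qed.

Definition kernel_form t : R := \int[m]_x (f x * kernel_apply f t x).

Lemma kernel_formE s t : 0 < s -> 0 < t ->
  (\int[m]_x (kernel_apply f s x * kernel_apply f t x)%:E =
   \int[m]_x (f x * kernel_apply f (s + t) x)%:E)%E.
Proof.
move=> s0 t0; set g := kernel_apply f t.
have mg : measurable_fun setT g by exact: kernel_apply_measurable.
have g0 x : 0 <= g x by exact: kernel_apply_ge0.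
have h0 x y : (0 <= (f y * q s x y * g x)%:E)%E by rewrite lee_fin !mulr_ge0.
have mh : measurable_fun setT (fun w : R * R => (f w.2 * q s w.1 w.2 * g w.1)%:E).
  apply/measurable_EFinP; apply: measurable_funM.
    by apply: measurable_funM => //; exact: measurableT_comp.
  exact: (measurableT_comp mg).
transitivity (\int[m]_x \int[m]_y (f y * q s x y * g x)%:E)%E.
  apply: eq_integral => x _; under [RHS]eq_integral do rewrite mulrC EFinM.
  rewrite ge0_integralZl ?lee_fin//; last 2 first.
  - by apply/measurable_EFinP; exact: measurable_funM.
  - by move=> y _; rewrite lee_fin mulr_ge0.
  by rewrite -kernel_applyE// -EFinM mulrC.
rewrite (tonelli msf msf (f := fun x y => (f y * q s x y * g x)%:E))//.
apply: eq_integral => y _.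
rewrite -kernel_apply_semigroup// EFinM (@kernel_applyE g)//; last exact: kernel_apply_fin.
rewrite -ge0_integralZl//; last 3 first.
- by apply/measurable_EFinP; exact: measurable_funM.
- by move=> z _; rewrite lee_fin mulr_ge0.
- by rewrite lee_fin.
by apply: eq_integral => z _; rewrite -EFinM qsym; congr (_%:E); ring.
Qed.

Lemma kernel_formD s t : 0 < s -> 0 < t ->
  (\int[m]_x (kernel_apply f s x * kernel_apply f t x)%:E =
   (kernel_form (s + t))%:E)%E.
Proof.
move=> s0 t0; rewrite kernel_formE// /kernel_form /Rintegral fineK//.
rewrite -kernel_formE// ge0_fin_numE; last first.
  by apply: integral_ge0 => x _; rewrite lee_fin mulr_ge0// kernel_apply_ge0.
have L u : 0 < u -> kernel_apply f u \in Lfun m 2%:E.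
  move=> u0; apply: Lfun2P; first exact: kernel_apply_measurable.
  exact: kernel_apply_fin.
have := Lfun2_mul_Lfun1 (L s s0) (L t t0) => /Lfun1_integrable/integrable_lty.
exact.
Qed.

Lemma kernel_form_sqr_norm s : 0 < s ->
  sqr_norm m (kernel_apply f s) = (kernel_form (2 * s))%:E.
Proof.
move=> s0; have -> : 2 * s = s + s by ring.
by rewrite -kernel_formD.
Qed.

Lemma kernel_form_ge0 s : 0 < s -> 0 <= kernel_form s.
Proof. by move=> s0; apply: Rintegral_ge0 => x _; rewrite mulr_ge0// kernel_apply_ge0. Qed.

Lemma kernel_form_le s : 0 < s -> kernel_form s <= fine (sqr_norm m f).
Proof.
move=> s0; have s20 : 0 < s / 2 by rewrite divr_gt0.
have Ffin : sqr_norm m f \is a fin_num by rewrite ge0_fin_numE// sqr_norm_ge0.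
rewrite -lee_fin (fineK Ffin).
have {1}-> : s = 2 * (s / 2) by field.
by rewrite -kernel_form_sqr_norm//; exact: kernel_apply_contraction.
Qed.

Lemma kernel_apply_sqr_dist s t : 0 < s -> 0 < t ->
  sqr_norm m (kernel_apply f s \- kernel_apply f t) =
  (kernel_form (2 * s) + kernel_form (2 * t) - 2 * kernel_form (s + t))%:E.
Proof.
move=> s0 t0; set u := kernel_apply f s; set v := kernel_apply f t.
have mu_ : measurable_fun setT u by exact: kernel_apply_measurable.
have mv : measurable_fun setT v by exact: kernel_apply_measurable.
have u0 x : 0 <= u x by exact: kernel_apply_ge0.
have v0 x : 0 <= v x by exact: kernel_apply_ge0.
(* The expansion of the square is stated as an equality of sums of nonnegative integrals, which is
   additive without any integrability; the subtraction follows once all terms are finite. *)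
have H : (sqr_norm m (u \- v)%R + 2%:E * \int[m]_x (u x * v x)%:E =
    sqr_norm m u + sqr_norm m v)%E.
  rewrite /sqr_norm -ge0_integralZl//; last 2 first.
  - by apply/measurable_EFinP; exact: measurable_funM.
  - by move=> x _; rewrite lee_fin mulr_ge0.
  rewrite -!ge0_integralD//; last 8 first.
  - by move=> x _; rewrite lee_fin sqr_ge0.
  - by apply/measurable_EFinP; exact: measurable_funX.
  - by move=> x _; rewrite lee_fin sqr_ge0.
  - by apply/measurable_EFinP; exact: measurable_funX.
  - by move=> x _; rewrite lee_fin sqr_ge0.
  - by apply/measurable_EFinP; apply: measurable_funX; exact: measurable_funB.
  - by move=> x _; rewrite mule_ge0// lee_fin mulr_ge0.
  - by apply: measurable_funeM; apply/measurable_EFinP; exact: measurable_funM.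
  by apply: eq_integral => x _; rewrite -EFinM -!EFinD /=; congr (_%:E); ring.
move: H; rewrite kernel_formD// !kernel_form_sqr_norm// -EFinM -EFinD => H.
by rewrite EFinB -H [RHS]addeK.
Qed.

End nonnegative.

(** The form at time [t] is the squared norm at time [t / 2], and reaching [t / 2] from [s / 2]
    applies one more contraction. *)
Lemma kernel_form_noninc (f : R -> R) s t : (forall x, 0 <= f x) -> measurable_fun setT f ->
  (sqr_norm m f < +oo)%E -> 0 < s -> s <= t -> kernel_form f t <= kernel_form f s.
Proof.
move=> f0 mf ffin s0; rewrite le_eqVlt => /predU1P[->//|st].
have s20 : 0 < s / 2 by rewrite divr_gt0.
have t20 : 0 < (t - s) / 2 by rewrite divr_gt0// subr_gt0.
have tE : t = 2 * ((t - s) / 2 + s / 2) by field.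
have sE : s = 2 * (s / 2) by field.
rewrite [in leLHS]tE [in leRHS]sE -lee_fin.
rewrite -[leRHS](kernel_form_sqr_norm f0 mf ffin s20).
rewrite -[leLHS](kernel_form_sqr_norm f0 mf ffin (addr_gt0 t20 s20)).
rewrite (_ : kernel_apply f ((t - s) / 2 + s / 2) =
    kernel_apply (kernel_apply f (s / 2)) ((t - s) / 2)); last first.
  by apply/funext => x; rewrite kernel_apply_semigroup.
apply: kernel_apply_contraction => //.
- by move=> x; exact: kernel_apply_ge0.
- exact: kernel_apply_measurable.
- exact: kernel_apply_fin.
Qed.

(** As the form at [2 * t] is at most that at [s + t], the squared distance is at most the decrement
    of the form from [2 * s] to [2 * t]. If [t - s < s / (n + 1)], then [n + 1] steps of length
    [2 * (t - s)] fit to the left of [2 * s], so this decrement is at most [M / (n + 1)]. *)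
Lemma kernel_apply_continuous_ge0 (f : R -> R) s e : (forall x, 0 <= f x) ->
  measurable_fun setT f -> (sqr_norm m f < +oo)%E -> 0 < s -> 0 < e ->
  exists2 h : R, 0 < h & forall t, s <= t -> t < s + h ->
    (sqr_norm m (kernel_apply f s \- kernel_apply f t)%R <= e%:E)%E.
Proof.
move=> f0 mf ffin s0 e0; set M := fine (sqr_norm m f).
have [n nM] : exists n, M / e < n.+1%:R.
  by exists (Num.truncn (M / e)); exact: truncnS_gt.
have n0 : 0 < n.+1%:R :> R by [].
exists (s / n.+1%:R); first by rewrite divr_gt0.
move=> t st ts.
have t0 : 0 < t by apply: lt_le_trans st.
rewrite (kernel_apply_sqr_dist f0 mf ffin s0 t0) lee_fin.
have psi0 u : 0 < u -> 0 <= kernel_form f u by exact: kernel_form_ge0.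
have psiM u : 0 < u -> kernel_form f u <= M by exact: kernel_form_le.
have psiN : kernel_form f (2 * t) <= kernel_form f (s + t).
  by apply: kernel_form_noninc => //; [exact: addr_gt0|lra].
(* Midpoint convexity is the nonnegativity of the squared distance between the images at times
   [a / 2] and [b / 2]. *)
have psiC a b : 0 < a -> 0 < b ->
    2 * kernel_form f ((a + b) / 2) <= kernel_form f a + kernel_form f b.
  move=> a0 b0.
  have a20 : 0 < a / 2 by rewrite divr_gt0.
  have b20 : 0 < b / 2 by rewrite divr_gt0.
  have := sqr_norm_ge0 m (kernel_apply f (a / 2) \- kernel_apply f (b / 2)).
  rewrite (kernel_apply_sqr_dist f0 mf ffin a20 b20) lee_fin.
  have -> : a / 2 + b / 2 = (a + b) / 2 by field.
  have -> : 2 * (a / 2) = a by field.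
  have -> : 2 * (b / 2) = b by field.
  by rewrite subr_ge0.
move: (kernel_form f) psi0 psiM psiN psiC => psi psi0 psiM psiN psiC.
have tE : 2 * t = 2 * s + 2 * (t - s) by ring.
have : n.+1%:R * (psi (2 * s) - psi (2 * s + 2 * (t - s))) <= M.
  apply: midconvex_decrement => //.
  - by rewrite mulr_gt0.
  - by rewrite mulr_ge0// subr_ge0.
  - have : (t - s) * n.+1%:R < s by rewrite -ltr_pdivlMr// ltrBlDl.
    by rewrite mulrC => ?; rewrite mulrCA ltr_pM2l.
rewrite -tE mulrC -ler_pdivlMr// => H2.
have H3 : M / n.+1%:R <= e.
  by rewrite ler_pdivrMr// ltW// mulrC -ltr_pdivrMr.
move: H2 H3 psiN; set c := M / _; lra.
Qed.

Section signed.
Variable f : R -> R.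
Hypotheses (mf : measurable_fun setT f) (ffin : (sqr_norm m f < +oo)%E).

(** The image of [f] is dominated by the image of its absolute value, to which the nonnegative case
    applies. *)
Lemma kernel_apply_contraction_signed t : 0 < t ->
  (sqr_norm m (kernel_apply f t) <= sqr_norm m f)%E.
Proof.
move=> t0; pose g x := `|f x|.
have mg : measurable_fun setT g by exact: measurableT_comp.
have g0 x : 0 <= g x by exact: normr_ge0.
have gE : sqr_norm m g = sqr_norm m f.
  by apply: eq_integral => x _; rewrite /g real_normK ?num_real.
have gfin : (sqr_norm m g < +oo)%E by rewrite gE.
rewrite -gE; apply: le_trans (kernel_apply_contraction g0 mg gfin t0).
apply: ge0_le_integral => //.
- by move=> x _; rewrite lee_fin sqr_ge0.
- apply/measurable_EFinP; apply: measurable_funX; exact: kernel_apply_measurable.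
- apply/measurable_EFinP; apply: measurable_funX; exact: kernel_apply_measurable.
move=> x _; rewrite lee_fin -(real_normK (num_real (kernel_apply f t x))).
rewrite ler_pXn2r// ?nnegrE ?kernel_apply_ge0//.
apply: (le_trans (le_normr_Rintegral _ (kernel_apply_integrable x t0 mf ffin))) => //.
rewrite le_eqVlt; apply/orP; left; apply/eqP.
by apply: eq_Rintegral => y _; rewrite normrM [X in _ * X]ger0_norm.
Qed.

Let pos x := Num.max (f x) 0.
Let neg x := Num.max (- f x) 0.
Let pos0 x : 0 <= pos x. Proof. by rewrite le_max lexx orbT. Qed.
Let neg0 x : 0 <= neg x. Proof. by rewrite le_max lexx orbT. Qed.
Let mpos : measurable_fun setT pos. Proof. exact: measurable_maxr. Qed.
Let mneg : measurable_fun setT neg.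
Proof. by apply: measurable_maxr => //; exact: measurable_funN. Qed.

Let part_fin (g : R -> R) : measurable_fun setT g -> (forall x, 0 <= g x <= `|f x|) ->
  (sqr_norm m g < +oo)%E.
Proof.
move=> mg gf; apply: le_lt_trans ffin; apply: ge0_le_integral => //.
- by move=> x _; rewrite lee_fin sqr_ge0.
- by apply/measurable_EFinP; exact: measurable_funX.
- by apply/measurable_EFinP; exact: measurable_funX.
move=> x _; have /andP[g0 gfx] := gf x.
by rewrite lee_fin -(real_normK (num_real (f x))) ler_pXn2r// nnegrE.
Qed.

Let pos_fin : (sqr_norm m pos < +oo)%E.
Proof.
by apply: part_fin => // x; rewrite pos0 ge_max ler_norm normr_ge0.
Qed.

Let neg_fin : (sqr_norm m neg < +oo)%E.
Proof.
by apply: part_fin => // x; rewrite neg0 ge_max -normrN ler_norm normr_ge0.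
Qed.

Let partsE t x : 0 < t ->
  kernel_apply f t x = kernel_apply pos t x - kernel_apply neg t x.
Proof.
move=> t0; rewrite -RintegralB//; last 2 first.
- exact: kernel_apply_integrable.
- exact: kernel_apply_integrable.
apply: eq_Rintegral => y _; rewrite -mulrBl; congr (_ * _).
by rewrite /pos /neg !maxEge; case: ifPn; case: ifPn; rewrite -?ltNge ?oppr_ge0; lra.
Qed.

Lemma kernel_apply_continuous s e : 0 < s -> 0 < e ->
  exists2 h : R, 0 < h & forall t, s <= t -> t < s + h ->
    ('N[m]_2%:E[EFin \o (kernel_apply f s \- kernel_apply f t)%R] <= e%:E)%E.
Proof.
move=> s0 e0; have e2 : 0 < e / 2 by rewrite divr_gt0.
have ee : 0 < (e / 2) ^+ 2 by rewrite exprn_gt0.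
have [h1 h10 H1] := kernel_apply_continuous_ge0 pos0 mpos pos_fin s0 ee.
have [h2 h20 H2] := kernel_apply_continuous_ge0 neg0 mneg neg_fin s0 ee.
exists (Num.min h1 h2); first by rewrite lt_min h10.
move=> t st ts; have t0 : 0 < t by exact: lt_le_trans st.
have ts1 : t < s + h1 by apply: lt_le_trans ts _; rewrite lerD2l ge_min lexx.
have ts2 : t < s + h2 by apply: lt_le_trans ts _; rewrite lerD2l ge_min lexx orbT.
have mk g : measurable_fun setT g ->
    measurable_fun setT (kernel_apply g s \- kernel_apply g t).
  by move=> mg; apply: measurable_funB; exact: kernel_apply_measurable.
rewrite (_ : kernel_apply f s \- kernel_apply f t =
    (kernel_apply pos s \- kernel_apply pos t) \+
    (fun x => - (kernel_apply neg s \- kernel_apply neg t) x)); last first.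
  by apply/funext => x /=; rewrite !partsE//; ring.
apply: le_trans (minkowski_EFin m (mk _ mpos) (measurable_funN (mk _ mneg)) _) _.
  by rewrite ler1n.
have -> : e%:E = ((e / 2)%:E + (e / 2)%:E)%E by rewrite -EFinD -splitr.
apply: leeD.
  exact: Lnorm2_le (ltW e2) (H1 _ st ts1).
rewrite (_ : EFin \o _ = \- (EFin \o (kernel_apply neg s \- kernel_apply neg t)%R))%E;
  last by apply/funext.
by rewrite oppe_Lnorm; exact: Lnorm2_le (ltW e2) (H2 _ st ts2).
Qed.

End signed.

End symmetric_kernel.

Section fubini.
Context d1 d2 (T1 : measurableType d1) (T2 : measurableType d2) (R : realType).
Variables (m1 : {measure set T1 -> \bar R}) (m2 : {measure set T2 -> \bar R}).
Hypotheses (s1 : sigma_finite setT m1) (s2 : sigma_finite setT m2).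
Variable f : T1 -> T2 -> R.
Hypothesis mf : measurable_fun setT (fun z : T1 * T2 => f z.1 z.2).

Lemma fubini : (\int[m1]_x \int[m2]_y `|f x y|%:E < +oo)%E ->
  (\int[m1]_x \int[m2]_y (f x y)%:E = \int[m2]_y \int[m1]_x (f x y)%:E)%E.
Proof.
move=> fin; pose M1 := sigma_finite_measure_of s1; pose M2 := sigma_finite_measure_of s2.
have mfE : measurable_fun setT (fun z : T1 * T2 => (f z.1 z.2)%:E).
  exact/measurable_EFinP.
apply: (@Fubini _ _ T1 T2 R M1 M2 (fun z => (f z.1 z.2)%:E)).
by apply/integrable12ltyP.
Qed.

End fubini.

Lemma integral_expR_decay (R : realType) (b : R) : 0 < b ->
  (\int[lebesgue_measure]_(s in `]0%R, +oo[) (expR (- (b * s)))%:E <= (b^-1)%:E)%E.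
Proof.
move=> b0.
have -> : (b^-1)%:E = ((b^-1)%:E * \int[lebesgue_measure]_x (exponential_pdf b x)%:E)%E.
  by rewrite integral_exponential_pdf// mule1.
rewrite -ge0_integralZl//; last 3 first.
- by apply/measurable_EFinP; exact: measurable_exponential_pdf.
- by move=> x _; rewrite lee_fin exponential_pdf_ge0// ltW.
- by rewrite lee_fin invr_ge0 ltW.
have nn x : (0 <= (b^-1)%:E * (exponential_pdf b x)%:E)%E.
  by rewrite mule_ge0 ?lee_fin ?invr_ge0 ?exponential_pdf_ge0// ltW.
have mp : measurable_fun setT (fun x => (b^-1)%:E * (exponential_pdf b x)%:E)%E.
  by apply: measurable_funeM; apply/measurable_EFinP; exact: measurable_exponential_pdf.
apply: (@le_trans _ _ (\int[lebesgue_measure]_(x in `]0%R, +oo[)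
    ((b^-1)%:E * (exponential_pdf b x)%:E))%E).
  rewrite le_eqVlt; apply/orP; left; apply/eqP; apply: eq_integral => s.
  rewrite inE /= in_itv/= andbT => s0.
  have -> : exponential_pdf b s = b * expR (- b * s) by rewrite exponential_pdfE// ltW.
  by rewrite -EFinM mulrA mulVf ?gt_eqF// mul1r mulNr.
by apply: ge0_subset_integral.
Qed.

(** * The Bochner integral of a semigroup with exponential damping *)

Section damped_bochner.
Context {R : realType}.
Variable m : {measure set R -> \bar R}.
Hypothesis msf : sigma_finite setT m.
Variable q : R -> R -> R -> R.
Hypotheses (q0 : forall t x y, 0 <= q t x y)
  (qsym : forall t x y, q t x y = q t y x)
  (mq : measurable_fun setT (fun z : R * R * R => q z.1.1 z.1.2 z.2))
  (q_sub_markov : forall t x, (\int[m]_y (q t x y)%:E <= 1)%E)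
  (q_semigroup : forall t s x y, 0 < t -> 0 < s ->
    (\int[m]_z (q t x z * q s z y)%:E = (q (t + s) x y)%:E)%E).
Variables (phi : R -> R) (C b : R).
Hypotheses (C0 : 0 < C) (b0 : 0 < b) (phi_cont : continuous phi)
  (phi_le : forall s, 0 < s -> `|phi s| <= C * expR (- (b * s))).

Notation D := (`]0%R, +oo[%classic : set R).
Notation leb := (@lebesgue_measure R).

Section function.
Variable f : R -> R.
Hypotheses (mf : measurable_fun setT f) (ffin : (sqr_norm m f < +oo)%E).

Let F s x := phi s * kernel_apply m q f s x.
(** A positive bound for the norm of [f] that avoids the root: [1 + u] exceeds the square root of
    [u]. *)
Let M := 1 + fine (sqr_norm m f).
Let a s := C * M * expR (- (b * s)).
Let A := C * M * b^-1.

Let fM : (sqr_norm m f <= (M ^+ 2)%:E)%E.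
Proof.
have f0 := sqr_norm_ge0 m f.
rewrite -(fineK (_ : sqr_norm m f \is a fin_num)) ?ge0_fin_numE// lee_fin.
rewrite /M; have := fine_ge0 f0; move: (fine _) => u u0; nra.
Qed.

Let M0 : 0 < M.
Proof. by rewrite ltr_wpDr// fine_ge0// sqr_norm_ge0. Qed.

Let a0 s : 0 < a s.
Proof. by rewrite !mulr_gt0// expR_gt0. Qed.

Let A0 : 0 < A. Proof. by rewrite !mulr_gt0// invr_gt0. Qed.

Let mexp : measurable_fun setT (fun s : R => expR (- (b * s))).
Proof. by apply: measurableT_comp => //; exact: measurable_funN. Qed.

Let ma : measurable_fun setT a. Proof. exact: measurable_funM. Qed.

Let aA : (\int[leb]_(s in D) (a s)%:E <= A%:E)%E.
Proof.
rewrite /a; under eq_integral do rewrite EFinM.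
rewrite ge0_integralZl//; last 2 first.
- by apply/measurable_EFinP; exact: measurable_funTS.
- by rewrite lee_fin mulr_ge0// ltW.
by rewrite /A (EFinM (C * M)); apply: lee_wpmul2l; [rewrite lee_fin mulr_ge0// ltW|exact: integral_expR_decay].
Qed.

Let mF : measurable_fun setT (fun z : R * R => F z.1 z.2).
Proof.
apply: measurable_funM; last exact: kernel_apply_measurable_pair.
apply: (measurableT_comp (f := phi)) => //.
exact: continuous_measurable_fun.
Qed.

Let sqr_norm_scale c (h : R -> R) : measurable_fun setT h ->
  sqr_norm m (fun x => c * h x) = ((c ^+ 2)%:E * sqr_norm m h)%E.
Proof.
move=> mh; rewrite /sqr_norm -ge0_integralZl//; last 3 first.
- by apply/measurable_EFinP; exact: measurable_funX.
- by move=> x _; rewrite lee_fin sqr_ge0.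
- by rewrite lee_fin sqr_ge0.
by apply: eq_integral => x _; rewrite -EFinM exprMn.
Qed.

Let scale_le c (B : R) (h : R -> R) : 0 <= B -> measurable_fun setT h ->
  ('N[m]_2%:E[EFin \o h] <= B%:E)%E ->
  ('N[m]_2%:E[EFin \o (fun x => c * h x)%R] <= (`|c|%R * B)%:E)%E.
Proof.
move=> B0 mh hB; apply: Lnorm2_le; first by rewrite mulr_ge0.
rewrite sqr_norm_scale// exprMn real_normK ?num_real// (EFinM (c ^+ 2)).
apply: lee_wpmul2l; first by rewrite lee_fin sqr_ge0.
exact: sqr_norm_le.
Qed.

Let kernel_norm s : 0 < s -> ('N[m]_2%:E[EFin \o kernel_apply m q f s] <= M%:E)%E.
Proof.
move=> s0; apply: Lnorm2_le; first exact: ltW.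
by apply: le_trans fM; exact: kernel_apply_contraction_signed.
Qed.

Let mk s : measurable_fun setT (kernel_apply m q f s).
Proof. exact: kernel_apply_measurable. Qed.

Let Fa s : D s -> (sqr_norm m (F s) <= (a s ^+ 2)%:E)%E.
Proof.
rewrite /= in_itv/= andbT => s0; apply: sqr_norm_le; first exact: ltW.
apply: (le_trans (scale_le (phi s) (ltW M0) (mk s) (kernel_norm s0))).
rewrite lee_fin /a mulrAC ler_wpM2r ?(ltW M0)//.
exact: phi_le.
Qed.

Let a_noninc s t : 0 < s -> s <= t -> a t <= a s.
Proof.
move=> s0 st; apply: ler_wpM2l; first by rewrite mulr_ge0// ltW.
by rewrite ler_expR lerN2; apply: ler_wpM2l => //; exact: ltW.
Qed.

Let F_right_continuous s e : 0 < s -> 0 < e ->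
  exists2 h : R, 0 < h & forall t, s <= t -> t < s + h ->
    ('N[m]_2%:E[EFin \o (F s \- F t)%R] <= e%:E)%E.
Proof.
move=> s0 e0.
(* The tolerance [e] is halved between the increment of the semigroup, multiplied by [phi s], and
   the increment of [phi], multiplied by a function of norm at most [M]. Adding 1 avoids a division
   by 0. *)
have c0 : 0 < 1 + `|phi s| by rewrite ltr_pwDl.
have e1 : 0 < e / 2 / (1 + `|phi s|) by rewrite !divr_gt0.
have e2 : 0 < e / 2 / M by rewrite !divr_gt0.
have [h1 h10 H1] := kernel_apply_continuous msf q0 qsym mq q_sub_markov q_semigroup mf ffin s0 e1.
have /cvgrPdist_lt /(_ _ e2) := @phi_cont s.
move=> /nbhs_ballP[h2 /= h20 H2].
exists (Num.min h1 h2); first by rewrite lt_min h10.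
move=> t st ts; have t0 : 0 < t by exact: lt_le_trans st.
have ts1 : t < s + h1 by apply: lt_le_trans ts _; rewrite lerD2l ge_min lexx.
have ts2 : t < s + h2 by apply: lt_le_trans ts _; rewrite lerD2l ge_min lexx orbT.
rewrite (_ : F s \- F t =
    (fun x => phi s * (kernel_apply m q f s \- kernel_apply m q f t) x) \+
    (fun x => (phi s - phi t) * kernel_apply m q f t x)); last first.
  by apply/funext => x; rewrite /F /=; ring.
have mkk : measurable_fun setT (kernel_apply m q f s \- kernel_apply m q f t).
  exact: measurable_funB.
apply: le_trans (minkowski_EFin m (measurable_funM (measurable_cst (phi s)) mkk)
  (measurable_funM (measurable_cst (phi s - phi t)) (mk t)) _) _.
  by rewrite ler1n.
have -> : e%:E = ((e / 2)%:E + (e / 2)%:E)%E by rewrite -EFinD -splitr.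
apply: leeD.
  apply: (le_trans (scale_le (phi s) (ltW e1) mkk (H1 _ st ts1))).
  rewrite lee_fin mulrA ler_pdivrMr// mulrC ler_wpM2l ?divr_ge0 ?ltW//.
  by rewrite ltrDr.
apply: (le_trans (scale_le (phi s - phi t) (ltW M0) (mk t) (kernel_norm t0))).
rewrite lee_fin -ler_pdivlMr//; apply/ltW/H2.
by rewrite /ball/= distrC ger0_norm ?subr_ge0// ltrBlDl.
Qed.

Lemma damped_integrable_ae :
  {ae m, forall x, leb.-integrable D (fun s => (phi s * kernel_apply m q f s x)%:E)}.
Proof.
exact: (kernel_integrable_ae msf (measurable_itv _) mF a0 ma A0 aA Fa).
Qed.

Lemma damped_bochner_integral :
  {ae m, forall x, bochner_integral m D (fun s x => phi s * kernel_apply m q f s x) x =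
     \int[leb]_(s in D) (phi s * kernel_apply m q f s x)}.
Proof.
exact: (bochner_integralE msf mF a0 ma A0 aA Fa a_noninc F_right_continuous).
Qed.

End function.

End damped_bochner.

Lemma is_bochner_integral_eq (R : realType) (m : {measure set R -> \bar R})
    (D : set R) (F F' : R -> R -> R) g : measurable D ->
  (forall s, D s -> F s = F' s) ->
  is_bochner_integral m D F g -> is_bochner_integral m D F' g.
Proof.
move=> mD FF' [gL FL [S [S1 S2 S3]]]; split => //.
  move: FL; apply: filterS; first exact: (ae_filter_ringOfSetsType lebesgue_measure).
  by move=> s Fs Ds; rewrite -FF'//; exact: Fs.
exists S; split => //.
  move: S1; apply: filterS; first exact: (ae_filter_ringOfSetsType lebesgue_measure).
  by move=> s Ss Ds; rewrite -FF'//; exact: Ss.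
rewrite (_ : (fun n => _) = (fun n => \int[lebesgue_measure]_(s in D)
  dist_L2 m (F s) (simple_eval (S n) s))%E)//.
by apply/funext => n; apply: eq_integral => s /set_mem Ds; rewrite FF'.
Qed.

(** The semigroup and [kernel_apply] need to agree only at positive times; the chosen representative
    is nevertheless the same function, since both kernels have the same set of Bochner integrals. *)
Lemma eq_bochner_integral (R : realType) (m : {measure set R -> \bar R})
    (D : set R) (F F' : R -> R -> R) : measurable D ->
  (forall s, D s -> F s = F' s) -> bochner_integral m D F = bochner_integral m D F'.
Proof.
move=> mD FF'; rewrite /bochner_integral; congr xget.
apply/seteqP; split => g; apply: is_bochner_integral_eq => // s Ds.
by rewrite FF'.
Qed.

(** * The representation of the Bessel operator by the last hitting time *)

Section representation.
Context {R : realType} {d : measure_display} {Omega : measurableType d}.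
Variables (l r : \bar R) (m k : {measure set R -> \bar R})
  (p : R -> R -> R -> R) (zeta : Omega -> \bar R) (X : R -> Omega -> R)
  (P : R -> probability Omega R).
Hypothesis lr : (l < r)%E.
Let E := state_space l r.
Hypothesis RD : regular_diffusion E zeta X P m k.
Hypothesis TD : transition_density E zeta X P m p.

Notation q := (ext_density l r p).

Let q0 := ext_density_ge0 TD.
Let qsym := ext_density_sym TD.

Notation leb := (@lebesgue_measure R).
Notation potential := (potential l r p).
Hypothesis tr : transient E zeta X P.
Variables (alpha t : R).
Hypotheses (alpha0 : 0 < alpha) (t0 : 0 < t).

Local Notation last := (last_hitting_time zeta X).
Local Notation phi := (bessel_kernel alpha t).
Notation D := (`]0%R, +oo[%classic : set R).

Let msf : sigma_finite setT m := speed_sigma_finite lr RD.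
Let mq := ext_density_measurable TD.
Let qsub := ext_density_sub_markov RD TD.
Let qsemi := fun t s x y => @chapman_kolmogorov _ _ _ _ _ _ _ _ _ _ _ lr RD TD t s x y.

Let mphi : measurable_fun setT phi := bessel_kernel_measurable alpha t.

(** Off the support the last hitting time is 0 or [+oo], and there the variable is 0 by the
    indicator or by its default value. On the support the law has the density found above. *)
Lemma expectation_bessel_last_hitting x y : E x -> E y ->
  ('E_(P y)[bessel_last_hitting zeta X alpha t x] =
  \int[leb]_s (phi s * (q s y x / fine (potential x x)))%R%:E)%E.
Proof.
move=> Ex Ey; set u := fine (potential x x).
have u0 : 0 <= u by rewrite fine_ge0// (potential_ge0 TD).
rewrite -(@integral_density _ _ _ _ R (P y) leb (last_hitting_support zeta X x)
  (fine \o last x : Omega -> measurableTypeR R) (fun s => q s y x / u) phi) //; last 5 first.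
- exact: (last_hitting_support_measurable RD x).
- by apply: measurable_funTS; exact: (fine_last_hitting_measurable RD x).
- by move=> s; rewrite divr_ge0.
- by apply: measurable_funM => //; apply/measurable_EFinP; exact: (density_time_measurable TD).
- by move=> B mB; exact: (last_hitting_density lr RD TD tr Ex Ey mB).
rewrite unlock integral_mkcond [RHS]integral_mkcond; apply: eq_integral => w _.
rewrite !patchE in_setT /bessel_last_hitting.
have G0 := @last_hitting_ge0 R d Omega zeta X x w.
case: ifPn => [|h].
  rewrite inE /last_hitting_support /=; case: (last x w) => [g| |]//=.
    by rewrite !lte_fin => /andP[g0 _]; rewrite g0 mulr1.
  by rewrite ltxx andbF.
move: h; rewrite notin_setE /last_hitting_support /=; case: (last x w) G0 => [g| |]//=.
rewrite lee_fin lte_fin ltry andbT => g0 h.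
by rewrite (_ : (0 < g) = false) ?mulr0//; apply/negP.
Qed.

Lemma semigroup_kernel_apply f s : 0 < s ->
  semigroup E m p s f = kernel_apply m q f s.
Proof.
move=> s0; apply/funext => x; rewrite /semigroup patchE /kernel_apply.
case: ifPn => [/set_mem Ex|/negP nEx].
  rewrite Rintegral_mkcond; apply: eq_Rintegral => y _; rewrite patchE.
  case: ifPn => [/set_mem Ey|/negP nEy]; first by rewrite ext_density_in.
  by rewrite ext_density_out ?mulr0// => -[_ _ Ey]; apply: nEy; rewrite inE.
rewrite /Rintegral (eq_integral (fun=> 0%E)) ?integral0// => y _.
by rewrite ext_density_out ?mulr0// => -[_ Ex]; case: nEx; rewrite inE.
Qed.

Lemma kernel_density_integrable x y : E x -> E y ->
  leb.-integrable setT (fun s => (phi s * (q s y x / fine (potential x x)))%:E).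
Proof.
move=> Ex Ey; set u := fine (potential x x).
have u0 : 0 <= u by rewrite fine_ge0// (potential_ge0 TD).
have mqs : measurable_fun setT (fun s => q s y x).
  by apply/measurable_EFinP; exact: (density_time_measurable TD).
apply/integrableP; split.
  by apply/measurable_EFinP; apply: measurable_funM => //; exact: measurable_funM.
(* The kernel is bounded by [expR (2 * t / alpha)], and no damping has to be kept here: the time
   integral of [q s y x] is the finite potential. *)
pose C := expR (2 * t / alpha) / u.
have C0 : 0 <= C by rewrite divr_ge0// expR_ge0.
have bound s : `|phi s * (q s y x / u)| <= C * q s y x.
  have [s0|s0] := ltP 0 s; last first.
    by rewrite ext_density_out ?mul0r ?mulr0 ?normr0// => -[]; rewrite ltNge s0.
  rewrite normrM [X in _ * X]ger0_norm ?divr_ge0//.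
  rewrite (_ : C * q s y x = expR (2 * t / alpha) * (q s y x / u)); last first.
    by rewrite /C; ring.
  rewrite ler_wpM2r ?divr_ge0//.
  apply: (le_trans (bessel_kernel_bound alpha0 (ltW t0) (ltW s0))).
  rewrite ler_piMr ?expR_ge0// -expR0 ler_expR oppr_le0 mulr_ge0 ?(ltW s0)//.
  by rewrite divr_ge0// ltW.
apply: (@le_lt_trans _ _ (\int[leb]_s (C%:E * (q s y x)%:E))%E).
  apply: ge0_le_integral => //.
  - apply/measurable_EFinP; apply: measurableT_comp => //.
    by apply: measurable_funM => //; exact: measurable_funM.
  - by apply: measurable_funeM; exact/measurable_EFinP.
  - by move=> s _; rewrite /= -EFinM lee_fin.
rewrite ge0_integralZl//; last 2 first.
- exact/measurable_EFinP.
- by move=> s _; rewrite lee_fin.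
apply: lte_mul_pinfty; rewrite ?lee_fin//.
apply: le_lt_trans (potential_fin lr RD TD tr Ey Ex).
rewrite le_eqVlt; apply/orP; left; apply/eqP; rewrite [RHS]integral_mkcond.
apply: eq_integral => s _; rewrite patchE; case: ifPn => //.
rewrite notin_setE /= in_itv/= andbT => s0.
by rewrite ext_density_out// => -[] /s0.
Qed.

Section function.
Variable f : R -> R.
Hypotheses (mf : measurable_fun setT f) (ffin : (sqr_norm m f < +oo)%E).

Let g y := `|f y|.
Let mg : measurable_fun setT g. Proof. exact: measurableT_comp. Qed.
Let g0 y : 0 <= g y. Proof. exact: normr_ge0. Qed.
Let gfin : (sqr_norm m g < +oo)%E.
Proof.
rewrite (_ : sqr_norm m g = sqr_norm m f)//.
by apply: eq_integral => x _; rewrite /g real_normK ?num_real.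
Qed.

Let Dcase s : (0 < s) = (s \in D).
Proof. by apply/idP/idP; rewrite inE /= in_itv/= andbT. Qed.

(** The integrability for the absolute value of [f] is precisely the condition for exchanging the
    integrals over [y] and over time; symmetry then turns the density from [y] to [x] into the
    semigroup at [x], and [potential x x] cancels the normalisation of the law. *)
Lemma potential_expectationE x : E x ->
  leb.-integrable D (fun s => (phi s * kernel_apply m q g s x)%:E) ->
  leb.-integrable D (fun s => (phi s * kernel_apply m q f s x)%:E) ->
  (potential x x * expectation_density E P m f (bessel_last_hitting zeta X alpha t x) =
   (\int[leb]_(s in D) (phi s * kernel_apply m q f s x)%R)%R%:E)%E.
Proof.
move=> Ex ig ifs; set u := fine (potential x x).
have Ufin : potential x x \is a fin_num.
  by rewrite ge0_fin_numE ?(potential_ge0 TD)// (potential_fin lr RD TD tr).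
have u0 : 0 < u.
  by rewrite fine_gt0// (potential_diag_gt0 lr RD TD)//= -ge0_fin_numE// (potential_ge0 TD).
pose G y s := f y * (phi s * (q s y x / u)).
have mqG : measurable_fun setT (fun z : R * R => q z.2 z.1 x).
  apply: (measurableT_comp (f := fun z : R * R * R => q z.1.1 z.1.2 z.2)
    (g := fun z : R * R => ((z.2, z.1), x)) mq).
  by apply: measurable_fun_pair => //; apply: measurable_fun_pair.
have mG : measurable_fun setT (fun z : R * R => G z.1 z.2).
  apply: measurable_funM; first exact: measurableT_comp.
  apply: measurable_funM; first exact: (measurableT_comp mphi).
  exact: measurable_funM.
have Gout s : ~ 0 < s -> forall y, G y s = 0.
  by move=> s0 y; rewrite /G ext_density_out ?mul0r ?mulr0// => -[].
have E1 : expectation_density E P m f (bessel_last_hitting zeta X alpha t x) =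
    (\int[m]_y \int[leb]_s (G y s)%:E)%E.
  rewrite /expectation_density integral_mkcond; apply: eq_integral => y _.
  rewrite patchE; case: ifPn => [/set_mem Ey|/negP nEy].
    rewrite expectation_bessel_last_hitting// muleC -integralZl//.
    exact: kernel_density_integrable.
  rewrite (eq_integral (fun=> 0%E)) ?integral0// => s _.
  by rewrite /G ext_density_out ?mul0r ?mulr0// => -[_ Ey]; case: nEy; rewrite inE.
have GE s y : 0 < s -> G y s = (phi s / u) * (f y * q s x y).
  by move=> s0; rewrite /G qsym; ring.
have E2 s : 0 < s -> (\int[m]_y `|G y s|%:E =
    (u^-1)%:E * `|phi s * kernel_apply m q g s x|%:E)%E.
  move=> s0.
  have K0 : 0 <= kernel_apply m q g s x.
    by apply: Rintegral_ge0 => y _; rewrite mulr_ge0.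
  rewrite (normrM (phi s)) [`|kernel_apply _ _ _ _ _|]ger0_norm// EFinM muleA -(EFinM u^-1).
  rewrite kernel_applyE// -ge0_integralZl//; last 3 first.
  - by apply/measurable_EFinP; apply: measurable_funM => //; exact: (ext_density_measurable2 TD s x).
  - by move=> y _; rewrite lee_fin mulr_ge0.
  - by rewrite lee_fin mulr_ge0// invr_ge0 ltW.
  apply: eq_integral => y _; rewrite GE// -EFinM (normrM (phi s / u)) (normrM (phi s)) (normrM (f y)).
  rewrite [`|q s x y|]ger0_norm// [`|u^-1|]ger0_norm ?invr_ge0 ?(ltW u0)//.
  by congr (_%:E); rewrite /g; ring.
have E3 s : 0 < s -> (\int[m]_y (G y s)%:E =
    (u^-1)%:E * (phi s * kernel_apply m q f s x)%:E)%E.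
  move=> s0; rewrite EFinM muleA -(EFinM u^-1) kernel_applyE// -integralZl//; last first.
    exact: kernel_apply_integrable.
  by apply: eq_integral => y _; rewrite GE// -EFinM; congr (_%:E); ring.
rewrite E1 (fubini msf (sigma_finiteT leb) mG); last first.
  rewrite (tonelli msf (sigma_finiteT leb) (f := fun y s => `|G y s|%:E))//; last first.
    by apply/measurable_EFinP; exact: measurableT_comp.
  rewrite (_ : (\int[leb]_s \int[m]_y `|G y s|%:E =
    \int[leb]_(s in D) ((u^-1)%:E * `|phi s * kernel_apply m q g s x|%:E))%E); last first.
    rewrite [RHS]integral_mkcond; apply: eq_integral => s _; rewrite patchE -Dcase.
    case: ifPn => [s0|/negP s0]; first by rewrite E2.
    by rewrite (eq_integral (fun=> 0%E)) ?integral0// => y _; rewrite Gout ?normr0.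
  case/integrableP: ig => mig fig.
  rewrite ge0_integralZl//; last 2 first.
  - apply/measurable_EFinP; apply: measurableT_comp => //.
    exact/measurable_EFinP.
  - by rewrite lee_fin invr_ge0 ltW.
  by apply: lte_mul_pinfty; rewrite ?lee_fin ?invr_ge0// ltW.
rewrite (_ : (\int[leb]_s \int[m]_y (G y s)%:E =
    \int[leb]_(s in D) ((u^-1)%:E * (phi s * kernel_apply m q f s x)%:E))%E); last first.
  rewrite [RHS]integral_mkcond; apply: eq_integral => s _; rewrite patchE -Dcase.
  case: ifPn => [s0|/negP s0]; first by rewrite E3.
  by rewrite (eq_integral (fun=> 0%E)) ?integral0// => y _; rewrite Gout.
rewrite integralZl// -(fineK Ufin) muleA -EFinM mulfV ?gt_eqF// mul1e.
by rewrite /Rintegral fineK//; apply: integrable_fin_num.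
Qed.

Lemma bessel_operatorE : {ae m, forall x, E x ->
  (bessel_operator E m p alpha t f x)%:E =
  (potential_kernel p x x *
   expectation_density E P m f (bessel_last_hitting zeta X alpha t x))%E}.
Proof.
have C0 : 0 < expR (2 * t / alpha) by exact: expR_gt0.
have b0 : 0 < alpha / 2 by rewrite divr_gt0.
have phi_cont : continuous phi := @bessel_kernel_continuous R alpha t.
have phi_le s : 0 < s -> `|phi s| <= expR (2 * t / alpha) * expR (- (alpha / 2 * s)).
  by move=> s0; exact: (bessel_kernel_bound alpha0 (ltW t0) (ltW s0)).
have H1 := damped_integrable_ae msf q0 qsym mq qsub qsemi C0 b0 phi_cont phi_le mg gfin.
have H2 := damped_integrable_ae msf q0 qsym mq qsub qsemi C0 b0 phi_cont phi_le mf ffin.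
have H3 := damped_bochner_integral msf q0 qsym mq qsub qsemi C0 b0 phi_cont phi_le mf ffin.
have BE : bessel_operator E m p alpha t f =
    bochner_integral m D (fun s x => phi s * kernel_apply m q f s x).
  apply: eq_bochner_integral => // s; rewrite /= in_itv/= andbT => s0.
  by apply/funext => x; rewrite semigroup_kernel_apply.
(* The exceptional set consists of the points where a time integral, for [f] or its absolute value,
   does not converge absolutely, or where the chosen representative differs from the pointwise
   integral. *)
move: H1 H2 H3; apply: filterS3 => x h1 h2 h3 Ex.
rewrite BE h3 (potential_kernelE _ Ex Ex).
by rewrite potential_expectationE.
Qed.

End function.

End representation.
Theorem proposition2p3 (R : realType) (d : measure_display)
    (Omega : measurableType d) (l r : \bar R)
    (m k : {measure set R -> \bar R}) (p : R -> R -> R -> R)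
    (zeta : Omega -> \bar R) (X : R -> Omega -> R)
    (P : R -> probability Omega R) (f : R -> R) (alpha t : R) :
  let E := state_space l r in
  (l < r)%E ->
  regular_diffusion E zeta X P m k ->
  transition_density E zeta X P m p ->
  transient E zeta X P ->
  f \in Lfun m 2%:E ->
  0 < alpha -> 0 < t ->
  {ae m, forall x, E x ->
    (bessel_operator E m p alpha t f x)%:E =
    (potential_kernel p x x *
     expectation_density E P m f (bessel_last_hitting zeta X alpha t x))%E}.
Proof.
move=> E lr RD TD tr /[dup] /Lfun2_measurable mf /Lfun2_sqr_norm ffin a0 t0.
exact: (bessel_operatorE lr RD TD tr a0 t0 mf ffin).
Qed.
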